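(* (i) Let $X=\ell_1$ endowed with the convolution product and let $\lambda>1$. Then $\lambda B$ admits an upper frequently hypercyclic algebra. (ii) Let $X=H(\mathbb C)$ endowed with the convolution product (i.e. the pointwise product of entire functions). Then the derivation operator $D:f\mapsto f'$ admits an upper frequently hypercyclic algebra.
   Context: $\ell_1$ is the space of absolutely summable complex sequences $(x_n)_{n\ge0}$, and $B(x_0,x_1,\dots)=(x_1,x_2,\dots)$ is the unweighted backward shift. The convolution (Cauchy) product is $(x\cdot y)_n=\sum_{j=0}^nx_jy_{n-j}$. $H(\mathbb C)$ is the Fréchet space of entire functions with the topology of uniform convergence on compact sets, identified with a space of sequences via Taylor coefficients at $0$; the convolution product of Taylor coefficients corresponds to the usual product of functions. A vector $x\in X$ is upper frequently hypercyclic for a continuous linear operator $T$ on $X$ if, for every non-empty open $U\subset X$, the set $\{n\in\mathbb N:T^nx\in U\}$ has positive upper density. An upper frequently hypercyclic algebra for $T$ is a subalgebra of $X$, different from $\{0\}$ and not required to be unital, all of whose nonzero elements are upper frequently hypercyclic vectors for $T$. *)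

(* Defs.v *)
From HB Require Import structures.
From mathcomp Require Import all_boot all_order all_algebra.
From mathcomp Require Import all_classical all_reals all_analysis.
From mathcomp Require Import complex.

Set Implicit Arguments.
Unset Strict Implicit.
Unset Printing Implicit Defensive.

Import Order.TTheory GRing.Theory Num.Theory.
Import numFieldNormedType.Exports.
Import Normc.

Local Open Scope classical_set_scope.
Local Open Scope ring_scope.
Local Open Scope complex_scope.

HB.instance Definition _ (R : realType) := NormedModule.copy R[i] R[i]^o.

Definition upper_density (R : realType) (A : set nat) : \bar R :=
  limn_esup (fun N : nat =>
    (#|[pred k : 'I_N.+1 | `[< A k >]]|%:R / N.+1%:R)%:E).

(* [X] is a subset of an ambient space [E], given the subspace topology: its
   open sets are the traces [X `&` U] of the open sets [U] of [E]. *)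
Definition upper_frequently_hypercyclic (R : realType) (E : topologicalType)
    (X : set E) (T : E -> E) (x : E) : Prop :=
  X x /\
  forall U : set E, open U -> X `&` U !=set0 ->
    (0 < upper_density R [set n | (X `&` U) (iter n T x)])%E.

Definition is_subalgebra (K : pzRingType) (E : lmodType K)
    (mul : E -> E -> E) (A : set E) : Prop :=
  [/\ A 0,
      forall x y, A x -> A y -> A (x + y),
      forall (a : K) x, A x -> A (a *: x)
    & forall x y, A x -> A y -> A (mul x y)].

Definition upper_frequently_hypercyclic_algebra (R : realType)
    (E : preTopologicalLmodType R[i]) (X : set E) (mul : E -> E -> E) (T : E -> E) (A : set E) : Prop :=
  [/\ A `<=` X, is_subalgebra mul A, A <> [set 0]
    & forall x, A x -> x <> 0 -> upper_frequently_hypercyclic R X T x].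

Section l1norm.
Variable R : realType.
Implicit Types (x y : nat -> R[i]).

Lemma normc_ge0 (z : R[i]) : 0 <= normc z.
Proof. by case: z => a b /=; exact: sqrtr_ge0. Qed.

Lemma normr_normc (z : R[i]) : `|z| = (normc z)%:C.
Proof. by rewrite normc_def; case: z. Qed.

Lemma normc_sum (I : Type) (r : seq I) (P : pred I) (F : I -> R[i]) :
  normc (\sum_(i <- r | P i) F i) <= \sum_(i <- r | P i) normc (F i).
Proof.
apply: (big_ind2 (fun a b => normc a <= b)) => //; first by rewrite normc0.
by move=> a b c d ab cd; rewrite (le_trans (le_normcD _ _))// lerD.
Qed.

Definition l1norm x : \bar R := (\sum_(n <oo) (normc (x n))%:E)%E.

Lemma l1norm_ge0 x : (0 <= l1norm x)%E.
Proof. by apply: nneseries_ge0 => n _ _; rewrite lee_fin normc_ge0. Qed.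

Lemma l1norm0 : l1norm 0 = 0%E.
Proof. by apply: eseries0 => n _ _; rewrite [normc _]normc0. Qed.

Lemma l1normD x y : (l1norm (x + y)%R <= l1norm x + l1norm y)%E.
Proof.
rewrite -nneseriesD; last 2 first.
- by move=> n _ _; rewrite lee_fin normc_ge0.
- by move=> n _ _; rewrite lee_fin normc_ge0.
apply: lee_nneseries => n *; first by rewrite lee_fin normc_ge0.
by rewrite -EFinD lee_fin le_normcD.
Qed.

Lemma l1normZ (a : R[i]) x : l1norm (a *: x) = ((normc a)%:E * l1norm x)%E.
Proof.
rewrite -nneseriesZl; last by move=> n _; rewrite lee_fin normc_ge0.
by apply: eq_eseriesr => n _; rewrite -EFinM -normcM.
Qed.

Lemma l1norm_partial x N : ((\sum_(n < N) normc (x n))%:E <= l1norm x)%E.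
Proof.
rewrite -sumEFin -(big_mkord xpredT (fun n => (normc (x n))%:E)).
by apply: nneseries_lim_ge => n _ _; rewrite lee_fin normc_ge0.
Qed.

Lemma l1norm_le x (M : \bar R) :
  (forall N, ((\sum_(n < N) normc (x n))%:E <= M)%E) -> (l1norm x <= M)%E.
Proof.
move=> xM; apply: lime_le.
  by apply: is_cvg_nneseries => n _ _; rewrite lee_fin normc_ge0.
by apply: nearW => N; rewrite big_mkord sumEFin.
Qed.

Definition seq_shift x : nat -> R[i] := fun n => x n.+1.

Lemma l1norm_shift x : (l1norm (seq_shift x) <= l1norm x)%E.
Proof.
apply: l1norm_le => N; apply: le_trans (l1norm_partial x N.+1).
by rewrite lee_fin big_ord_recl lerDr normc_ge0.
Qed.

Definition cauchy_product x y : nat -> R[i] :=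
  fun n => \sum_(j < n.+1) x j * y (n - j)%N.

Lemma l1norm_cauchy_product x y :
  (l1norm (cauchy_product x y) <= l1norm x * l1norm y)%E.
Proof.
apply: l1norm_le => N.
apply: (@le_trans _ _
  ((\sum_(n < N) normc (x n))%:E * (\sum_(n < N) normc (y n))%:E)%E); last first.
  apply: lee_pmul; rewrite ?l1norm_partial// lee_fin;
    by apply: sumr_ge0 => n _; exact: normc_ge0.
rewrite -EFinM lee_fin mulr_suml.
pose F (n j : nat) := if (j <= n)%N then normc (x j) * normc (y (n - j)%N) else 0.
apply: (@le_trans _ _ (\sum_(n < N) \sum_(j < N) F n j)).
  apply: ler_sum => n _; apply: (le_trans (normc_sum _ _ _)).
  rewrite (big_ord_widen N (fun j => normc (x j * y (n - j)%N))) // big_mkcond.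
  by apply: ler_sum => j _; rewrite ltnS /F; case: ifP; rewrite ?normcM.
rewrite exchange_big; apply: ler_sum => j _ /=; rewrite mulr_sumr.
rewrite -(big_mkord xpredT (F^~ j)) (big_cat_nat _ (n := j)) ?(ltnW (ltn_ord j))//=.
rewrite big_nat big1 ?add0r; last by move=> n; rewrite /F ltnNge => /andP[_ /negbTE->].
rewrite -{1}(add0n j : (0 + j)%N = j) big_addn big_mkord.
rewrite (big_ord_widen N (fun n => F (n + j)%N j)) ?leq_subr// big_mkcond.
apply: ler_sum => n _; rewrite /F leq_addl addnK.
by case: ifP => // _; rewrite mulr_ge0 ?normc_ge0.
Qed.

Definition summable_pred : {pred nat -> R[i]} :=
  [pred x : nat -> R[i] | (l1norm x < +oo)%E].

Lemma summable_zmod_closed : zmod_closed summable_pred.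
Proof.
split=> [|x y]; rewrite !inE; first by rewrite l1norm0 ltry.
move=> xoo yoo; apply: (le_lt_trans (l1normD _ _)); apply: lte_add_pinfty => //.
rewrite -scaleN1r l1normZ.
by rewrite normcN normc1 mul1e.
Qed.

Lemma summable_scaler_closed : GRing.scaler_closed summable_pred.
Proof.
move=> a x; rewrite !inE l1normZ => xoo.
by rewrite lte_mul_pinfty ?lee_fin ?normc_ge0.
Qed.

HB.instance Definition _ :=
  GRing.isZmodClosed.Build _ summable_pred summable_zmod_closed.
HB.instance Definition _ :=
  GRing.isScaleClosed.Build _ _ summable_pred summable_scaler_closed.

End l1norm.

Section ell1.
Variable R : realType.

Record ell1 := Ell1 { ell1_val :> nat -> R[i]; _ : ell1_val \in @summable_pred R }.

HB.instance Definition _ := [isSub for ell1_val].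
HB.instance Definition _ := [Choice of ell1 by <:].
HB.instance Definition _ := [SubChoice_isSubLmodule of ell1 by <:].

Implicit Types x y : ell1.

Lemma ell1P x : (l1norm x < +oo)%E.
Proof. by have := valP x; rewrite inE. Qed.

Lemma l1norm_fin_num x : l1norm x \is a fin_num.
Proof. by rewrite ge0_fin_numE ?l1norm_ge0 ?ell1P. Qed.

Definition ell1_norm x : R[i] := (fine (l1norm x))%:C.

Lemma ell1_normD x y : ell1_norm (x + y) <= ell1_norm x + ell1_norm y.
Proof.
rewrite -rmorphD lecR -lee_fin EFinD !fineK ?l1norm_fin_num//.
exact: l1normD.
Qed.

Lemma ell1_normZ (a : R[i]) x : ell1_norm (a *: x) = `|a| * ell1_norm x.
Proof.
rewrite normr_normc -rmorphM; congr (_%:C).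
by rewrite [LHS](congr1 fine (l1normZ a x)) fineM ?l1norm_fin_num.
Qed.

Lemma ell1_norm0_eq0 x : ell1_norm x = 0 -> x = 0.
Proof.
move=> /(congr1 (@complex.Re R)) /= x0.
have {}x0 : l1norm x = 0%E by rewrite -(fineK (l1norm_fin_num x)) x0.
apply: val_inj; apply: funext => n /=; apply: eq0_normc.
apply/eqP; rewrite eq_le normc_ge0 andbT -lee_fin -(x0 : _ = 0%:E).
apply: le_trans (l1norm_partial x n.+1).
by rewrite lee_fin big_ord_recr/= lerDr sumr_ge0// => i _; exact: normc_ge0.
Qed.

HB.instance Definition _ :=
  Lmodule_isNormed.Build R[i] ell1 ell1_normD ell1_normZ ell1_norm0_eq0.

Lemma backward_shift_subproof x : seq_shift x \in @summable_pred R.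
Proof. by rewrite inE (le_lt_trans (l1norm_shift _))// ell1P. Qed.

Definition backward_shift x : ell1 := Ell1 (backward_shift_subproof x).

Lemma ell1_conv_subproof x y : cauchy_product x y \in @summable_pred R.
Proof.
rewrite inE (le_lt_trans (l1norm_cauchy_product _ _))//.
by rewrite lte_mul_pinfty ?l1norm_ge0 ?l1norm_fin_num ?ell1P.
Qed.

Definition ell1_conv x y : ell1 := Ell1 (ell1_conv_subproof x y).

End ell1.

Section entire.
Variable R : realType.

Definition compact_cvg_fun : Type := {family compact, R[i] -> R[i]}.

HB.instance Definition _ := Uniform.on compact_cvg_fun.
HB.instance Definition _ := GRing.Lmodule.copy compact_cvg_fun (R[i] -> R[i]).

(* [R[i]] is its own scalar field here, so [derivable] in the direction 1 and
   [derive1] are complex differentiability and the complex derivative. *)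
Definition entire : set compact_cvg_fun :=
  [set f | forall z : R[i], derivable (f : R[i] -> R[i]) z 1].

Definition fun_mul (f g : compact_cvg_fun) : compact_cvg_fun :=
  fun z => f z * g z.

(* Total on the ambient space; it is only used on entire functions, which it
   maps to entire functions. *)
Definition derivation (f : compact_cvg_fun) : compact_cvg_fun :=
  derive1 (f : R[i] -> R[i]).

End entire.

(* Main.v *)
(* Both operators are weighted backward shifts T on power series, with
   T^n e_(i+n) = (W (i+n) / W i) e_i for W n = lambda^n and W n = n!, and both
   products are the Cauchy product. The algebra is generated, without unit, by one
   element x, the limit of polynomials u_t; no Baire category argument is needed.

   Given u, a target polynomial y and a degree m, one adds to u a perturbation
   v = delta X^N + w, where w carries small copies of y along an arithmetic
   progression of positions M_k. For P monic of degree m, the cross term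
   m (delta X^N)^(m-1) w of P(u + v) carries these copies to the positions
   n_k = 2h + kp, 0 <= k <= h/p, so that T^(n_k) P(u + v) is close to y for all
   these k at once. The terms of lower order in X^N are small for N large, those
   of second order in w are small for h large since n_i + n_j - n_k >= h, and the
   terms without w have degree at most mN < n_k. As p does not depend on u and m,
   the return times n_k, which all lie below 3h, have upper density at least
   1/(4p).

   In H(C) one must moreover approximate a function that is merely complex
   differentiable by polynomials. Goursat's theorem on rectangles moves the
   integral of f(t) (1 - (z - t)^2)^n over a real segment, which is a polynomial
   in z, to the height of z, where Landau's kernel is a real approximate
   identity. *)

Require Import Defs.
From mathcomp Require Import all_boot all_order all_algebra.
From mathcomp Require Import all_classical all_reals all_analysis.
From mathcomp Require Import complex ring lra zify.

Set Implicit Arguments.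
Unset Strict Implicit.
Unset Printing Implicit Defensive.

Import Order.TTheory GRing.Theory Num.Theory.
Import numFieldNormedType.Exports.
Import Normc.

Local Open Scope classical_set_scope.
Local Open Scope ring_scope.
Local Open Scope complex_scope.

(** Positive upper density survives infinitely many stages only if the same period [p] is used
    whenever a target and a precision recur, whereas N, delta and h may depend on everything built
    before. The order of choice is therefore p, then N and delta, then h. The period can come first
    because each estimate on the copies is a sum along an arithmetic progression, bounded by a full
    geometric series whatever the number of copies, their starting point and the shift applied. The
    term delta X^N answers another difficulty: w enters P(u + w) through the factor P'(u), which may
    vanish and offers nothing to invert. After delta X^N is added, this factor has an explicit
    leading monomial, which is compensated by dividing w by a constant and moving it down by the
    degree of the monomial. The constant grows exponentially with N; the gap between the leading
    monomial and all the others grows with N too, and the weight of this gap wins. A stage achieves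
    its goal on a whole ball of polynomials, so later stages, whose corrections sum to less than the
    radius, preserve it. *)

(** * Coefficient norms of polynomials *)

Section CoefficientNorm.
Variable R : realType.
Implicit Types (p q : {poly R[i]}) (r s : R) (z : R[i]).

Lemma normcR (a : R) : normc a%:C = `|a|.
Proof. by rewrite /normc /= expr0n /= addr0 sqrtr_sqr. Qed.

Lemma normcR_ge0 (a : R) : 0 <= a -> normc a%:C = a.
Proof. by move=> a0; rewrite normcR ger0_norm. Qed.

Lemma normcX z n : normc (z ^+ n) = normc z ^+ n.
Proof. by elim: n => [|n IH]; rewrite ?normc1// !exprS normcM IH. Qed.

Lemma normc_nat n : normc (n%:R : R[i]) = n%:R.
Proof. by rewrite -(rmorph_nat (real_complex R)) normcR_ge0. Qed.

Lemma normc_gt0 z : (0 < normc z) = (z != 0).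
Proof.
rewrite lt_def normc_ge0 andbT; congr negb.
by apply/eqP/eqP => [/eq0_normc|->] //; rewrite normc0.
Qed.

(** At [r = 1] this is the norm of l1. For all [r >= 1] together these norms dominate uniform
    convergence on discs and are submultiplicative, which the suprema on discs would not make
    visible on coefficients. *)
Definition pnorm r p : R := \sum_(i < size p) normc p`_i * r ^+ i.

Lemma pnorm_widen n r p : (size p <= n)%N ->
  pnorm r p = \sum_(i < n) normc p`_i * r ^+ i.
Proof.
move=> pn; rewrite /pnorm (big_ord_widen n (fun i => normc p`_i * r ^+ i))//.
rewrite big_mkcond; apply: eq_bigr => i _; case: ltnP => // pi.
by rewrite nth_default// normc0 mul0r.
Qed.

Lemma pnorm_ge0 r p : 0 <= r -> 0 <= pnorm r p.
Proof. by move=> r0; apply: sumr_ge0 => i _; rewrite mulr_ge0 ?normc_ge0 ?exprn_ge0. Qed.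

Lemma pnormD r p q : 0 <= r -> pnorm r (p + q) <= pnorm r p + pnorm r q.
Proof.
move=> r0; set n := maxn (size p) (size q).
rewrite !(@pnorm_widen n) ?leq_maxl ?leq_maxr ?size_polyD//.
rewrite -big_split/=; apply: ler_sum => i _.
by rewrite coefD -mulrDl ler_wpM2r ?exprn_ge0 ?le_normcD.
Qed.

Lemma pnormZ r (a : R[i]) p : pnorm r (a *: p) = normc a * pnorm r p.
Proof.
rewrite (@pnorm_widen (size p)) ?size_scale_leq// mulr_sumr.
by apply: eq_bigr => i _; rewrite coefZ normcM mulrA.
Qed.

Lemma pnormN r p : pnorm r (- p) = pnorm r p.
Proof. by rewrite -scaleN1r pnormZ normcN normc1 mul1r. Qed.

Lemma pnorm0 r : pnorm r 0 = 0.
Proof. by rewrite /pnorm size_poly0 big_ord0. Qed.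

Lemma pnormB r p q : 0 <= r -> pnorm r (p - q) <= pnorm r p + pnorm r q.
Proof. by move=> r0; rewrite -[pnorm r q]pnormN pnormD. Qed.

Lemma pnorm_sum r (I : Type) (s : seq I) (P : pred I) (F : I -> {poly R[i]}) :
  0 <= r -> pnorm r (\sum_(i <- s | P i) F i) <= \sum_(i <- s | P i) pnorm r (F i).
Proof.
move=> r0; apply: (big_ind2 (fun a b => pnorm r a <= b)) => //.
  by rewrite pnorm0.
by move=> a b c d ab cd; rewrite (le_trans (pnormD _ _ _))// lerD.
Qed.

Lemma pnormMXn r p n : pnorm r (p * 'X^n) = pnorm r p * r ^+ n.
Proof.
rewrite (@pnorm_widen (n + size p)); last first.
  by rewrite (leq_trans (size_polyMleq _ _))// size_polyXn addnS /= addnC.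
rewrite big_split_ord/= big1 ?add0r; last first.
  by move=> i _; rewrite coefMXn ltn_ord normc0 mul0r.
rewrite mulr_suml; apply: eq_bigr => i _.
by rewrite coefMXn ltnNge leq_addr/= addKn exprD; ring.
Qed.

Lemma pnorm1 r : pnorm r 1 = 1.
Proof. by rewrite /pnorm size_poly1 big_ord1 coef1 normc1 mul1r. Qed.

Lemma pnormM r p q : 0 <= r -> pnorm r (p * q) <= pnorm r p * pnorm r q.
Proof.
move=> r0; rewrite {1}(_ : q = \sum_(i < size q) q`_i *: 'X^i); last first.
  by rewrite -[LHS]coefK poly_def.
rewrite mulr_sumr (le_trans (pnorm_sum _ _ _ r0))// [X in _ * X]/pnorm mulr_sumr.
by apply: ler_sum => i _; rewrite -scalerAr pnormZ pnormMXn mulrCA.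
Qed.

Lemma pnormX r p n : 0 <= r -> pnorm r (p ^+ n) <= pnorm r p ^+ n.
Proof.
move=> r0; elim: n => [|n IH]; first by rewrite !expr0 pnorm1.
by rewrite !exprS (le_trans (pnormM _ _ r0))// ler_wpM2l ?pnorm_ge0.
Qed.

Lemma pnorm_le r s p : 0 <= r -> r <= s -> pnorm r p <= pnorm s p.
Proof.
move=> r0 rs; apply: ler_sum => i _.
by rewrite ler_wpM2l ?normc_ge0// lerXn2r// nnegrE (le_trans r0).
Qed.

Lemma normc_horner p z : normc p.[z] <= pnorm (normc z) p.
Proof.
rewrite horner_coef (le_trans (normc_sum _ _ _))//.
by apply: ler_sum => i _; rewrite normcM normcX.
Qed.

Lemma pnorm_partial r p n : 0 <= r -> \sum_(i < n) normc p`_i * r ^+ i <= pnorm r p.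
Proof.
move=> r0; rewrite (@pnorm_widen (maxn n (size p))) ?leq_maxr//.
rewrite (big_ord_widen (maxn n (size p)) (fun i => normc p`_i * r ^+ i)) ?leq_maxl//.
rewrite big_mkcond; apply: ler_sum => i _; case: ifP => // _.
by rewrite mulr_ge0 ?normc_ge0 ?exprn_ge0.
Qed.

End CoefficientNorm.

(** * First and second order expansions of powers *)

Section PowerEstimates.
Variables (R : realType) (r : R).
Hypothesis r0 : 0 <= r.
Implicit Types (u z w p : {poly R[i]}) (B : R).

Lemma pnorm_expB u z B l : 1 <= B -> pnorm r u <= B -> pnorm r (u + z) <= B ->
  pnorm r ((u + z) ^+ l - u ^+ l) <= pnorm r z * (l%:R * B ^+ l).
Proof.
move=> B1 uB uzB; have B0 : 0 <= B by apply: le_trans B1.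
elim: l => [|l IH]; first by rewrite !expr0 subrr pnorm0 mul0r mulr0.
have -> : (u + z) ^+ l.+1 - u ^+ l.+1
    = (u + z) * ((u + z) ^+ l - u ^+ l) + z * u ^+ l by rewrite !exprS; ring.
apply: le_trans (pnormD _ _ r0) _.
have h1 : pnorm r ((u + z) * ((u + z) ^+ l - u ^+ l))
    <= B * (pnorm r z * (l%:R * B ^+ l)).
  by apply: le_trans (pnormM _ _ r0) _; rewrite ler_pM ?pnorm_ge0.
have h2 : pnorm r (z * u ^+ l) <= pnorm r z * B ^+ l.+1.
  apply: le_trans (pnormM _ _ r0) _; rewrite ler_wpM2l ?pnorm_ge0//.
  apply: le_trans (pnormX _ _ r0) _.
  apply: (@le_trans _ _ (B ^+ l)); first by rewrite lerXn2r ?nnegrE ?pnorm_ge0.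
  by rewrite ler_weXn2l.
apply: le_trans (lerD h1 h2) _.
by rewrite exprS -natr1 le_eqVlt; apply/orP; left; apply/eqP; ring.
Qed.

(** The cofactors obey Q_(l+1) = l u^(l-1) + (u + w) Q_l. The factor 4 absorbs both l <= 4^l and the
    doubling caused by u + w, since 1 + 2B <= 4B. *)
Lemma taylor2_exp u w B l : 1 <= B -> pnorm r u <= B -> pnorm r w <= B ->
  exists2 Q, (u + w) ^+ l = u ^+ l + (l%:R * u ^+ l.-1) * w + w ^+ 2 * Q
    & pnorm r Q <= (4 * B) ^+ l.
Proof.
move=> B1 uB wB; have B0 : 0 <= B by apply: le_trans B1.
elim: l => [|l [Q eQ nQ]].
  by exists 0; rewrite ?pnorm0 ?expr0 ?ler01// mulr0 mul0r mul0r !addr0.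
exists ((l%:R) * u ^+ l.-1 + (u + w) * Q).
  rewrite exprS eQ; case: l {eQ nQ} => [|l]; rewrite /= ?expr0 ?exprS -?natr1; ring.
apply: le_trans (pnormD _ _ r0) _.
have h1 : pnorm r (l%:R * u ^+ l.-1) <= (4 * B) ^+ l.
  rewrite mulr_natl -scaler_nat pnormZ normc_nat exprMn.
  have lB : pnorm r (u ^+ l.-1) <= B ^+ l.
    apply: le_trans (pnormX _ _ r0) _; apply: (@le_trans _ _ (B ^+ l.-1)).
      by rewrite lerXn2r ?nnegrE ?pnorm_ge0.
    by rewrite ler_weXn2l// leq_pred.
  rewrite ler_pM ?ler0n ?pnorm_ge0//.
  by rewrite -natrX ler_nat ltnW// ltn_expl.
have h2 : pnorm r ((u + w) * Q) <= (B + B) * (4 * B) ^+ l.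
  apply: le_trans (pnormM _ _ r0) _; rewrite ler_pM ?pnorm_ge0//.
  by apply: le_trans (pnormD _ _ r0) _; rewrite lerD.
apply: le_trans (lerD h1 h2) _; rewrite exprS.
have := exprn_ge0 l (mulr_ge0 (ler0n R 4) B0); set X := _ ^+ l => X0.
nra.
Qed.

End PowerEstimates.

(** * Weighted shifts of polynomials *)

(** What lambda^n and n! have in common. [ok] selects the norms of the space: only r = 1 for l1, all
    r >= 1 for H(C). Supermultiplicativity makes the copies small; its converse up to [kappa] bounds
    the shift between two radii. *)
Record admissible_weight (R : realType) (W : nat -> R) (kappa : R)
    (ok : R -> Prop) : Prop := AdmissibleWeight {
  weight0 : W 0 = 1;
  weight_ge1 : forall n, 1 <= W n;
  weight_supermul : forall a b, W a * W b <= W (a + b)%N;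
  weight_submul : forall a b, W (a + b)%N <= W a * W b * kappa ^+ (a + b);
  radius_ge1 : forall r, ok r -> 1 <= r;
  radiusM : forall r s, ok r -> ok s -> ok (r * s);
  radius_kappa : ok kappa;
  weight_decay : forall r, ok r -> exists D theta,
    [/\ 0 <= D, 0 < theta < 1 & forall l, r ^+ l / W l <= D * theta ^+ l] }.

(** * Sums along arithmetic progressions *)

Section ArithmeticSums.
Variable R : realType.

Lemma sum_progression_le (F : nat -> R) t p K : (forall l, 0 <= F l) -> (0 < p)%N ->
  \sum_(j < K) F (t + j * p)%N <= \sum_(l < t + K * p) F l.
Proof.
move=> F0 p0; elim: K => [|K IH]; first by rewrite big_ord0 sumr_ge0.
rewrite big_ord_recr/=; apply: le_trans (lerD IH (lexx _)) _.
have -> : (t + K.+1 * p = (t + K * p).+1 + p.-1)%N by lia.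
rewrite [leRHS]big_split_ord/= [X in _ <= X + _]big_ord_recr/= lerDl.
by apply: sumr_ge0 => i _.
Qed.

Lemma sum_geometric_tail (D theta : R) n M : 0 <= D -> 0 < theta < 1 ->
  \sum_(l < M) (if (n <= l)%N then D * theta ^+ (l - n) else 0)
    <= D / (1 - theta).
Proof.
move=> D0 /andP[t0 t1]; rewrite ler_pdivlMr ?subr_gt0//.
apply: (@le_trans _ _ (D * (1 - (if (n <= M)%N then theta ^+ (M - n) else 1)))); last first.
  rewrite ler_piMr// lerBlDr lerDl; case: ifP => // _.
  by rewrite exprn_ge0// ltW.
elim: M => [|M IH].
  rewrite big_ord0 mul0r; case: ifP; rewrite ?sub0n ?expr0 ?subrr ?mulr0//.
rewrite big_ord_recr/= mulrDl; apply: le_trans (lerD IH (lexx _)) _.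
have [nM|Mn] := leqP n M.
  rewrite (leqW nM) subSn// exprS.
  by rewrite le_eqVlt; apply/orP; left; apply/eqP; ring.
rewrite mul0r addr0; case: ifP => // nM1.
by have -> : n = M.+1 by [lia]; rewrite subnn expr0.
Qed.

(** The terms are distinct terms of one geometric series. The bound is free of [n], [t], [p] and
    [K], hence the number of return times costs nothing. *)
Lemma sum_tail_progression (f : nat -> R) (D theta : R) n t p K :
    0 <= D -> 0 < theta < 1 -> (0 < p)%N ->
    (forall l, 0 <= f l <= D * theta ^+ l) ->
  \sum_(j < K) (if (n <= t + j * p)%N then f (t + j * p - n)%N else 0)
    <= D / (1 - theta).
Proof.
move=> D0 th p0 fD.
pose F l := if (n <= l)%N then f (l - n)%N else 0.
apply: le_trans (@sum_progression_le F t p K _ p0) _.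
  by move=> l; rewrite /F; case: ifP => // _; case/andP: (fD (l - n)%N).
apply: le_trans (sum_geometric_tail n (t + K * p) D0 th).
apply: ler_sum => l _; rewrite /F; case: ifP => // _.
by case/andP: (fD (l - n)%N).
Qed.

End ArithmeticSums.

Section WeightedShift.
Variables (R : realType) (W : nat -> R) (kappa : R) (ok : R -> Prop).
Hypothesis hW : admissible_weight W kappa ok.
Implicit Types (p y : {poly R[i]}) (r : R).

Lemma weight_gt0 n : 0 < W n.
Proof. by apply: lt_le_trans (weight_ge1 hW n); rewrite ltr01. Qed.

Lemma weight_ge0 n : 0 <= W n. Proof. exact: ltW (weight_gt0 n). Qed.

Lemma weight_neq0 n : W n != 0. Proof. by rewrite gt_eqF ?weight_gt0. Qed.

Lemma radius_ge0 r : ok r -> 0 <= r.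
Proof. by move=> /(radius_ge1 hW); apply: le_trans; rewrite ler01. Qed.

Lemma le_weight a b : (a <= b)%N -> W a <= W b.
Proof.
move=> ab; rewrite -(subnKC ab); apply: le_trans (weight_supermul hW _ _).
by rewrite ler_peMr ?weight_ge0 ?(weight_ge1 hW).
Qed.

(** The n-th iterate in closed form: it corresponds to (lambda B)^n for lambda^n, and to the n-th
    derivative for n!. *)
Definition shiftn n p : {poly R[i]} :=
  \poly_(i < size p) ((W (i + n) / W i)%:C * p`_(i + n)).

Lemma coef_shiftn n p i : (shiftn n p)`_i = (W (i + n)%N / W i)%:C * p`_(i + n).
Proof.
rewrite coef_poly; case: ltnP => // pi.
by rewrite nth_default ?mulr0// (leq_trans pi)// leq_addr.
Qed.

Lemma shiftnD n p q : shiftn n (p + q) = shiftn n p + shiftn n q.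
Proof. by apply/polyP => i; rewrite !(coef_shiftn, coefD) mulrDr. Qed.

Lemma shiftnZ n (a : R[i]) p : shiftn n (a *: p) = a *: shiftn n p.
Proof. by apply/polyP => i; rewrite !(coef_shiftn, coefZ) mulrCA. Qed.

Lemma shiftnB n p q : shiftn n (p - q) = shiftn n p - shiftn n q.
Proof. by rewrite -scaleN1r shiftnD shiftnZ scaleN1r. Qed.

Lemma shiftn0 n : shiftn n 0 = 0.
Proof. by apply/polyP => i; rewrite coef_shiftn !coef0 mulr0. Qed.

Lemma shiftn_sum n (I : Type) (s : seq I) (P : pred I) (F : I -> {poly R[i]}) :
  shiftn n (\sum_(i <- s | P i) F i) = \sum_(i <- s | P i) shiftn n (F i).
Proof. by apply: (big_morph (shiftn n) (shiftnD n) (shiftn0 n)). Qed.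

Lemma shiftn_small n p : (size p <= n)%N -> shiftn n p = 0.
Proof.
move=> pn; apply/polyP => i; rewrite coef_shiftn coef0 nth_default ?mulr0//.
by rewrite (leq_trans pn)// leq_addl.
Qed.

Lemma shiftnXn n t : shiftn n 'X^t =
  if (n <= t)%N then (W t / W (t - n))%:C *: 'X^(t - n) else 0.
Proof.
apply/polyP => i; rewrite coef_shiftn coefXn.
case: (leqP n t) => nt; last first.
  by rewrite coef0 (_ : (i + n == t)%N = false) ?mulr0//; apply/eqP; lia.
rewrite coefZ coefXn (_ : (i == t - n)%N = (i + n == t)%N); last first.
  by apply/eqP/eqP; lia.
by case: eqP => [<-|]; rewrite ?mulr0// addnK.
Qed.

(** The larger radius pays for W(i + n) / W i <= W n kappa^(i + n). *)
Lemma pnorm_shiftn r n p : ok r ->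
  pnorm r (shiftn n p) <= W n * pnorm (kappa * r) p.
Proof.
move=> okr; have r1 := radius_ge1 hW okr; have r0 := radius_ge0 okr.
have k0 := radius_ge0 (radius_kappa hW).
rewrite (@pnorm_widen _ (size p)) ?size_poly//.
apply: le_trans (ler_wpM2l (weight_ge0 n)
  (pnorm_partial p (n + size p) (mulr_ge0 k0 r0))).
rewrite big_split_ord/= mulrDr; apply: ler_wpDl.
  rewrite mulr_ge0 ?weight_ge0// sumr_ge0// => i _.
  by rewrite mulr_ge0 ?normc_ge0// exprn_ge0// mulr_ge0.
rewrite mulr_sumr; apply: ler_sum => i _; rewrite coef_shiftn normcM normcR_ge0; last first.
  by rewrite divr_ge0 ?weight_ge0.
rewrite addnC [leRHS](_ : _ = (W n * (kappa * r) ^+ (n + i)) * normc p`_(n + i)); last by ring.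
rewrite -mulrA [_ * r ^+ i]mulrC mulrA ler_wpM2r ?normc_ge0//.
rewrite mulrAC ler_pdivrMr ?weight_gt0//.
apply: (@le_trans _ _ ((W n * W i * kappa ^+ (n + i)) * r ^+ (n + i))).
  rewrite ler_pM ?weight_ge0 ?exprn_ge0//; first exact: weight_submul hW _ _.
  by rewrite ler_weXn2l// leq_addl.
by rewrite exprMn le_eqVlt; apply/orP; left; apply/eqP; ring.
Qed.

Definition decay r (D theta : R) :=
  [/\ 0 <= D, 0 < theta < 1 & forall l, r ^+ l / W l <= D * theta ^+ l].

Lemma decay_bounds r D theta l : 0 <= r -> decay r D theta ->
  0 <= r ^+ l / W l <= D * theta ^+ l.
Proof.
by move=> r0 [_ _ h]; rewrite h andbT divr_ge0 ?exprn_ge0 ?weight_ge0.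
Qed.

Lemma sum_shifted_monomials r D theta (n t p K : nat) : 0 <= r -> decay r D theta ->
    (0 < p)%N ->
  \sum_(j < K) pnorm r (shiftn n 'X^(t + j * p)) / W (t + j * p)
    <= D / (1 - theta).
Proof.
move=> r0 dec p0; have [D0 th _] := dec.
apply: le_trans (@sum_tail_progression R (fun l => r ^+ l / W l) D theta n t p K
  D0 th p0 (fun l => decay_bounds l r0 dec)).
apply: ler_sum => j _; rewrite shiftnXn; case: ifP => nt; last by rewrite pnorm0 mul0r.
rewrite pnormZ normcR_ge0 ?divr_ge0 ?weight_ge0// -['X^_]mul1r pnormMXn pnorm1 mul1r.
rewrite le_eqVlt; apply/orP; left; apply/eqP.
by have := weight_neq0 (t + j * p); have := weight_neq0 (t + j * p - n) => ? ?; field; apply/andP.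
Qed.

Section Wave.
Variables (y : {poly R[i]}) (h p K d : nat).
Hypotheses (p0 : (0 < p)%N) (dh : (d <= 2 * h)%N).

(** Block j is the preimage of [y] under the shift by 2h + jp, moved down by [d] to leave room for
    the factor X^d of the cross term. *)
Definition wave : {poly R[i]} :=
  \sum_(j < K) \sum_(i < size y)
    (y`_i * (W i / W (2 * h + j * p + i))%:C) *: 'X^(2 * h + j * p + i - d).

Definition wmass : R := \sum_(i < size y) normc y`_i * W i.

Lemma wmass_ge0 : 0 <= wmass.
Proof. by apply: sumr_ge0 => i _; rewrite mulr_ge0 ?normc_ge0 ?weight_ge0. Qed.

Lemma waveMXn l : (l <= d)%N -> wave * 'X^l =
  \sum_(j < K) \sum_(i < size y)
    (y`_i * (W i / W (2 * h + j * p + i))%:C) *: 'X^(2 * h + j * p + i - (d - l)).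
Proof.
move=> ld; rewrite mulr_suml; apply: eq_bigr => j _; rewrite mulr_suml.
apply: eq_bigr => i _; rewrite -scalerAl -exprD; congr (_ *: 'X^_); lia.
Qed.

(** When l falls short of d, the copies sit d - l places lower than their coefficients were designed
    for, and W T * W(d - l) <= W(T + (d - l)) yields the gain 1 / W(d - l), uniformly in [n]. *)
Lemma pnorm_shift_wave r D theta n l : 0 <= r -> decay r D theta -> (l <= d)%N ->
  pnorm r (shiftn n (wave * 'X^l)) <= wmass * (D / (1 - theta)) / W (d - l).
Proof.
move=> r0 dec ld; have [D0 /andP[t0 t1] _] := dec.
rewrite waveMXn// exchange_big/= shiftn_sum.
apply: le_trans (pnorm_sum _ _ _ r0) _.
rewrite /wmass mulr_suml mulr_suml; apply: ler_sum => i _.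
rewrite shiftn_sum; apply: le_trans (pnorm_sum _ _ _ r0) _.
rewrite -mulrA.
apply: le_trans (ler_wpM2l _ (ler_wpM2r _ (@sum_shifted_monomials r D theta n
  (2 * h + i - (d - l)) p K r0 dec p0))); last first.
- by rewrite invr_ge0 weight_ge0.
- by rewrite mulr_ge0 ?normc_ge0 ?weight_ge0.
rewrite mulr_suml mulr_sumr; apply: ler_sum => j _.
rewrite shiftnZ pnormZ normcM normcR_ge0 ?divr_ge0 ?weight_ge0//.
have -> : (2 * h + i - (d - l) + j * p = 2 * h + j * p + i - (d - l))%N by lia.
set T := (2 * h + j * p + i - (d - l))%N.
have TE : (2 * h + j * p + i = T + (d - l))%N by rewrite /T; lia.
rewrite TE [leLHS](_ : _ = (normc y`_i * W i) * ((W (T + (d - l)))^-1 * pnorm r (shiftn n 'X^T))); last by ring.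
rewrite ler_wpM2l ?mulr_ge0 ?normc_ge0 ?weight_ge0// -mulrA [leRHS]mulrC.
rewrite ler_wpM2r ?pnorm_ge0// -invfM lef_pV2 ?posrE ?mulr_gt0 ?weight_gt0//.
exact: weight_supermul hW _ _.
Qed.

Lemma pnorm_wave r D theta : 1 <= r -> decay r D theta ->
  pnorm r wave <= wmass * (D / (1 - theta)) * (r ^+ (2 * h) / W (2 * h)).
Proof.
move=> r1 dec; have r0 : 0 <= r by apply: le_trans r1.
have [D0 th _] := dec; have /andP[t0 t1] := th.
rewrite /wave exchange_big/= /wmass !mulr_suml.
apply: le_trans (pnorm_sum _ _ _ r0) _; apply: ler_sum => i _.
apply: le_trans (pnorm_sum _ _ _ r0) _.
have c0 : 0 <= r ^+ (2 * h) / W (2 * h) by rewrite divr_ge0 ?exprn_ge0 ?weight_ge0.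
apply: le_trans (ler_wpM2r c0 (ler_wpM2l _ (@sum_tail_progression R
  (fun l => r ^+ l / W l) D theta 0 i p K D0 th p0
  (fun l => decay_bounds l r0 dec)))); last first.
  by rewrite mulr_ge0 ?normc_ge0 ?weight_ge0.
rewrite mulr_sumr mulr_suml; apply: ler_sum => j _.
rewrite pnormZ normcM normcR_ge0 ?divr_ge0 ?weight_ge0// -['X^_]mul1r pnormMXn pnorm1 mul1r /= subn0.
rewrite -!mulrA ler_wpM2l ?normc_ge0// ler_wpM2l ?weight_ge0//.
apply: (@le_trans _ _ ((W (2 * h + j * p + i))^-1 * r ^+ (i + j * p + 2 * h))).
  by rewrite ler_wpM2l ?invr_ge0 ?weight_ge0// ler_weXn2l//; lia.
rewrite [leRHS](_ : _ = (W (2 * h) * W (i + j * p))^-1 * r ^+ (i + j * p + 2 * h)); last first.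
  by rewrite (exprD r (i + j * p)) invfM; ring.
rewrite ler_wpM2r ?exprn_ge0// lef_pV2 ?posrE ?mulr_gt0 ?weight_gt0//.
by rewrite -addnA [(j * p + i)%N]addnC; exact: weight_supermul hW _ _.
Qed.

(* The blocks before the k-th one are annihilated, the k-th one produces y, and
   the later ones land beyond position p, where the weights make them small. *)
Lemma shift_wave_hits r D theta k : 0 <= r -> decay r D theta -> (k < K)%N ->
    (size y <= p)%N ->
  pnorm r (shiftn (2 * h + k * p) (wave * 'X^d) - y)
    <= wmass * (D / (1 - theta)) * theta ^+ p.
Proof.
move=> r0 dec kK yp; have [D0 th decl] := dec; have /andP[t0 t1] := th.
rewrite waveMXn// shiftn_sum (bigD1 (Ordinal kK))//= shiftn_sum.
rewrite (_ : \sum_(i < size y) _ = y); last first.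
  rewrite -[RHS]coefK poly_def; apply: eq_bigr => i _.
  rewrite subnn subn0 shiftnZ shiftnXn leq_addr addKn scalerA -mulrA -rmorphM/=.
  rewrite (_ : _ / _ * _ = 1) ?mulr1//.
  by have := weight_neq0 i; have := weight_neq0 (2 * h + k * p + i) => ? ?; field; apply/andP.
rewrite addrAC subrr add0r.
apply: le_trans (pnorm_sum _ _ _ r0) _.
pose F (i j : nat) := if (2 * h + k * p + p <= 2 * h + i + j * p)%N then
  (r ^+ (2 * h + i + j * p - (2 * h + k * p)) / W (2 * h + i + j * p - (2 * h + k * p))) else 0.
apply: (@le_trans _ _ (\sum_(j < K) \sum_(i < size y) normc y`_i * W i * F i j)).
  rewrite [leLHS]big_mkcond; apply: ler_sum => j _.
  case: ifPn => [jk|_]; last first.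
    apply: sumr_ge0 => i _; rewrite mulr_ge0 ?mulr_ge0 ?normc_ge0 ?weight_ge0// /F.
    by case: ifP => // _; rewrite divr_ge0 ?exprn_ge0 ?weight_ge0.
  rewrite shiftn_sum; apply: le_trans (pnorm_sum _ _ _ r0) _; apply: ler_sum => i _.
  rewrite subnn subn0 shiftnZ pnormZ normcM normcR_ge0 ?divr_ge0 ?weight_ge0//.
  rewrite -!mulrA ler_wpM2l ?normc_ge0// ler_wpM2l ?weight_ge0// /F.
  have iy : (i < p)%N := leq_trans (ltn_ord i) yp.
  rewrite shiftnXn; have [jltk|kltj|jek] := ltngtP (j : nat) k; last first.
  - by move: jk; rewrite -val_eqE/= jek eqxx.
  - have kjp : (k * p + p <= j * p)%N by rewrite -mulSnr leq_mul2r kltj orbT.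
    rewrite !ifT; [|lia|lia].
    rewrite pnormZ normcR_ge0 ?divr_ge0 ?weight_ge0// -['X^_]mul1r pnormMXn pnorm1 mul1r.
    rewrite (_ : 2 * h + i + j * p = 2 * h + j * p + i)%N; last lia.
    rewrite le_eqVlt; apply/orP; left; apply/eqP.
    by have := weight_neq0 (2 * h + j * p + i); have := weight_neq0 (2 * h + j * p + i - (2 * h + k * p)) => ? ?; field; apply/andP.
  - have kjp : (j * p + p <= k * p)%N by rewrite -mulSnr leq_mul2r jltk orbT.
    have c1 : (2 * h + k * p <= 2 * h + j * p + i)%N = false by apply/negbTE; lia.
    have c2 : (2 * h + k * p + p <= 2 * h + i + j * p)%N = false by apply/negbTE; lia.
    by rewrite c1 c2 pnorm0 mulr0.
rewrite exchange_big/= /wmass !mulr_suml; apply: ler_sum => i _.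
rewrite -mulr_sumr -mulrA ler_wpM2l ?mulr_ge0 ?normc_ge0 ?weight_ge0//.
have Dp : 0 <= D * theta ^+ p by rewrite mulr_ge0// exprn_ge0// ltW.
rewrite mulrAC.
apply: le_trans (@sum_tail_progression R (fun l => r ^+ (p + l) / W (p + l))
  (D * theta ^+ p) theta (2 * h + k * p + p) (2 * h + i) p K Dp th p0 _).
  apply: ler_sum => j _; rewrite /F; case: ifP => // le.
  by rewrite (_ : p + _ = 2 * h + i + j * p - (2 * h + k * p))%N//; lia.
move=> l; have := decay_bounds (p + l) r0 dec.
by rewrite (exprD theta) mulrA.
Qed.

End Wave.

End WeightedShift.

(** * One stage of the construction *)

Section Geometric.
Variable R : realType.

Lemma geometric_eventually_lt (theta C eps : R) : 0 < theta < 1 -> 0 < eps ->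
  exists H, forall h, (H <= h)%N -> C * theta ^+ h < eps.
Proof.
move=> /andP[t0 t1] e0.
have : (fun h => C * theta ^+ h) @ \oo --> (C * 0 : R).
  by apply: cvgM; [exact: cvg_cst|apply: cvg_expr; rewrite ger0_norm ?ltW].
rewrite mulr0 => /cvgrPdist_lt/(_ _ e0)[H _ hH]; exists H => h Hh.
by have := hH h Hh; rewrite /= sub0r normrN; apply: le_lt_trans; rewrite ler_norm.
Qed.

End Geometric.

Section Stage.
Variables (R : realType) (W : nat -> R) (kappa : R) (ok : R -> Prop).
Hypothesis hW : admissible_weight W kappa ok.
Local Notation T := (shiftn W).

Lemma size_mul_leq (p q : {poly R[i]}) a b : (size p <= a.+1)%N -> (size q <= b)%N ->
  (size (p * q)%R <= a + b)%N.
Proof. by move=> pa qb; apply: leq_trans (size_polyMleq _ _) _; lia. Qed.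

Lemma size_exp_leq (p : {poly R[i]}) N j : (size p <= N.+1)%N ->
  (size (p ^+ j)%R <= (j * N).+1)%N.
Proof.
move=> pN; elim: j => [|j IH]; first by rewrite expr0 size_poly1.
by rewrite exprS mulSn -addnS size_mul_leq.
Qed.

Lemma size_expB_leq (u a : {poly R[i]}) s N j : (size u <= s)%N -> (s <= N)%N ->
  (size a <= N.+1)%N -> (size ((u + a) ^+ j.+1 - a ^+ j.+1)%R <= j * N + s)%N.
Proof.
move=> us sN aN.
have uaN : (size (u + a)%R <= N.+1)%N.
  by rewrite (leq_trans (size_polyD _ _))// geq_max aN andbT; lia.
elim: j => [|j IH]; first by rewrite !expr1 addrK.
have -> : (u + a) ^+ j.+2 - a ^+ j.+2
    = (u + a) ^+ j.+1 * u + a * ((u + a) ^+ j.+1 - a ^+ j.+1) by rewrite ![_ ^+ j.+2]exprS; ring.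
rewrite (leq_trans (size_polyD _ _))// geq_max; apply/andP; split.
  by apply: size_mul_leq => //; exact: size_exp_leq.
by rewrite mulSn -addnA size_mul_leq.
Qed.

Lemma comp_poly_taylor2 (P b w : {poly R[i]}) (rho A B : R) :
    0 <= rho -> 0 <= A -> 1 <= B -> pnorm rho b <= B -> pnorm rho w <= B ->
    (forall i, normc P`_i <= A) ->
  exists2 Q, P \Po (b + w) = P \Po b
      + (\sum_(l < size P) P`_l *: (l%:R * b ^+ l.-1)) * w + w ^+ 2 * Q
    & pnorm rho Q <= A * \sum_(l < size P) (4 * B) ^+ l.
Proof.
move=> rho0 A0 B1 bB wB PA.
have H (l : nat) : exists Q, (b + w) ^+ l = b ^+ l + (l%:R * b ^+ l.-1) * w + w ^+ 2 * Q
    /\ pnorm rho Q <= (4 * B) ^+ l.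
  by have [Q] := taylor2_exp rho0 l B1 bB wB; exists Q.
have [Q hQ] := choice H.
exists (\sum_(l < size P) P`_l *: Q l).
  rewrite !comp_polyE mulr_suml mulr_sumr -!big_split/=; apply: eq_bigr => l _.
  have [-> _] := hQ l.
  by rewrite !scalerDr -scalerAl -scalerAr.
apply: le_trans (pnorm_sum _ _ _ rho0) _; rewrite mulr_sumr.
apply: ler_sum => l _; rewrite pnormZ ler_pM ?normc_ge0 ?pnorm_ge0//.
by have [_] := hQ l.
Qed.

(** The remainder consists of powers of u + a of exponent below m and of products with a factor u;
    each loses at least N - s degrees against X^(mN). *)
Lemma size_derivative_remainder (P u a : {poly R[i]}) s N m :
    P \is monic -> size P = m.+2 ->
    (size u <= s)%N -> (0 < s <= N)%N -> (size a <= N.+1)%N ->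
  (size (\sum_(l < size P) P`_l *: (l%:R * (u + a) ^+ l.-1) - m.+1%:R * a ^+ m)%R
    <= m * N - (N - s))%N.
Proof.
move=> /monicP Pm sP us /andP[s0 sN] aN.
have uaN : (size (u + a)%R <= N.+1)%N.
  by rewrite (leq_trans (size_polyD _ _))// geq_max aN andbT; lia.
rewrite sP big_ord_recr/= -addrA.
have -> : P`_m.+1 = 1 by rewrite -Pm /lead_coef sP.
rewrite scale1r -mulrBr (leq_trans (size_polyD _ _))// geq_max; apply/andP; split; last first.
  case: m {Pm sP} => [|m]; first by rewrite !expr0 subrr mulr0 size_poly0.
  rewrite mulr_natl -scaler_nat; apply: leq_trans (size_scale_leq _ _) _.
  by apply: leq_trans (size_expB_leq m us sN aN) _; rewrite mulSn; lia.
apply: leq_trans (size_sum _ _ _) _; apply/bigmax_leqP => -[[|l] lm] _ /=.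
  by rewrite mul0r scaler0 size_poly0.
apply: leq_trans (size_scale_leq _ _) _.
rewrite mulr_natl -scaler_nat; apply: leq_trans (size_scale_leq _ _) _.
apply: leq_trans (size_exp_leq l uaN) _.
case: m {Pm sP} lm => [|m] lm; first by lia.
have : (l * N <= m * N)%N by rewrite leq_mul2r; apply/orP; right; lia.
by rewrite mulSn; lia.
Qed.

(** The shift costs W(2h + a) <= W(2h) W(h) kappa^(3h), and W(h)^2 <= W(2h), so dividing by W(2h)^2
    leaves one factor W h in the denominator. *)
Lemma wave_second_order rho h a : ok rho -> (a <= h)%N ->
  W (2 * h + a) * (rho ^+ (2 * h) / W (2 * h)) ^+ 2
    <= (rho ^+ 4 * kappa ^+ 3) ^+ h / W h.
Proof.
move=> okr ah; have r1 := radius_ge1 hW okr; have k1 := radius_ge1 hW (radius_kappa hW).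
have r0 : 0 <= rho by apply: le_trans r1.
have k0 : 0 <= kappa by apply: le_trans k1.
have Wh := weight_gt0 hW h; have W2 := weight_gt0 hW (2 * h).
have h1 : W (2 * h + a) <= W (2 * h) * W h * kappa ^+ (3 * h).
  apply: le_trans (weight_submul hW _ _) _.
  rewrite ler_pM ?mulr_ge0 ?exprn_ge0 ?(weight_ge0 hW)//.
    by rewrite ler_wpM2l ?(weight_ge0 hW)// (le_weight hW).
  by rewrite ler_weXn2l//; lia.
have h2 : W h * W h <= W (2 * h) by rewrite mul2n -addnn; exact: weight_supermul hW _ _.
rewrite expr_div_n mulrA ler_pdivrMr ?exprn_gt0//.
have -> : (rho ^+ 4 * kappa ^+ 3) ^+ h = (rho ^+ (2 * h)) ^+ 2 * kappa ^+ (3 * h).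
  by rewrite exprMn -!exprM; congr (_ ^+ _ * _); lia.
set X := (rho ^+ (2 * h)) ^+ 2; set Y := kappa ^+ (3 * h).
have X0 : 0 <= X by rewrite !exprn_ge0.
have Y0 : 0 <= Y by rewrite exprn_ge0.
apply: (@le_trans _ _ (W (2 * h) * W h * Y * X)); first by rewrite ler_wpM2r.
rewrite [leLHS](_ : _ = X * Y * (W (2 * h) * W h)); last by ring.
rewrite -[leRHS]mulrA ler_wpM2l ?(mulr_ge0 X0 Y0)//.
rewrite [leRHS](_ : _ = W (2 * h) * (W (2 * h) / W h)); last by ring.
by rewrite ler_wpM2l ?(weight_ge0 hW)// ler_pdivlMr.
Qed.

End Stage.

Section StageConstruction.
Variables (R : realType) (W : nat -> R) (kappa : R) (ok : R -> Prop).
Hypothesis hW : admissible_weight W kappa ok.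
Local Notation T := (shiftn W).

Lemma radiusX r n : ok r -> ok (r ^+ n.+1).
Proof.
by move=> okr; elim: n => [|n IH]; rewrite ?expr1// exprS; apply: radiusM hW _ _ okr IH.
Qed.

Lemma pnorm_shift_mul_wave (y : {poly R[i]}) h p K d r D theta n (G : {poly R[i]}) g : (0 < p)%N -> (d <= 2 * h)%N ->
    0 <= r -> decay W r D theta -> (size G <= d - g)%N ->
  pnorm r (T n (G * wave W y h p K d))
    <= pnorm 1 G * (wmass W y * (D / (1 - theta)) / W g).
Proof.
move=> p0 dh r0 dec sG; have [D0 /andP[t0 t1] _] := dec.
rewrite {1}(_ : G = \sum_(j < size G) G`_j *: 'X^j); last by rewrite -[LHS]coefK poly_def.
rewrite mulr_suml shiftn_sum; apply: le_trans (pnorm_sum _ _ _ r0) _.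
rewrite [X in _ <= X * _]/pnorm mulr_suml; apply: ler_sum => j _.
rewrite -scalerAl shiftnZ pnormZ expr1n mulr1 ler_wpM2l ?normc_ge0// mulrC.
have jG := ltn_ord j.
apply: le_trans (pnorm_shift_wave hW y K p0 dh n r0 dec _) _; first by lia.
rewrite ler_wpM2l ?mulr_ge0 ?(wmass_ge0 hW) ?invr_ge0 ?subr_ge0 ?(ltW t1)//.
by rewrite lef_pV2 ?posrE ?(weight_gt0 hW)// (le_weight hW)//; lia.
Qed.

Lemma common_bound a b c d e : exists h,
  [/\ (a <= h)%N, (b <= h)%N, (c <= h)%N, (d <= h)%N & (e < h)%N].
Proof. by exists (a + b + c + d + e.+1)%N; split; lia. Qed.

(** The hit itself only requires theta^p to be small relative to [y] and [r]. This is why [p] can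
    precede [u], [m] and all the other data. *)
Lemma stage (y : {poly R[i]}) (r eps : R) : 0 < eps -> ok r ->
  exists2 p, (0 < p)%N & forall (u : {poly R[i]}) m A eps' r' N0,
    0 <= A -> 0 < eps' -> ok r' ->
  exists v h, [/\ (N0 <= h)%N, pnorm r' v < eps', forall i, (i < N0)%N -> v`_i = 0
    & forall P : {poly R[i]}, P \is monic -> size P = m.+2 ->
      (forall i, normc P`_i <= A) ->
      forall k, (k * p <= h)%N ->
      pnorm r (T (2 * h + k * p) (P \Po (u + v)) - y) < eps].
Proof.
move=> e0 okr.
have r0 := radius_ge0 hW okr.
have [D [th dec]] := weight_decay hW okr; have [D0 /andP[th0 th1] decl] := dec.
set S := D / (1 - th).
have S0 : 0 <= S by rewrite divr_ge0// subr_ge0 ltW.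
set Y := wmass W y; have Y0 : 0 <= Y by apply: wmass_ge0 hW _.
have e30 : 0 < eps / 3 by rewrite divr_gt0// ltr0n.
have [Hp hp] := @geometric_eventually_lt R th (Y * S) _ (introT andP (conj th0 th1)) e30.
pose p := maxn Hp (size y).+1.
have p0 : (0 < p)%N by rewrite leq_max orbT.
have yp : (size y <= p)%N by rewrite leq_max leqnSn orbT.
exists p => // u m A eps' r' N0 A0 e'0 okr'.
have r'1 := radius_ge1 hW okr'; have r'0 := radius_ge0 hW okr'.
have r'gt0 : 0 < r' by apply: lt_le_trans r'1.
pose s := (size u).+1.
pose B1 := pnorm 1 u + 1.
have B11 : 1 <= B1 by rewrite lerDr pnorm_ge0.
have B10 : 0 <= B1 by apply: le_trans B11.
pose C0 := A * (\sum_(l < m.+2) l%:R * B1 ^+ l.-1) + m.+1%:R.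
have C00 : 0 <= C0.
  rewrite addr_ge0// mulr_ge0// sumr_ge0// => l _; by rewrite mulr_ge0 ?exprn_ge0.
(* The inverse of c below grows like r'^(mN). The exponent is m + 1 because the radius 1 = r'^0 is
   not assumed admissible when m = 0. *)
pose R1 := r' ^+ m.+1.
have R10 : 0 <= R1 by rewrite exprn_ge0.
have [D1 [th1' [D10 th1'01 dec1]]] := weight_decay hW (radiusX m okr').
pose eta := Num.min 1 (eps' / 2).
have eta0 : 0 < eta by rewrite lt_min ltr01 divr_gt0.
have eta1 : eta <= 1 by rewrite ge_min lexx.
have etae : eta <= eps' / 2 by rewrite ge_min lexx orbT.
(* The gap g is chosen before N = s + g exists: c^-1 / W g is at most R1^s / eta^m times R1^g / W g,
   which decays in g. *)
have [H1 hH1] := geometric_eventually_lt (C0 * (R1 ^+ s / eta ^+ m * (Y * S)) * D1) th1'01 e30.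
pose g := maxn H1 N0; pose N := (s + g)%N.
have sN : (0 < s <= N)%N by rewrite /N leq_addr.
have N0N : (N0 <= N)%N by rewrite /N (leq_trans (leq_maxr H1 N0))// leq_addl.
have Ng : (N - s)%N = g by rewrite /N addKn.
(* With this value delta X^N has norm exactly eta at radius r', for every N. *)
pose delta := eta / r' ^+ N.
have delta0 : 0 < delta by rewrite divr_gt0// exprn_gt0.
have delta1 : delta <= 1.
  by rewrite ler_pdivrMr ?exprn_gt0// mul1r (le_trans eta1)// exprn_ege1.
(* The leading coefficient of P'(u + delta X^N); dividing [w0] by it makes the cross term exactly
   [w0 * 'X^d], up to the lower terms [G]. *)
pose c := m.+1%:R * delta ^+ m.
have c0 : 0 < c by rewrite mulr_gt0 ?exprn_gt0// ltr0n.
have cinv : c^-1 / W g <= R1 ^+ s / eta ^+ m * (D1 * th1' ^+ g).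
  have Wg := weight_gt0 hW g.
  apply: (@le_trans _ _ (R1 ^+ N / eta ^+ m / W g)).
    rewrite ler_wpM2r ?invr_ge0 ?(weight_ge0 hW)// /c /delta expr_div_n.
    rewrite invfM invf_div -[leRHS]mul1r ler_pM ?invr_ge0 ?ler0n//.
    - by rewrite mulr_ge0 ?invr_ge0 ?exprn_ge0// ltW.
    - by rewrite invf_le1 ?ltr0n// ler1n.
    rewrite ler_wpM2r ?invr_ge0 ?exprn_ge0// ?(ltW eta0)//.
    by rewrite /R1 -!exprM ler_weXn2l// mulnC leq_mul2r leqnSn orbT.
  rewrite [leLHS](_ : _ = R1 ^+ s / eta ^+ m * (R1 ^+ g / W g)); last first.
    by rewrite /N exprD; ring.
  have E0 : 0 <= R1 ^+ s / eta ^+ m by rewrite divr_ge0 ?exprn_ge0 ?(ltW eta0).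
  by rewrite ler_wpM2l.
pose d := (m * N)%N.
pose a : {poly R[i]} := delta%:C *: 'X^N.
have sa : (size a <= N.+1)%N.
  by rewrite (leq_trans (size_scale_leq _ _))// size_polyXn.
have na t : pnorm t a = delta * t ^+ N.
  by rewrite pnormZ normcR_ge0 ?(ltW delta0)// -['X^_]mul1r pnormMXn pnorm1 mul1r.
have am : m.+1%:R * a ^+ m = c%:C *: 'X^d.
  rewrite /a exprZn -exprM mulr_natl -scaler_nat scalerA mulnC; congr (_ *: _).
  by rewrite /c [RHS]rmorphM/= [in RHS](rmorph_nat (real_complex R)) [in RHS](rmorphXn (real_complex R)).
pose b := u + a.
pose rho := kappa * r; have okrho : ok rho := radiusM hW (radius_kappa hW) okr.
have rho0 := radius_ge0 hW okrho; have rho1 := radius_ge1 hW okrho.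
pose B := 1 + pnorm rho b.
have B_1 : 1 <= B by rewrite lerDl pnorm_ge0.
have [D2 [th2 dec2]] := weight_decay hW okr'.
have [D3 [th3 dec3]] := weight_decay hW okrho.
have ok4 : ok (rho ^+ 4 * kappa ^+ 3).
  by apply: radiusM hW _ _ _ _; apply: radiusX => //; exact: radius_kappa hW.
have [D4 [th4 dec4]] := weight_decay hW ok4.
have [D20 th201 dec2l] := dec2; have [D30 th301 dec3l] := dec3; have [D40 th401 dec4l] := dec4.
pose S2 := D2 / (1 - th2); pose S3 := D3 / (1 - th3).
have S20 : 0 <= S2 by case/andP: th201 => _ t; rewrite divr_ge0// subr_ge0 ltW.
have S30 : 0 <= S3 by case/andP: th301 => _ t; rewrite divr_ge0// subr_ge0 ltW.
have ci0 : 0 <= c^-1 by rewrite invr_ge0 ltW.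
have e'20 : 0 < eps' / 2 by rewrite divr_gt0.
have [G1 hG1] := geometric_eventually_lt (c^-1 * (Y * S2 * D2)) th201 e'20.
have [G2 hG2] := geometric_eventually_lt (c^-1 * (Y * S3 * D3)) th301 ltr01.
pose QB := A * \sum_(l < m.+2) (4 * B) ^+ l.
have QB0 : 0 <= QB.
  rewrite mulr_ge0// sumr_ge0// => l _; rewrite exprn_ge0// mulr_ge0//.
  exact: (le_trans ler01 B_1).
have [G3 hG3] := geometric_eventually_lt ((c^-1 * (Y * S3)) ^+ 2 * QB * D4) th401 e30.
(* In order: smallness of w at radius r', the bound pnorm rho w <= B required by the expansion,
   smallness of the second order term, the prescribed lower bound for h, and times beyond the degree
   of P(b). *)
have [h [/hG1{}hG1 /hG2{}hG2 /hG3{}hG3 N0h mNh]] := common_bound G1 G2 G3 N0 (m.+1 * N).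
have dNh : (d + N < h)%N by rewrite addnC -mulSn.
have dh : (d <= 2 * h)%N.
  by rewrite (leq_trans (leq_addr N d))// (leq_trans (ltnW dNh))// leq_pmull.
have dhi i : (2 * h + i - d >= N)%N.
  rewrite leq_subRL ?(leq_trans dh) ?leq_addr// (leq_trans (ltnW dNh))//.
  by rewrite mul2n -addnn -addnA leq_addr.
pose K := (h %/ p).+1.
pose w0 := wave W y h p K d.
pose w := (c^-1)%:C *: w0.
have nw t D' th' : 1 <= t -> decay W t D' th' ->
    pnorm t w <= c^-1 * (Y * (D' / (1 - th')) * D') * th' ^+ h.
  move=> t1 dec'; have [D'0 /andP[th'0 th'1] dec'l] := dec'.
  rewrite pnormZ normcR_ge0// -[leRHS]mulrA ler_wpM2l//.
  apply: le_trans (pnorm_wave hW y K p0 dh t1 dec') _.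
  rewrite -[leRHS]mulrA ler_wpM2l ?mulr_ge0 ?invr_ge0 ?subr_ge0 ?(ltW th'1)//.
  apply: le_trans (dec'l _) _; rewrite ler_wpM2l//.
  by rewrite ler_wiXn2l ?(ltW th'0) ?(ltW th'1)// leq_pmull.
exists (a + w), h; split => //.
- rewrite (le_lt_trans (pnormD _ _ r'0))// (splitr eps') ler_ltD//.
    by rewrite na /delta divfK// gt_eqF// exprn_gt0.
  by apply: le_lt_trans hG1; exact: nw.
- move=> i iN0; rewrite coefD /a /w !coefZ coefXn coef_sum.
  have iN : (i < N)%N := leq_trans iN0 N0N.
  rewrite (ltn_eqF iN) mulr0 add0r.
  rewrite big1 ?mulr0// => j _; rewrite coef_sum big1// => l _.
  by rewrite coefZ coefXn -addnA ltn_eqF ?mulr0// (leq_trans iN).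
move=> P Pm sP PA k kph.
have kK : (k < K)%N by rewrite /K ltnS leq_divRL.
set n := (2 * h + k * p)%N.
have bB : pnorm rho b <= B by rewrite lerDr.
have wB : pnorm rho w <= B.
  apply: (fun h => le_trans h B_1); apply: ltW; apply: le_lt_trans hG2.
  exact: nw.
have [Q eQ nQ] := comp_poly_taylor2 rho0 A0 B_1 bB wB PA.
rewrite addrA -/b eQ.
set Ds := \sum_(l < size P) _.
set G := Ds - m.+1%:R * a ^+ m.
have Dw : Ds * w = w0 * 'X^d + (c^-1)%:C *: (G * w0).
  rewrite (_ : Ds = G + c%:C *: 'X^d); last by rewrite /G am subrK.
  rewrite mulrDl addrC /w; congr (_ + _); last by rewrite -scalerAr.
  by rewrite -scalerAr -scalerAl scalerA -rmorphM/= mulVf ?gt_eqF// scale1r mulrC.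
rewrite Dw !shiftnD shiftn_small ?add0r; last first.
  apply: leq_trans (size_comp_poly_leq _ _) _; rewrite sP /=.
  have : ((size b).-1 <= N)%N.
    have : (size b <= N.+1)%N.
      rewrite (leq_trans (size_polyD _ _))// geq_max sa andbT.
      by rewrite (leq_trans _ (leqnSn N))// /N /s addSn -addnS leq_addr.
    by case: (size b).
  move=> bN; rewrite /n; apply: (@leq_trans (m.+1 * N).+1); last first.
    by rewrite (leq_trans mNh)// (leq_trans _ (leq_addr _ _))// leq_pmull.
  by rewrite ltnS leq_mul2l bN orbT.
rewrite shiftnZ addrAC (addrAC _ _ (- y)).
rewrite [ltRHS](_ : eps = eps / 3 + eps / 3 + eps / 3); last by field.
have G_size : (size G <= d - g)%N.
  by rewrite -Ng; apply: size_derivative_remainder => //; rewrite /s leqnSn.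
have b1 : pnorm 1 b <= B1.
  rewrite (le_trans (pnormD _ _ ler01))// /B1 lerD2l na expr1n mulr1//.
have nG : pnorm 1 G <= C0.
  rewrite (le_trans (pnormB _ _ ler01))// lerD//.
    rewrite (le_trans (pnorm_sum _ _ _ ler01))// sP mulr_sumr; apply: ler_sum => l _.
    rewrite pnormZ ler_pM ?normc_ge0 ?pnorm_ge0// mulr_natl -scaler_nat pnormZ normc_nat.
    rewrite ler_wpM2l// (le_trans (pnormX _ _ ler01))//.
    by rewrite lerXn2r ?nnegrE ?pnorm_ge0.
  rewrite am pnormZ normcR_ge0 ?(ltW c0)// -['X^_]mul1r pnormMXn pnorm1 expr1n !mulr1.
  by rewrite /c ler_piMr ?exprn_ile1// ltW.
have t1 : pnorm r (T n (w0 * 'X^d) - y) < eps / 3.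
  apply: le_lt_trans (shift_wave_hits hW p0 dh r0 dec kK yp) _.
  by apply: hp; rewrite leq_maxl.
have t2 : pnorm r ((c^-1)%:C *: T n (G * w0)) < eps / 3.
  rewrite pnormZ normcR_ge0//.
  apply: le_lt_trans (hH1 g (leq_maxl _ _)).
  apply: le_trans (ler_wpM2l ci0 (pnorm_shift_mul_wave y K n p0 dh r0 dec G_size)) _.
  rewrite -/S -/Y [leLHS](_ : _ = pnorm 1 G * (Y * S * (c^-1 / W g))); last by ring.
  have YS0 := mulr_ge0 Y0 S0.
  have cg0 : 0 <= c^-1 / W g by rewrite divr_ge0 ?invr_ge0 ?(weight_ge0 hW)// ltW.
  apply: le_trans (ler_pM (pnorm_ge0 G ler01) (mulr_ge0 YS0 cg0) nG (ler_wpM2l YS0 cinv)) _.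
  by rewrite le_eqVlt; apply/orP; left; apply/eqP; ring.
have t3 : pnorm r (T n (w ^+ 2 * Q)) < eps / 3.
  apply: le_lt_trans hG3.
  apply: le_trans (pnorm_shiftn hW n _ okr) _; rewrite -/rho.
  have nw3 : pnorm rho w <= c^-1 * (Y * S3) * (rho ^+ (2 * h) / W (2 * h)).
    by rewrite pnormZ normcR_ge0// -mulrA ler_wpM2l//; exact: (pnorm_wave hW y K p0 dh rho1 dec3).
  have nwQ : pnorm rho (w ^+ 2 * Q)
      <= (c^-1 * (Y * S3) * (rho ^+ (2 * h) / W (2 * h))) ^+ 2 * QB.
    apply: le_trans (pnormM _ _ rho0) _; rewrite ler_pM ?pnorm_ge0//; last first.
      by apply: le_trans nQ _; rewrite sP.
    apply: le_trans (pnormX _ _ rho0) _; rewrite lerXn2r ?nnegrE ?pnorm_ge0//.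
    exact: mulr_ge0 (mulr_ge0 ci0 (mulr_ge0 Y0 S30)) (divr_ge0 (exprn_ge0 _ rho0) (weight_ge0 hW _)).
  apply: le_trans (ler_wpM2l (weight_ge0 hW n) nwQ) _.
  rewrite [leLHS](_ : _ = (c^-1 * (Y * S3)) ^+ 2 * QB *
    (W n * (rho ^+ (2 * h) / W (2 * h)) ^+ 2)); last by ring.
  rewrite -[leRHS]mulrA.
  apply: (ler_wpM2l (mulr_ge0 (exprn_ge0 2 (mulr_ge0 ci0 (mulr_ge0 Y0 S30))) QB0)).
  exact: le_trans (wave_second_order hW okrho kph) (dec4l h).
apply: le_lt_trans (pnormD _ _ r0) _; apply: ltrD t3.
by apply: le_lt_trans (pnormD _ _ r0) _; apply: ltrD.
Qed.

End StageConstruction.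

(** * The universal sequence of polynomials *)

Section Countability.
Variable R : realType.

Lemma injective_unbounded (f : nat -> nat) H : injective f -> exists j, (H <= f j)%N.
Proof.
move=> fI; apply: contrapT => noj.
have lt j : (f j < H)%N by rewrite ltnNge; apply/negP => le; apply: noj; exists j.
have /leq_card : injective (fun j : 'I_H.+1 => Ordinal (lt j)).
  by move=> i j [] /fI/val_inj.
by rewrite !card_ord ltnn.
Qed.

Definition ratc (ab : rat * rat) : R[i] := ratr ab.1 +i* ratr ab.2.

Definition ratpoly (s : seq (rat * rat)) : {poly R[i]} := Poly (map ratc s).

Lemma rat_approx (x e : R) : 0 < e -> exists q : rat, `|ratr q - x| < e.
Proof.
move=> e0; have /rat_in_itvoo[q] : x - e < x + e by lra.
by rewrite in_itv/= => /andP[h1 h2]; exists q; rewrite ltr_norml; apply/andP; split; lra.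
Qed.

Lemma normc_le_ReIm (z : R[i]) : normc z <= `|complex.Re z| + `|complex.Im z|.
Proof.
case: z => a b /=; have ab0 : 0 <= `|a| + `|b| by rewrite addr_ge0.
rewrite -[leRHS]ger0_norm// -sqrtr_sqr ler_sqrt ?sqr_ge0// sqrrD !real_normK ?num_real//.
by rewrite lerD2r lerDl mulrn_wge0// mulr_ge0.
Qed.

Lemma ratc_approx (z : R[i]) (e : R) : 0 < e -> exists ab, normc (ratc ab - z) < e.
Proof.
move=> e0; have e2 : 0 < e / 2 by rewrite divr_gt0.
have [a ha] := rat_approx (complex.Re z) e2; have [b hb] := rat_approx (complex.Im z) e2.
exists (a, b); apply: le_lt_trans (normc_le_ReIm _) _.
by case: z ha hb => x y /= ha hb; rewrite (splitr e) ltrD.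
Qed.

Lemma ratpoly_dense (y : {poly R[i]}) (r e : R) : 0 <= r -> 0 < e ->
  exists s, pnorm r (ratpoly s - y) < e.
Proof.
move=> r0 e0; pose c := \sum_(i < size y) r ^+ i.
have c0 : 0 <= c by apply: sumr_ge0 => i _; exact: exprn_ge0.
have tol0 : 0 < e / (c + 1) by rewrite divr_gt0// ltr_wpDl.
have [f hf] := choice (fun z => @ratc_approx z _ tol0).
exists (map f y); rewrite (@pnorm_widen _ (size y)); last first.
  rewrite (leq_trans (size_polyD _ _))// geq_max size_polyN leqnn andbT.
  by rewrite (leq_trans (size_Poly _))// !size_map.
apply: (@le_lt_trans _ _ (\sum_(i < size y) (e / (c + 1)) * r ^+ i)).
  apply: ler_sum => i _; rewrite ler_wpM2r ?exprn_ge0//.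
  rewrite coefB coef_Poly -map_comp (nth_map 0)//=; exact: ltW.
rewrite -mulr_sumr -/c mulrAC ltr_pdivrMr ?ltr_wpDl// ltr_pM2l//.
by rewrite ltrDl ltr01.
Qed.

End Countability.

(** * Stability of finitely many iterates *)

Section Perturbation.
Variables (R : realType) (W : nat -> R) (kappa : R) (ok : R -> Prop).
Hypothesis hW : admissible_weight W kappa ok.
Local Notation T := (shiftn W).

(** Only finitely many shifts and a bounded set of polynomials P are involved, so one [eta] serves
    all of them. This turns a goal reached at [u] into a goal reached on a ball. *)
Lemma perturbation (u : {poly R[i]}) (r A eps : R) m n0 : ok r -> 0 <= A -> 0 < eps ->
  exists2 eta, 0 < eta & forall z P : {poly R[i]}, pnorm (kappa * r) z <= eta ->
    size P = m -> (forall i, normc P`_i <= A) -> forall n, (n <= n0)%N ->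
    pnorm r (T n (P \Po (u + z)) - T n (P \Po u)) <= eps.
Proof.
move=> okr A0 e0; have r0 := radius_ge0 hW okr.
have okk : ok (kappa * r) := radiusM hW (radius_kappa hW) okr.
have k0 := radius_ge0 hW okk.
pose B := 1 + pnorm (kappa * r) u.
have B1 : 1 <= B by rewrite lerDl pnorm_ge0.
have B0 : 0 <= B by apply: le_trans B1.
pose c := W n0 * (A * \sum_(l < m) l%:R * B ^+ l).
have c0 : 0 <= c.
  rewrite !mulr_ge0 ?(weight_ge0 hW)// sumr_ge0// => l _.
  by rewrite mulr_ge0 ?exprn_ge0.
exists (Num.min 1 (eps / (c + 1))).
  by rewrite lt_min ltr01 divr_gt0// ltr_wpDl.
move=> z P; rewrite le_min => /andP[z1 zc] sP PA n nn0.
rewrite -shiftnB; apply: le_trans (pnorm_shiftn hW n _ okr) _.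
rewrite !comp_polyE -sumrB sP.
have uz : pnorm (kappa * r) (u + z) <= B.
  by rewrite (le_trans (pnormD _ _ k0))// addrC /B lerD.
have h : pnorm (kappa * r) (\sum_(l < m) (P`_l *: (u + z) ^+ l - P`_l *: u ^+ l))
    <= pnorm (kappa * r) z * (A * \sum_(l < m) l%:R * B ^+ l).
  apply: le_trans (pnorm_sum _ _ _ k0) _; rewrite !mulr_sumr; apply: ler_sum => l _.
  rewrite -scalerBr pnormZ mulrCA ler_pM ?normc_ge0 ?pnorm_ge0//.
  by apply: pnorm_expB => //; rewrite lerDr.
apply: (@le_trans _ _ (W n0 * (pnorm (kappa * r) z * (A * \sum_(l < m) l%:R * B ^+ l)))).
  by rewrite ler_pM ?(weight_ge0 hW) ?pnorm_ge0 ?(le_weight hW).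
rewrite mulrCA -/c; apply: (@le_trans _ _ (eps / (c + 1) * c)).
  by rewrite ler_wpM2r.
rewrite mulrAC ler_pdivrMr ?ltr_wpDl// ler_wpM2l ?(ltW e0)//.
by rewrite lerDl ler01.
Qed.

End Perturbation.

(** * Scheduling of the stages and passage to the limit *)

Section UniversalSequence.
Variables (R : realType) (W : nat -> R) (kappa : R) (ok : R -> Prop).
Hypothesis hW : admissible_weight W kappa ok.
Variable rad : nat -> R.
Hypotheses (ok_rad : forall n, ok (rad n))
  (rad_cofinal : forall r, ok r -> exists n0, forall n, (n0 <= n)%N -> r <= rad n).
Local Notation T := (shiftn W).
Local Notation key := (nat * (seq (rat * rat) * nat * nat))%type.

(** The first component of a key is a dummy counter, which makes each triple of target, degree and
    level recur at arbitrarily late stages. The default for indices that code nothing is a harmless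
    task. *)
Definition task t : key := odflt (0, ([::], 0, 0))%N (unpickle t).
Definition task_target t : {poly R[i]} := ratpoly R (task t).2.1.1.
Definition task_degree t := (task t).2.1.2.
Definition task_level t := (task t).2.2.

Lemma task_cofinal s m nu H : exists2 t, (H <= t)%N &
  (task t).2 = (s, m, nu).
Proof.
have inj : injective (fun j : nat => pickle ((j, (s, m, nu)) : key)).
  by move=> i j /(pcan_inj pickleK)[].
have [j hj] := injective_unbounded H inj.
by exists (pickle ((j, (s, m, nu)) : key)) => //; rewrite /task pickleK.
Qed.

(** The radius in which the correction of stage t is measured. A product rather than a maximum,
    because admissible radii are only assumed stable under products. *)
Fixpoint control t : R :=
  if t is t'.+1 then control t' * (kappa * rad (task_level t') * rad t') else kappa.

Lemma ok_control t : ok (control t).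
Proof.
elim: t => [|t IH] /=; first exact: radius_kappa hW.
by do ![apply: (radiusM hW) => //]; exact: radius_kappa hW.
Qed.

Lemma control_ge t : [/\ control t <= control t.+1,
  kappa * rad (task_level t) <= control t.+1 & rad t <= control t.+1].
Proof.
have c1 := radius_ge1 hW (ok_control t).
have k1 := radius_ge1 hW (radius_kappa hW).
have a1 := radius_ge1 hW (ok_rad (task_level t)).
have b1 := radius_ge1 hW (ok_rad t).
have ka1 : 1 <= kappa * rad (task_level t) by rewrite mulr_ege1.
have kab1 : 1 <= kappa * rad (task_level t) * rad t by rewrite mulr_ege1.
have c0 := le_trans ler01 c1; have ka0 := le_trans ler01 ka1.
have kab0 := le_trans ler01 kab1; have b0 := le_trans ler01 b1.
split=> /=; first by rewrite ler_peMr.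
  by apply: (@le_trans _ _ (kappa * rad (task_level t) * rad t)); rewrite ?ler_peMr ?ler_peMl.
by apply: (@le_trans _ _ (kappa * rad (task_level t) * rad t)); rewrite ler_peMl.
Qed.

Lemma le_control t s : (t <= s)%N -> control t <= control s.
Proof.
by move=> ts; apply: (@homo_leq _ control <=%R) ts => // [y x z|n];
  [exact: le_trans|have [] := control_ge n].
Qed.

(** The ball is measured at [control t.+1], which dominates the radius needed by [perturbation]. Of
    the two errors 1/(nu + 1), one comes from the stage and one from the perturbation [z]. *)
Definition achieves (period : seq (rat * rat) * nat -> nat) t
    (u : {poly R[i]}) (tau : R) :=
  exists2 h, (t <= h)%N & forall z, pnorm (control t.+1) z <= tau ->
    forall P : {poly R[i]}, P \is monic -> size P = (task_degree t).+2 ->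
    (forall i, normc P`_i <= (task_level t)%:R) ->
    forall k, (k * period ((task t).2.1.1, task_level t) <= h)%N ->
    pnorm (rad (task_level t))
      (T (2 * h + k * period ((task t).2.1.1, task_level t)) (P \Po (u + z))
        - task_target t) <= (task_level t).+1%:R^-1 *+ 2.

(** [period] sees the target and the level, not the degree nor the polynomial already built; a
    recurring task thus keeps its period. *)
Lemma exists_period : exists2 period, (forall x, (0 < period x)%N) &
  forall t (u : {poly R[i]}) (tau : R), 0 < tau -> exists u' tau',
    [/\ 0 < tau' <= tau / 2, pnorm (control t) (u' - u) <= tau / 2,
        forall i, (i < t)%N -> u'`_i = u`_i & achieves period t u' tau'].
Proof.
have e0 nu : 0 < nu.+1%:R^-1 :> R by rewrite invr_gt0 ltr0n.
have [period hperiod] := choice (fun x : seq (rat * rat) * nat =>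
  let: ex_intro2 p p0 hp := stage hW (ratpoly R x.1) (e0 x.2) (ok_rad x.2) in
  ex_intro (fun p => _ /\ _) p (conj p0 hp)).
exists period => [x|t u tau tau0]; first by have [] := hperiod x.
set nu := task_level t; set m := task_degree t.
have [p0 hp] := hperiod ((task t).2.1.1, nu).
have tau20 : 0 < tau / 2 by rewrite divr_gt0.
have [v [h [th vtau vt hv]]] := hp u m nu%:R (tau / 2) (control t) t (ler0n R nu)
  tau20 (ok_control t).
(* All return times 2h + kp with kp <= h are at most 3h. *)
have [eta eta0 heta] := perturbation hW (u + v) m.+2 (3 * h) (ok_rad nu) (ler0n R nu) (e0 nu).
exists (u + v), (Num.min (tau / 2) eta); split.
- by rewrite lt_min tau20 eta0/= ge_min lexx.
- by rewrite addrC addKr ltW.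
- by move=> i it; rewrite coefD vt// addr0.
exists h => // z; rewrite le_min => /andP[_ zeta] P Pm sP PA k kh.
have r0 := radius_ge0 hW (ok_rad nu).
set n := (2 * h + _)%N.
rewrite (_ : T n _ - _ = (T n (P \Po (u + v + z)) - T n (P \Po (u + v)))
  + (T n (P \Po (u + v)) - task_target t)); last by rewrite subrKA.
apply: le_trans (pnormD _ _ r0) _; rewrite mulr2n lerD//.
  apply: (heta z P _ sP PA); last by rewrite /n; lia.
  apply: le_trans zeta; apply: pnorm_le; last by have [] := control_ge t.
  by rewrite mulr_ge0// (radius_ge0 hW (radius_kappa hW)).
by apply: ltW; exact: hv.
Qed.

Theorem universal_sequence : exists u : nat -> {poly R[i]},
  [/\ forall t s i, (i < t)%N -> (t <= s)%N -> (u s)`_i = (u t)`_i,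
      forall r eps, ok r -> 0 < eps -> exists t0, forall t s, (t0 <= t)%N ->
        (t <= s)%N -> pnorm r (u s - u t) <= eps
    & forall (y P : {poly R[i]}) r eps, ok r -> 0 < eps -> (1 < size P)%N ->
      exists2 p, (0 < p)%N & forall H, exists2 h, (H <= h)%N & exists t0, forall s,
        (t0 <= s)%N -> forall k, (k * p <= h)%N ->
        pnorm r (T (2 * h + k * p) (P \Po u s) - y) <= eps].
Proof.
have [period period0 hstep] := exists_period.
(* [choice] wants a total relation: nonpositive tolerances receive a dummy value. *)
have hstep' (tx : nat * ({poly R[i]} * R)) : exists x' : {poly R[i]} * R, 0 < tx.2.2 ->
    [/\ 0 < x'.2 <= tx.2.2 / 2, pnorm (control tx.1) (x'.1 - tx.2.1) <= tx.2.2 / 2,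
        forall i, (i < tx.1)%N -> x'.1`_i = tx.2.1`_i & achieves period tx.1 x'.1 x'.2].
  case: tx => t [u tau] /=; case: (ltP 0 tau) => tau0; last by exists (0, 0).
  by have [u' [tau' ?]] := hstep t u tau tau0; exists (u', tau').
have [next hnext] := choice hstep'.
pose st := fix st t := if t is t'.+1 then next (t', st t') else (0 : {poly R[i]}, 1 : R).
have tau0 t : 0 < (st t).2.
  by elim: t => [|t IH] /=; [exact: ltr01|have [/andP[]] := hnext (t, st t) IH].
have hst t : [/\ 0 < (st t.+1).2 <= (st t).2 / 2,
    pnorm (control t) ((st t.+1).1 - (st t).1) <= (st t).2 / 2,
    forall i, (i < t)%N -> (st t.+1).1`_i = (st t).1`_i
  & achieves period t (st t.+1).1 (st t.+1).2] by exact: hnext (t, st t) (tau0 t).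
(* As the tolerances at least halve, half of tau_t is at most tau_t - tau_(t+1), and the distances
   telescope. *)
have cauchy t s : (t <= s)%N -> pnorm (control t) ((st s).1 - (st t).1) <= (st t).2 - (st s).2.
  move=> ts; rewrite -(subnKC ts); elim: (s - t)%N => [|d IH].
    by rewrite addn0 !subrr pnorm0.
  have c0 := radius_ge0 hW (ok_control t).
  rewrite addnS -(subrKA (st (t + d)).1); apply: le_trans (pnormD _ _ c0) _.
  have [/andP[_ h1] h2 _ _] := hst (t + d)%N.
  have h3 : pnorm (control t) ((st (t + d).+1).1 - (st (t + d)).1) <= (st (t + d)).2 / 2.
    by apply: le_trans h2; apply: pnorm_le => //; apply: le_control; rewrite leq_addr.
  lra.
have cauchy' t s : (t <= s)%N -> pnorm (control t) ((st s).1 - (st t).1) <= (st t).2.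
  by move=> /cauchy/le_trans; apply; rewrite gerBl ltW.
have tau_geo t : (st t).2 <= 2^-1 ^+ t.
  elim: t => [|t IH]; first by rewrite expr0.
  have [/andP[_ h1] _ _ _] := hst t; apply: le_trans h1 _.
  by rewrite exprS mulrC ler_wpM2l ?invr_ge0.
exists (fun t => (st t).1); split.
- move=> t s i it ts; rewrite -(subnKC ts); elim: (s - t)%N => [|d IH]; first by rewrite addn0.
  have [_ _ h _] := hst (t + d)%N; rewrite addnS h ?IH//.
  by rewrite (leq_trans it)// leq_addr.
- move=> r eps okr e0; have [n0 hn0] := rad_cofinal okr.
  have h2 : 0 < (2^-1 : R) < 1 by rewrite invr_gt0 ltr0n invf_lt1 ?ltr1n ?ltr0n.
  have [H hH] := geometric_eventually_lt 1 h2 e0.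
  exists (maxn n0 H).+1 => t s; case: t => // t; rewrite ltnS geq_max => /andP[n0t Ht] ts.
  have r0 := radius_ge0 hW okr.
  apply: (@le_trans _ _ (pnorm (control t.+1) ((st s).1 - (st t.+1).1))).
    by apply: pnorm_le => //; have [_ _ h] := control_ge t; rewrite (le_trans (hn0 _ n0t)).
  apply: le_trans (cauchy' _ _ ts) _; apply: le_trans (tau_geo _) _.
  by rewrite ltW// -[ltLHS]mul1r hH// ltnW.
move=> y P r eps okr e0 sP.
set a := lead_coef P.
have a0 : a != 0 by rewrite lead_coef_eq0 -size_poly_gt0 ltnW.
have na0 : 0 < normc a by rewrite normc_gt0.
pose P1 := a^-1 *: P.
have P1m : P1 \is monic by rewrite monicE lead_coefZ mulVf.
have [m sP1] : exists m, size P1 = m.+2.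
  rewrite size_scale ?invr_eq0//; by case: (size P) sP => [|[|m]] // _; exists m.
have [n0 hn0] := rad_cofinal okr.
(* P is replaced by the monic P1 and y by a^-1 y. The level must dominate r, bound the coefficients
   of P1, and give 3/(nu + 1) <= eps / |a|: two errors from [achieves], one from the rational
   approximation of the target. *)
pose nu := maxn n0 (maxn (Num.bound (pnorm 1 P1)) (Num.bound (3 * normc a / eps))).
have nuP i : normc P1`_i <= nu%:R.
  apply: (@le_trans _ _ (pnorm 1 P1)).
    apply: le_trans (pnorm_partial P1 i.+1 ler01); rewrite big_ord_recr/= expr1n mulr1 lerDr.
    by apply: sumr_ge0 => j _; rewrite expr1n mulr1 normc_ge0.
  have /ltW/le_trans := archi_boundP (pnorm_ge0 P1 ler01); apply.
  by rewrite ler_nat /nu !leq_max leqnn/= orbT.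
have nue : nu.+1%:R^-1 *+ 3 <= eps / normc a.
  have q0 : 0 <= 3 * normc a / eps by rewrite divr_ge0 ?mulr_ge0 ?normc_ge0 ?ltW.
  have h : 3 * normc a / eps <= nu.+1%:R.
    apply: le_trans (ltW (archi_boundP q0)) _; rewrite ler_nat leqW// /nu !leq_max leqnn.
    by rewrite !orbT.
  rewrite -[leLHS]mulr_natl ler_pdivrMr ?ltr0n// mulrAC ler_pdivlMr//.
  by move: h; rewrite ler_pdivrMr// [_ * eps]mulrC.
have nur : r <= rad nu by apply: hn0; rewrite leq_maxl.
have nu0 : 0 < nu.+1%:R^-1 :> R by rewrite invr_gt0 ltr0n.
have rn0 := radius_ge0 hW (ok_rad nu).
have [s hs] := ratpoly_dense (a^-1 *: y) rn0 nu0.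
exists (period (s, nu)) => // H.
have [t Ht ht] := task_cofinal s m nu H.
have [_ _ _ [h th hh]] := hst t.
exists h; first exact: leq_trans th.
exists t.+1 => s' ts' k kh.
have tl : task_level t = nu by rewrite /task_level ht.
have td : task_degree t = m by rewrite /task_degree ht.
have := hh ((st s').1 - (st t.+1).1) (cauchy' _ _ ts') P1 P1m.
rewrite (addrC _ (_ - _)) subrK td tl /task_target ht /= => /(_ sP1 nuP k kh) hfin.
set n := (2 * h + _)%N in hfin *.
have -> : T n (P \Po (st s').1) - y
    = a *: ((T n (P1 \Po (st s').1) - ratpoly R s) + (ratpoly R s - a^-1 *: y)).
  rewrite subrKA scalerBr !scalerA mulfV// scale1r comp_polyZ shiftnZ scalerA mulfV//.
  by rewrite scale1r.
rewrite pnormZ mulrC -ler_pdivlMr//; apply: le_trans nue.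
apply: le_trans (pnorm_le _ (radius_ge0 hW okr) nur) _.
apply: le_trans (pnormD _ _ rn0) _.
by rewrite mulrSr lerD// ltW.
Qed.

End UniversalSequence.

(** * Weights and upper density *)

Section Weights.
Variable R : realType.

Lemma geometric_admissible (lambda : R) : 1 < lambda ->
  admissible_weight (fun n => lambda ^+ n) 1 (fun r => r = 1).
Proof.
move=> l1; have l0 : 0 < lambda by apply: lt_trans l1.
split => //.
- by move=> n; rewrite exprn_ege1// ltW.
- by move=> a b; rewrite exprD.
- by move=> a b; rewrite expr1n mulr1 exprD.
- by move=> r ->.
- by move=> r s -> ->; rewrite mulr1.
move=> r ->; exists 1, lambda^-1; split => //.
  by rewrite invr_gt0 l0 invf_lt1.
by move=> l; rewrite expr1n !mul1r exprVn.
Qed.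

Lemma bin_le_exp2 n m : ('C(n, m) <= 2 ^ n)%N.
Proof.
elim: n m => [|n IH] [|m]; rewrite ?bin0 ?expn_gt0//.
by rewrite binS expnS mul2n -addnn leq_add.
Qed.

(** Up to the integer bound N of c the power is at most (N + 1)^N; beyond it, each new factor c is
    at most the new factor of the factorial. *)
Lemma exp_le_fact (c : R) : 0 <= c -> exists2 D, 0 <= D & forall l, c ^+ l <= D * l`!%:R.
Proof.
move=> c0; pose N := Num.bound c.
have cN : c <= N%:R by rewrite ltW// archi_boundP.
have N1 : (0 : R) <= N%:R ^+ N by rewrite exprn_ge0.
exists ((N%:R + 1) ^+ N); first by rewrite exprn_ge0// addr_ge0.
have B1 : 1 <= N%:R + 1 :> R by rewrite lerDr.
have cB : c <= N%:R + 1 by apply: le_trans cN _; rewrite lerDl.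
elim=> [|l IH]; first by rewrite expr0 fact0 mulr1 exprn_ege1.
have [lN|Nl] := leqP l.+1 N.
  apply: (@le_trans _ _ ((N%:R + 1) ^+ N)).
    apply: (@le_trans _ _ ((N%:R + 1) ^+ l.+1)).
      by rewrite lerXn2r// nnegrE// (le_trans c0).
    by rewrite ler_weXn2l.
  by rewrite ler_peMr ?exprn_ge0 ?addr_ge0// ler1n fact_gt0.
rewrite exprS factS natrM mulrCA ler_pM ?exprn_ge0//.
by rewrite (le_trans cN)// ler_nat ltnW.
Qed.

Lemma factorial_admissible : admissible_weight (fun n => n`!%:R) 2 (fun r : R => 1 <= r).
Proof.
split => //.
- by move=> n; rewrite ler1n fact_gt0.
- move=> a b; rewrite -natrM ler_nat -(@bin_fact (a + b) a) ?leq_addr// addKn.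
  by rewrite leq_pmull// bin_gt0 leq_addr.
- move=> a b; rewrite -natrX -!natrM ler_nat -(@bin_fact (a + b) a) ?leq_addr// addKn.
  by rewrite mulnC leq_mul2l bin_le_exp2 orbT.
- by move=> r s r1 s1; rewrite mulr_ege1.
- by rewrite ler1n.
move=> r r1; have r0 : 0 <= r by apply: le_trans r1.
(* Taken at 2r to gain the ratio 1/2. *)
have [D D0 hD] := exp_le_fact (mulr_ge0 (ler0n R 2) r0).
exists D, 2^-1; split => //; first by apply/andP; split; lra.
move=> l; rewrite ler_pdivrMr ?ltr0n ?fact_gt0// mulrAC exprVn.
by rewrite ler_pdivlMr ?exprn_gt0// mulrC -exprMn.
Qed.

End Weights.

(** Among the integers up to 3h at least floor(h/p) + 1 belong to [A], and 4p (floor(h/p) + 1) >=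
    4(h + 1) >= 3h + 1. As h is arbitrarily large, each tail supremum sees the proportion 1/(4p). *)
Lemma upper_density_gt0 (R : realType) (A : set nat) p : (0 < p)%N ->
  (forall H, exists2 h, (H <= h)%N & forall k, (k * p <= h)%N -> A (2 * h + k * p)%N) ->
  (0 < upper_density R A)%E.
Proof.
move=> p0 hA; pose c : R := (4 * p)%:R^-1.
have c0 : 0 < c by rewrite invr_gt0 ltr0n muln_gt0.
apply: (@lt_le_trans _ _ c%:E); first by rewrite lte_fin.
rewrite /upper_density limn_esup_lim; apply: lime_ge; first exact: is_cvg_esups.
apply: nearW => H; have [h Hh hk] := hA H.
apply: (@le_trans _ _
  (#|[pred k : 'I_(3 * h).+1 | `[< A k >]]|%:R / (3 * h).+1%:R)%:E); last first.
  apply: ereal_sup_ubound; exists (3 * h)%N => //=.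
  by rewrite (leq_trans Hh)// leq_pmull.
rewrite lee_fin ler_pdivlMr ?ltr0n// ler_pdivrMl ?ltr0n ?muln_gt0//.
rewrite -natrM ler_nat.
suff : ((h %/ p).+1 <= #|[pred k : 'I_(3 * h).+1 | `[< A k >]]|)%N.
  move=> le; apply: (@leq_trans (4 * p * (h %/ p).+1)); last by rewrite leq_mul2l le orbT.
  have : (h < (h %/ p).+1 * p)%N by rewrite ltn_ceil.
  nia.
have lt (k : 'I_(h %/ p).+1) : (2 * h + k * p < (3 * h).+1)%N.
  have : (k * p <= h)%N by rewrite -leq_divRL// -ltnS.
  lia.
have inj : injective (fun k : 'I_(h %/ p).+1 => Ordinal (lt k)).
  by move=> i j [] /addnI/eqP; rewrite eqn_pmul2r// => /eqP/val_inj.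
rewrite -[leqLHS]card_ord -(card_codom inj); apply/subset_leq_card/fintype.subsetP => i.
move=> /codomP[k ->]; rewrite inE /=; apply/asboolP/asboolP; apply: hk.
by rewrite -leq_divRL// -ltnS.
Qed.

(** Having no unit means P(0) = 0; this rules out nonzero constants, which the shifts would
    annihilate. *)
Lemma comp_poly_coef_nonconstant (R : realType) (P : {poly R[i]}) :
  P`_0 = 0 -> P != 0 -> (1 < size P)%N.
Proof.
move=> P0 Pn0; rewrite ltnNge; apply/negP => /size1_polyC PE.
by move: Pn0; rewrite PE P0 polyC0 eqxx.
Qed.

(** * The algebra in l1 *)

Section EllOne.
Variable R : realType.

Lemma ell1_truncation (y : ell1 R) (e : R) : 0 < e -> exists q : {poly R[i]},
  forall L, \sum_(i < L) normc (q`_i - y i) <= e.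
Proof.
move=> e0.
have [n hn] : exists n, fine (l1norm y) - e < \sum_(i < n) normc (y i).
  apply: contrapT => /forallNP hn.
  suff : (l1norm y <= (fine (l1norm y) - e)%:E)%E.
    rewrite -{1}(fineK (l1norm_fin_num y)) lee_fin; lra.
  by apply: l1norm_le => N; rewrite lee_fin leNgt; apply/negP; exact: hn.
exists (\poly_(i < n) y i) => L.
have le_l1 N : \sum_(i < N) normc (y i) <= fine (l1norm y).
  by rewrite -lee_fin fineK ?l1norm_fin_num// l1norm_partial.
apply: (@le_trans _ _ (\sum_(i < n + L) normc ((\poly_(i < n) y i)`_i - y i))).
  rewrite addnC big_split_ord/= lerDl; apply: sumr_ge0 => i _; exact: normc_ge0.
rewrite big_split_ord/= big1 ?add0r; last first.
  by move=> i _; rewrite coef_poly ltn_ord subrr normc0.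
apply: (@le_trans _ _ (\sum_(i < L) normc (y (n + i)%N))).
  by apply: ler_sum => i _; rewrite coef_poly ltnNge leq_addr/= sub0r normcN.
have := le_l1 (n + L)%N; rewrite big_split_ord/=; lra.
Qed.

Lemma iter_scaled_shift (lambda : R) n (x : ell1 R) i :
  iter n (fun x => lambda%:C *: backward_shift x) x i = (lambda ^+ n)%:C * x (i + n)%N.
Proof.
elim: n i => [|n IH] i; first by rewrite expr0 mul1r addn0.
rewrite iterS -[LHS]/(lambda%:C * iter n _ x i.+1) IH addSnnS mulrA.
by rewrite -rmorphM exprS.
Qed.

Theorem ell1_algebra (lambda : R) : 1 < lambda -> exists A : set (ell1 R),
  upper_frequently_hypercyclic_algebra setT (@ell1_conv R)
    (fun x => lambda%:C *: backward_shift x) A.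
Proof.
move=> l1; have hW := geometric_admissible l1.
have l0 : 0 < lambda by apply: lt_trans l1.
have cof (r : R) : r = 1 -> exists n0 : nat, forall n, (n0 <= n)%N -> r <= 1.
  by move=> ->; exists 0%N.
have [u [ustab ucau uhit]] :=
  @universal_sequence R _ _ _ hW (fun=> 1) (fun=> erefl) cof.
(* Coefficient i no longer changes from stage i + 1 on. *)
pose xf i := (u i.+1)`_i.
have xu s i : (i < s)%N -> xf i = (u s)`_i.
  by move=> is_; rewrite /xf (ustab i.+1 s).
have xsum : xf \in @summable_pred R.
  rewrite inE; have [t0 h] := ucau 1 1 erefl ltr01.
  apply: (@le_lt_trans _ _ (pnorm 1 (u t0) + 1)%:E); last exact: ltry.
  apply: l1norm_le => N; rewrite lee_fin.
  pose s := maxn N t0.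
  apply: (@le_trans _ _ (pnorm 1 (u s))).
    apply: le_trans (pnorm_partial (u s) N ler01); apply: ler_sum => i _.
    by rewrite expr1n mulr1 (xu s)// (leq_trans (ltn_ord i))// leq_maxl.
  rewrite -[u s](subrK (u t0)) addrC; apply: le_trans (pnormD _ _ ler01) _.
  by rewrite lerD2l; apply: h => //; rewrite leq_maxr.
pose x : ell1 R := Ell1 xsum.
pose T : ell1 R -> ell1 R := fun x => lambda%:C *: backward_shift x.
(* The relation a = P(x), read on coefficients: l < t ensures that the coefficient is already final
   in [u t]. Closure under the algebra operations then reduces to identities between polynomials. *)
pose represents (a : ell1 R) P := forall t l, (l < t)%N -> a l = (P \Po u t)`_l.
pose A := [set a : ell1 R | exists P : {poly R[i]}, P`_0 = 0 /\ represents a P].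
have Ax : A x.
  by exists 'X; split=> [|t l lt]; rewrite ?coefX// comp_polyX -xu.
have hit (a : ell1 R) (P : {poly R[i]}) (y0 : ell1 R) (e : R) : (1 < size P)%N -> represents a P -> 0 < e ->
    exists2 p, (0 < p)%N & forall H, exists2 h, (H <= h)%N & forall k, (k * p <= h)%N ->
      (l1norm (iter (2 * h + k * p) T a - y0 : ell1 R)%R <= e%:E)%E.
  move=> sP aP e0; have e20 : 0 < e / 2 by rewrite divr_gt0.
  have [y hy] := ell1_truncation y0 e20.
  have [p p0 hp] := uhit y P 1 (e / 2) erefl e20 sP.
  exists p => // H; have [h Hh [t0 ht0]] := hp H.
  exists h => // k kh; set n := (2 * h + k * p)%N.
  apply: l1norm_le => L; rewrite lee_fin (splitr e).
  (* The first L coefficients after n shifts involve those of index below L + n, hence this s. *)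
  pose s := maxn t0 (L + n).
  have := ht0 s (leq_maxl _ _) k kh; rewrite -/n => hs.
  apply: le_trans (lerD hs (hy L)).
  apply: le_trans (lerD (pnorm_partial _ L ler01) (lexx _)).
  rewrite -big_split/=; apply: ler_sum => i _.
  rewrite -[leLHS]/(normc (iter n T a i - y0 i)) iter_scaled_shift (aP s); last first.
    by apply: leq_trans (leq_maxr t0 (L + n)); rewrite ltn_add2r.
  rewrite expr1n mulr1 coefB coef_shiftn exprD mulrAC divff ?mul1r ?expf_neq0 ?gt_eqF//.
  by rewrite -(subrKA y`_i) le_normcD.
exists A; split => //.
- split.
  + by exists 0; split=> [|t l lt]; rewrite ?coef0// comp_poly0 coef0.
  + move=> a b [P [P0 aP]] [Q [Q0 bQ]]; exists (P + Q); split=> [|t l lt].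
      by rewrite coefD P0 Q0 addr0.
    by rewrite comp_polyD coefD -aP// -bQ.
  + move=> c a [P [P0 aP]]; exists (c *: P); split=> [|t l lt].
      by rewrite coefZ P0 mulr0.
    by rewrite comp_polyZ coefZ -aP.
  + move=> a b [P [P0 aP]] [Q [Q0 bQ]]; exists (P * Q); split=> [|t l lt].
      by rewrite coefM big_ord1 P0 mul0r.
    rewrite comp_polyM coefM; apply: eq_bigr => j _.
    rewrite -(aP t) -?(bQ t)// ?(leq_ltn_trans (leq_subr _ _))//.
    by rewrite (leq_ltn_trans _ lt)// -ltnS.
(* The generator is nonzero, since the constant coefficient of one of its iterates lies within 1/2
   of 1. *)
- move=> A0; have x0 : x = 0 by have := Ax; rewrite A0.
  have h20 : 0 < 2^-1 :> R by rewrite invr_gt0.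
  have [|p p0 hp] := uhit 1 'X 1 2^-1 erefl h20; first by rewrite size_polyX.
  have [h _ [t0 ht0]] := hp 0%N.
  pose s := maxn t0 (2 * h).+1.
  have := ht0 s (leq_maxl _ _) 0%N (leq0n _).
  move/(le_trans (pnorm_partial _ 1 ler01)).
  rewrite big_ord1 expr0 mulr1 coefB coef_shiftn coef1 comp_polyX addn0 add0n.
  rewrite -xu ?leq_maxr// -[xf _]/(x (2 * h)%N) x0 mulr0 sub0r normcN normc1.
  lra.
move=> a [P [P0 aP]] a0; split => // U Uo [y0 [_ Uy0]].
have Pn0 : P != 0.
  apply/eqP => PE; apply: a0; apply: val_inj; apply: funext => l /=.
  by rewrite (aP l.+1)// PE comp_poly0 coef0.
have sP := comp_poly_coef_nonconstant P0 Pn0.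
have : nbhs y0 U by exact: open_nbhs_nbhs.
move=> /nbhs_ballP[e /= e0 eU].
have [e' e'0 ee'] : exists2 e' : R, 0 < e' & e = e'%:C.
  exists (complex.Re e); first by move: e0; rewrite ltcE => /andP[].
  by move: e0; case: (e) => r i; rewrite ltcE /= => /andP[/eqP-> _].
have e'20 : 0 < e' / 2 by rewrite divr_gt0.
have [p p0 hp] := hit a P y0 (e' / 2) sP aP e'20.
refine (@upper_density_gt0 R _ p p0 _) => H; have [h Hh hh] := hp H.
exists h => // k kh; split => //; apply: eU.
rewrite -ball_normE /= distrC ee'.
rewrite -[X in X < _]/(ell1_norm _) ltcR.
apply: (@le_lt_trans _ _ (e' / 2)); last by rewrite ltr_pdivrMr// ltr_pMr// ltr1n.
by rewrite -lee_fin fineK ?l1norm_fin_num// hh.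
Qed.

End EllOne.

(** * Integration on rectangles *)

Section Subdivision.
Variable R : realType.
Implicit Types (a c w l x y : R).

(* Bisection, in place of the compactness of rectangles: it gives Goursat's
   theorem as well as boundedness and uniform continuity. *)
Lemma rectangle_ind (Q : R -> R -> R -> R -> Prop) :
    (forall a c w l, 0 <= w -> 0 <= l ->
      Q a c (w / 2) (l / 2) -> Q (a + w / 2) c (w / 2) (l / 2) ->
      Q a (c + l / 2) (w / 2) (l / 2) -> Q (a + w / 2) (c + l / 2) (w / 2) (l / 2) ->
      Q a c w l) ->
    (forall x y, exists2 d, 0 < d & forall a c w l, a <= x <= a + w -> c <= y <= c + l ->
      w < d -> l < d -> Q a c w l) ->
  forall a c w l, 0 <= w -> 0 <= l -> Q a c w l.
Proof.
move=> Qsplit Qloc a c w l w0 l0; apply: contrapT => nQ.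
pose W n := w / 2 ^+ n; pose L n := l / 2 ^+ n.
have WS n : W n.+1 = W n / 2 by rewrite /W exprSr invfM mulrA.
have LS n : L n.+1 = L n / 2 by rewrite /L exprSr invfM mulrA.
have W0 n : 0 <= W n by rewrite divr_ge0 ?exprn_ge0.
have L0 n : 0 <= L n by rewrite divr_ge0 ?exprn_ge0.
have step (t : nat * (R * R)) : exists p' : R * R,
    ~ Q t.2.1 t.2.2 (W t.1) (L t.1) ->
    [/\ ~ Q p'.1 p'.2 (W t.1.+1) (L t.1.+1), t.2.1 <= p'.1 <= t.2.1 + W t.1 / 2
      & t.2.2 <= p'.2 <= t.2.2 + L t.1 / 2].
  case: t => n [x y] /=; have := W0 n; have := L0 n => Ln Wn.
  have [?|nq] := pselect (Q x y (W n) (L n)); first by exists (0, 0).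
  have [q1|n1] := pselect (Q x y (W n / 2) (L n / 2)); last first.
    by exists (x, y) => _; rewrite WS LS; split => //=; apply/andP; split; lra.
  have [q2|n2] := pselect (Q (x + W n / 2) y (W n / 2) (L n / 2)); last first.
    by exists (x + W n / 2, y) => _; rewrite WS LS; split => //=; apply/andP; split; lra.
  have [q3|n3] := pselect (Q x (y + L n / 2) (W n / 2) (L n / 2)); last first.
    by exists (x, y + L n / 2) => _; rewrite WS LS; split => //=; apply/andP; split; lra.
  have [q4|n4] := pselect (Q (x + W n / 2) (y + L n / 2) (W n / 2) (L n / 2)); last first.
    exists (x + W n / 2, y + L n / 2) => _; rewrite WS LS.
    by split => //=; apply/andP; split; lra.
  by exfalso; apply: nq; exact: Qsplit.
have [next hnext] := choice step.
pose p := fix p n := if n is n'.+1 then next (n', p n') else (a, c).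
have bad n : ~ Q (p n).1 (p n).2 (W n) (L n).
  elim: n => [|n IH]; first by rewrite /W /L expr0 !divr1.
  by have [] := hnext (n, p n) IH.
have [hx hy] : (forall n, (p n).1 <= (p n.+1).1 <= (p n).1 + W n / 2) /\
    (forall n, (p n).2 <= (p n.+1).2 <= (p n).2 + L n / 2).
  by split=> n; have [] := hnext (n, p n) (bad n).
have nested (z V : nat -> R) : (forall n, 0 <= V n) -> (forall n, V n.+1 = V n / 2) ->
    (forall n, z n <= z n.+1 <= z n + V n / 2) ->
    exists x, forall n, z n <= x <= z n + V n.
  move=> V0 VS hz.
  have lez n m : z (n + m)%N <= z n + V n - V (n + m)%N /\ z n <= z (n + m)%N.
    elim: m => [|m [IH1 IH2]]; first by rewrite addn0; split; lra.
    rewrite addnS VS; have /andP[h1 h2] := hz (n + m)%N; have := V0 (n + m)%N.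
    by split; lra.
  have ub n : ubound (range z) (z n + V n).
    move=> _ [m _ <-]; have [mn|/ltnW nm] := leqP m n.
      have := V0 n; have [_] := lez m (n - m)%N; rewrite subnKC//; lra.
    have [] := lez n (m - n)%N; rewrite subnKC//; have := V0 m; lra.
  exists (sup (range z)) => n; apply/andP; split.
    by apply: ub_le_sup; [exists (z 0%N + V 0%N); exact: ub|exists n].
  by apply: ge_sup; [exists (z 0%N); exists 0%N|exact: ub].
have [x hxx] := nested _ _ W0 WS hx; have [y hyy] := nested _ _ L0 LS hy.
have [d d0 hd] := Qloc x y.
have half01 : 0 < (2^-1 : R) < 1 by rewrite invr_gt0 ltr0n invf_lt1 ?ltr1n ?ltr0n.
have [N1 hN1] := geometric_eventually_lt w half01 d0.
have [N2 hN2] := geometric_eventually_lt l half01 d0.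
have := bad (maxn N1 N2); apply; apply: hd => //.
  by rewrite /W -exprVn hN1// leq_maxl.
by rewrite /L -exprVn hN2// leq_maxr.
Qed.

End Subdivision.

(** * Real integrals through their primitives *)

Section RealIntegral.
Variable R : realType.
Local Notation mu := (@lebesgue_measure R).
Implicit Types (h F f : R -> R) (a b : R).

(** The mean value theorem. Integrals below are compared by differentiating primitives, so that
    equalities and inequalities all reduce to this lemma. *)
Lemma derive_mono F f a b : a <= b ->
  (forall x, a <= x <= b -> is_derive x 1 F (f x)) ->
  (forall x, a <= x <= b -> 0 <= f x) -> F a <= F b.
Proof.
move=> ab dF f0; rewrite -subr_ge0.
have [||c] := @MVT_segment R F f a b ab.
- by move=> x; rewrite in_itv/= => /andP[/ltW ax /ltW xb]; apply: dF; rewrite ax.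
- apply: derivable_within_continuous => x; rewrite in_itv/= => xab.
  by have [] := dF x xab.
by rewrite in_itv/= => cab ->; rewrite mulr_ge0 ?f0// subr_ge0.
Qed.

Lemma derive_unique F G f a b : a <= b ->
  (forall x, a <= x <= b -> is_derive x 1 F (f x)) ->
  (forall x, a <= x <= b -> is_derive x 1 G (f x)) -> F b - F a = G b - G a.
Proof.
move=> ab dF dG.
have h1 : F a - G a <= F b - G b.
  apply: (@derive_mono (F - G) (f - f)) => // x xab; last by rewrite !fctE subrr.
  by have := dF x xab; have := dG x xab => ? ?; exact: is_deriveB.
have h2 : G a - F a <= G b - F b.
  apply: (@derive_mono (G - F) (f - f)) => // x xab; last by rewrite !fctE subrr.
  by have := dF x xab; have := dG x xab => ? ?; exact: is_deriveB.
lra.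
Qed.

(* The base point -2 lies to the left of all the intervals of integration used
   below. *)
Definition prim h (x : R) : R := (\int[mu]_(t in `[(-2 : R), x]) h t)%R.

Lemma is_derive_prim h (x : R) : continuous h -> -2 < x -> is_derive x 1 (prim h) (h x).
Proof.
move=> ch x2.
have ux : x < x + 1 by rewrite ltrDl.
have [|d1 d2] := @continuous_FTC1_closed R h (-2) x (x + 1) ux _ x2 (ch x).
  apply: continuous_compact_integrable; first exact: segment_compact.
  by apply: continuous_subspaceT => y; exact: ch.
by apply: DeriveDef; [exact: d1|rewrite -derive1E; exact: d2].
Qed.

(** As a difference of primitives, it is additive in the interval and changes sign with its
    orientation, with no order assumed between the endpoints. *)
Definition rint h a b : R := prim h b - prim h a.

Lemma rint_derive h F a b : continuous h -> -2 < a -> a <= b ->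
  (forall x, a <= x <= b -> is_derive x 1 F (h x)) -> rint h a b = F b - F a.
Proof.
move=> ch a2 ab dF; apply: derive_unique ab _ dF => x /andP[ax _].
by apply: is_derive_prim => //; exact: lt_le_trans ax.
Qed.

Lemma rint_le h F k a b : continuous h -> -2 < a -> a <= b ->
  (forall x, a <= x <= b -> is_derive x 1 F (k x)) ->
  (forall x, a <= x <= b -> h x <= k x) -> rint h a b <= F b - F a.
Proof.
move=> ch a2 ab dF hk.
have : F a - prim h a <= F b - prim h b.
  apply: (@derive_mono (F - prim h) (k - h)) => // x xab.
    apply: is_deriveB; first exact: dF.
    by apply: is_derive_prim => //; case/andP: xab => ax _; exact: lt_le_trans ax.
  by rewrite !fctE subr_ge0 hk.
rewrite /rint; lra.
Qed.

Lemma rint_lin h k (al be : R) a b : continuous h -> continuous k -> -2 < a -> a <= b ->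
  rint (fun t => al * h t + be * k t) a b = al * rint h a b + be * rint k a b.
Proof.
move=> ch ck a2 ab.
have cl : continuous (fun t => al * h t + be * k t).
  move=> t; apply: cvgD; apply: cvgM; [exact: cvg_cst|exact: ch|exact: cvg_cst|exact: ck].
have dF x : a <= x <= b ->
    is_derive x 1 (al *: prim h + be *: prim k) (al * h x + be * k x).
  move=> /andP[ax _]; have x2 := lt_le_trans a2 ax.
  have dh := is_derive_prim ch x2; have dk := is_derive_prim ck x2.
  exact: (is_deriveD (is_deriveZ al dh) (is_deriveZ be dk)).
rewrite (rint_derive cl a2 ab dF) /rint.
have E t : (al *: prim h + be *: prim k) t = al * prim h t + be * prim k t by [].
by rewrite !E; ring.
Qed.

End RealIntegral.

(** * Complex differentiability with real error bounds *)

Section ComplexDerivative.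
Variable R : realType.
Implicit Types (f g : R[i] -> R[i]) (z h p q L : R[i]) (e d : R).

(** The form without quotient allows h = 0 and passes directly to sums, products and limits. *)
Definition cdiff f z L := forall e, 0 < e -> exists2 d, 0 < d &
  forall h, normc h < d -> normc (f (z + h) - f z - L * h) <= e * normc h.

Definition holo f := forall z, exists L, cdiff f z L.

Lemma cdiff_continuous f z L e : cdiff f z L -> 0 < e -> exists2 d, 0 < d &
  forall h, normc h < d -> normc (f (z + h) - f z) <= e.
Proof.
move=> df e0; have [d d0 hd] := df 1 ltr01.
have L0 := normc_ge0 L.
have L1 : 0 < 1 + normc L by rewrite ltr_pwDl.
exists (Num.min d (e / (1 + normc L))); first by rewrite lt_min d0 divr_gt0.
move=> h; rewrite lt_min => /andP[/hd h1 h2].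
rewrite -(subrK (L * h) (f (z + h) - f z)); apply: le_trans (le_normcD _ _) _.
rewrite normcM; apply: le_trans (lerD h1 (lexx _)) _.
by rewrite -mulrDl mulrC -ler_pdivlMr// ltW.
Qed.

Lemma cdiff_cst (c : R[i]) z : cdiff (fun=> c) z 0.
Proof.
move=> e e0; exists 1 => // h _; rewrite subrr mul0r subr0 normc0.
by rewrite mulr_ge0 ?normc_ge0// ltW.
Qed.

Lemma cdiff_affine p q z : cdiff (fun z => p + q * z) z q.
Proof.
move=> e e0; exists 1 => // h _.
rewrite (_ : p + q * (z + h) - (p + q * z) - q * h = 0) ?normc0; last by ring.
by rewrite mulr_ge0 ?normc_ge0// ltW.
Qed.

Lemma cdiffD f g z L M : cdiff f z L -> cdiff g z M ->
  cdiff (fun z => f z + g z) z (L + M).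
Proof.
move=> df dg e e0; have e20 : 0 < e / 2 by rewrite divr_gt0.
have [d1 d10 h1] := df _ e20; have [d2 d20 h2] := dg _ e20.
exists (Num.min d1 d2); first by rewrite lt_min d10.
move=> h; rewrite lt_min => /andP[/h1{}h1 /h2{}h2].
rewrite (_ : _ - _ - _ = (f (z + h) - f z - L * h) + (g (z + h) - g z - M * h)); last by ring.
by apply: le_trans (le_normcD _ _) _; rewrite [e](splitr e) mulrDl lerD.
Qed.

Lemma cdiffM f g z L M : cdiff f z L -> cdiff g z M ->
  cdiff (fun z => f z * g z) z (L * g z + f z * M).
Proof.
move=> df dg e e0.
have F0 := normc_ge0 (f z); have G0 := normc_ge0 (g z); have L0 := normc_ge0 L.
pose e1 := e / (normc (g z) + 1 + normc L + normc (f z)).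
have S0 : 0 < normc (g z) + 1 + normc L + normc (f z) by lra.
have e10 : 0 < e1 by rewrite divr_gt0.
have [d1 d10 h1] := df _ e10; have [d2 d20 h2] := dg _ e10.
have [d3 d30 h3] := cdiff_continuous dg e10.
have [d4 d40 h4] := cdiff_continuous dg ltr01.
exists (Num.min (Num.min d1 d2) (Num.min d3 d4)); first by rewrite !lt_min d10 d20 d30.
move=> h; rewrite !lt_min => /andP[/andP[/h1{}h1 /h2{}h2] /andP[/h3{}h3 /h4{}h4]].
have H0 := normc_ge0 h.
have gb : normc (g (z + h)) <= normc (g z) + 1.
  by rewrite -(subrK (g z) (g (z + h))) addrC; apply: le_trans (le_normcD _ _) _; rewrite lerD2l.
rewrite (_ : _ - _ - _ = (f (z + h) - f z - L * h) * g (z + h)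
  + (L * h) * (g (z + h) - g z) + f z * (g (z + h) - g z - M * h)); last by ring.
apply: le_trans (le_normcD _ _) _; rewrite (_ : e * normc h =
    (e1 * normc h) * (normc (g z) + 1) + (normc L * normc h) * e1
     + normc (f z) * (e1 * normc h)); last first.
  by rewrite /e1; field; rewrite gt_eqF.
rewrite lerD//; last by rewrite normcM ler_wpM2l.
apply: le_trans (le_normcD _ _) _; rewrite !normcM lerD//.
  by rewrite ler_pM ?normc_ge0.
by rewrite ler_wpM2l// mulr_ge0.
Qed.

Lemma cdiff_comp_affine f p q z L : cdiff f (p + q * z) L ->
  cdiff (fun z => f (p + q * z)) z (L * q).
Proof.
move=> df e e0; have Q0 := normc_ge0 q.
have q1 : 0 < normc q + 1 by lra.
have e10 : 0 < e / (normc q + 1) by rewrite divr_gt0.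
have [d d0 hd] := df _ e10.
exists (d / (normc q + 1)); first by rewrite divr_gt0.
move=> h; rewrite ltr_pdivlMr// => hh; have H0 := normc_ge0 h.
have /hd : normc (q * h) < d by rewrite normcM; nra.
rewrite (_ : p + q * (z + h) = p + q * z + q * h); last by ring.
rewrite mulrA => /le_trans; apply; rewrite normcM mulrA ler_wpM2r// mulrAC.
by rewrite ler_pdivrMr// ler_wpM2l ?(ltW e0)// lerDl.
Qed.

Lemma holo_cst (c : R[i]) : holo (fun=> c).
Proof. by move=> z; exists 0; exact: cdiff_cst. Qed.

Lemma holo_affine p q : holo (fun z => p + q * z).
Proof. by move=> z; exists q; exact: cdiff_affine. Qed.

Lemma holoD f g : holo f -> holo g -> holo (fun z => f z + g z).
Proof.
by move=> hf hg z; have [L ?] := hf z; have [M ?] := hg z; exists (L + M); exact: cdiffD.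
Qed.

Lemma holoM f g : holo f -> holo g -> holo (fun z => f z * g z).
Proof.
move=> hf hg z; have [L ?] := hf z; have [M ?] := hg z.
by exists (L * g z + f z * M); exact: cdiffM.
Qed.

Lemma holo_comp_affine f p q : holo f -> holo (fun z => f (p + q * z)).
Proof.
by move=> hf z; have [L ?] := hf (p + q * z); exists (L * q); exact: cdiff_comp_affine.
Qed.

Lemma holo_horner (P : {poly R[i]}) : holo (horner P).
Proof.
elim/poly_ind: P => [|P c IH].
  by rewrite (_ : horner 0 = fun=> 0); [exact: holo_cst|apply: funext => z; rewrite horner0].
rewrite (_ : horner _ = fun z => P.[z] * (0 + 1 * z) + c).
  by apply: holoD (holo_cst c); apply: holoM IH (holo_affine 0 1).
by apply: funext => z; rewrite hornerMXaddC add0r mul1r.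
Qed.

End ComplexDerivative.

(** * Integrals along complex segments *)

Section ComplexIntegral.
Variable R : realType.
Local Notation Re := (@complex.Re R).
Local Notation Im := (@complex.Im R).
Implicit Types (f g : R[i] -> R[i]) (z h p q L : R[i]) (e d a b c l w : R).

Lemma normc_ge_absRe z : `|Re z| <= normc z.
Proof.
by case: z => x y /=; rewrite -sqrtr_sqr ler_sqrt ?addr_ge0 ?sqr_ge0// lerDl sqr_ge0.
Qed.

Lemma normc_ge_absIm z : `|Im z| <= normc z.
Proof.
by case: z => x y /=; rewrite -sqrtr_sqr ler_sqrt ?addr_ge0 ?sqr_ge0// lerDr sqr_ge0.
Qed.

Lemma ReB z h : Re (z - h) = Re z - Re h. Proof. by case: z h => [? ?] [? ?]. Qed.
Lemma ImB z h : Im (z - h) = Im z - Im h. Proof. by case: z h => [? ?] [? ?]. Qed.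
Lemma ReD z h : Re (z + h) = Re z + Re h. Proof. by case: z h => [? ?] [? ?]. Qed.
Lemma ImD z h : Im (z + h) = Im z + Im h. Proof. by case: z h => [? ?] [? ?]. Qed.
Lemma ReM z h : Re (z * h) = Re z * Re h - Im z * Im h.
Proof. by case: z h => [? ?] [? ?]. Qed.
Lemma ImM z h : Im (z * h) = Re z * Im h + Im z * Re h.
Proof. by case: z h => [? ?] [? ?]. Qed.

Lemma holo_line f p q (t : R) e : holo f -> 0 < e -> exists2 d, 0 < d &
  forall s : R, `|t - s| < d -> normc (f (p + t%:C * q) - f (p + s%:C * q)) <= e.
Proof.
move=> hf e0; have [L df] := hf (p + t%:C * q).
have [d d0 hd] := cdiff_continuous df e0.
have Q0 := normc_ge0 q; have q1 : 0 < normc q + 1 by lra.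
exists (d / (normc q + 1)); first by rewrite divr_gt0.
move=> s; rewrite ltr_pdivlMr// => ts.
rewrite -normcN opprB.
have -> : p + s%:C * q = p + t%:C * q + (s - t)%:C * q by rewrite rmorphB/=; ring.
apply: hd; rewrite normcM normcR distrC.
have := normr_ge0 (t - s); nra.
Qed.

Lemma continuous_Re_line f p q : holo f -> continuous (fun t : R => Re (f (p + t%:C * q))).
Proof.
move=> hf t; apply/cvgrPdist_le => e e0.
have [d d0 hd] := holo_line p q t hf e0.
apply/nbhs_ballP; exists d => //= s; rewrite /ball/= => /hd hts.
by rewrite -ReB (le_trans (normc_ge_absRe _)).
Qed.

Lemma continuous_Im_line f p q : holo f -> continuous (fun t : R => Im (f (p + t%:C * q))).
Proof.
move=> hf t; apply/cvgrPdist_le => e e0.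
have [d d0 hd] := holo_line p q t hf e0.
apply/nbhs_ballP; exists d => //= s; rewrite /ball/= => /hd hts.
by rewrite -ImB (le_trans (normc_ge_absIm _)).
Qed.

(** The velocity q is left out: the contour integral is q times this value, whence the factor ['i]
    in [boundary_integral]. *)
Definition cint f p q a b : R[i] :=
  rint (fun t => Re (f (p + t%:C * q))) a b +i* rint (fun t => Im (f (p + t%:C * q))) a b.

Lemma cint_chasles f p q a b c : cint f p q a b + cint f p q b c = cint f p q a c.
Proof. by rewrite /cint /rint; congr (_ +i* _); rewrite addrC addrA subrK. Qed.

Lemma cintN f p q a b : cint f p q b a = - cint f p q a b.
Proof. by rewrite /cint /rint; congr (_ +i* _); rewrite opprB. Qed.

Lemma cintD f g p q a b : holo f -> holo g -> -2 < a -> a <= b ->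
  cint (fun z => f z + g z) p q a b = cint f p q a b + cint g p q a b.
Proof.
move=> hf hg a2 ab; rewrite /cint; congr (_ +i* _).
- rewrite -[X in X + _]mul1r -[X in _ + X]mul1r.
  rewrite -(rint_lin 1 1 (continuous_Re_line (p := p) (q := q) hf) (continuous_Re_line (p := p) (q := q) hg) a2 ab).
  by congr rint; apply: funext => t; rewrite ReD !mul1r.
- rewrite -[X in X + _]mul1r -[X in _ + X]mul1r.
  rewrite -(rint_lin 1 1 (continuous_Im_line (p := p) (q := q) hf) (continuous_Im_line (p := p) (q := q) hg) a2 ab).
  by congr rint; apply: funext => t; rewrite ImD !mul1r.
Qed.

Lemma cintZ (k : R[i]) f p q a b : holo f -> -2 < a -> a <= b ->
  cint (fun z => k * f z) p q a b = k * cint f p q a b.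
Proof.
move=> hf a2 ab; have cR := continuous_Re_line (p := p) (q := q) hf; have cI := continuous_Im_line (p := p) (q := q) hf.
rewrite {2}/cint; case: k => x y; rewrite [RHS]/GRing.mul/= -mulNr.
rewrite -(rint_lin x (- y) cR cI a2 ab) -(rint_lin x y cI cR a2 ab) /cint.
by congr (rint _ _ _ +i* rint _ _ _); apply: funext => t; rewrite ?ReM ?ImM/= ?mulNr.
Qed.

Lemma cint_cst (k : R[i]) p q a b : -2 < a -> a <= b ->
  cint (fun=> k) p q a b = k * (b - a)%:C.
Proof.
move=> a2 ab; have ccst (x : R) : continuous (fun _ : R => x) by move=> t; exact: cvg_cst.
have E (x : R) : rint (fun=> x) a b = x * (b - a).
  have dF t : a <= t <= b -> is_derive t 1 (x *: id : R -> R) x.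
    by move=> _; have := is_deriveZ x (is_derive_id t (1 : R)); rewrite [x *: 1]mulr1.
  by rewrite (rint_derive (ccst x) a2 ab dF) mulrBr.
by case: k => x y; rewrite /cint !E; simpc.
Qed.

Lemma cint_id p q a b : -2 < a -> a <= b ->
  cint id p q a b = p * (b - a)%:C + q * ((b ^+ 2 - a ^+ 2) / 2)%:C.
Proof.
move=> a2 ab.
have E (x y : R) : rint (fun t => x + t * y) a b = x * (b - a) + y * ((b ^+ 2 - a ^+ 2) / 2).
  have ch : continuous (fun t : R => x + t * y).
    move=> t; apply: cvgD; first exact: cvg_cst.
    by apply: cvgM; [exact: cvg_id|exact: cvg_cst].
  have dF t : a <= t <= b ->
      is_derive t 1 (x *: id + (y / 2) *: (id * id) : R -> R) (x + t * y).
    move=> _; have d1 := is_deriveZ x (is_derive_id t (1 : R)).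
    have d2 := is_deriveZ (y / 2) (is_deriveM (is_derive_id t (1 : R)) (is_derive_id t (1 : R))).
    have d3 := is_deriveD d1 d2.
    apply: (is_derive_eq d3).
    by rewrite -[LHS]/(x * 1 + y / 2 * (t * 1 + t * 1)); lra.
  rewrite (rint_derive ch a2 ab dF).
  rewrite -[LHS]/(x * b + y / 2 * (b * b) - (x * a + y / 2 * (a * a))); lra.
have ER : (fun t : R => Re (id (p + t%:C * q))) = fun t => Re p + t * Re q.
  by apply: funext => t; rewrite ReD ReM /= mul0r subr0.
have EI : (fun t : R => Im (id (p + t%:C * q))) = fun t => Im p + t * Im q.
  by apply: funext => t; rewrite ImD ImM /= mul0r addr0.
rewrite /cint ER EI !E; case: p q {ER EI} => [px py] [qx qy].
by apply/eqP; rewrite eq_complex /=; apply/andP; split; apply/eqP; ring.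
Qed.

(** The factor 2 comes from bounding the real and imaginary parts separately; the constants below
    have room for it. *)
Lemma cint_le f p q a b (F k : R -> R) : holo f -> -2 < a -> a <= b ->
  (forall t, a <= t <= b -> is_derive t 1 F (k t)) ->
  (forall t, a <= t <= b -> normc (f (p + t%:C * q)) <= k t) ->
  normc (cint f p q a b) <= 2 * (F b - F a).
Proof.
move=> hf a2 ab dF fk.
have cR := continuous_Re_line (p := p) (q := q) hf; have cI := continuous_Im_line (p := p) (q := q) hf.
have key (h : R -> R) : continuous h -> (forall t, a <= t <= b -> `|h t| <= k t) ->
    `|rint h a b| <= F b - F a.
  move=> ch hk; rewrite ler_norml; apply/andP; split; last first.
    by apply: rint_le dF _ => // t tab; rewrite (le_trans (ler_norm _))// hk.
  rewrite lerNl -mulN1r -[X in X <= _]addr0 -[X in _ + X](mul0r (rint h a b)).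
  rewrite -(rint_lin (-1) 0 ch ch a2 ab).
  apply: rint_le dF _ => // [t|t tab].
    apply: cvgD; apply: cvgM; [exact: cvg_cst|exact: ch|exact: cvg_cst|exact: ch].
  by rewrite mul0r addr0 mulN1r (le_trans _ (hk t tab))// -normrN ler_norm.
apply: le_trans (normc_le_ReIm _) _; rewrite mulr2n mulrDl mul1r lerD//; apply: key => // t tab.
- by rewrite (le_trans (normc_ge_absRe _))// fk.
- by rewrite (le_trans (normc_ge_absIm _))// fk.
Qed.

Lemma cint_bound f p q a b (M : R) : holo f -> -2 < a -> a <= b ->
  (forall t, a <= t <= b -> normc (f (p + t%:C * q)) <= M) ->
  normc (cint f p q a b) <= 2 * (M * (b - a)).
Proof.
move=> hf a2 ab fM; rewrite mulrBr.
apply: (@cint_le f p q a b (M *: id) (fun=> M)) => // t _.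
by have := is_deriveZ M (is_derive_id t (1 : R)); rewrite [M *: 1]mulr1.
Qed.

End ComplexIntegral.

(** * Goursat's theorem *)

Section Goursat.
Variable R : realType.
Local Notation Re := (@complex.Re R).
Local Notation Im := (@complex.Im R).
Implicit Types (f g : R[i] -> R[i]) (z p q L : R[i]) (e d a b c l w x y : R).

Definition boundary_integral f a b c d : R[i] :=
  cint f (0 +i* c) 1 a b - cint f (0 +i* d) 1 a b
    + 'i * (cint f (b +i* 0) 'i c d - cint f (a +i* 0) 'i c d).

Lemma horizontalE c (t : R) : (0 +i* c) + t%:C * 1 = t +i* c :> R[i].
Proof. by rewrite mulr1; simpc. Qed.

Lemma verticalE a (t : R) : (a +i* 0) + t%:C * 'i = a +i* t :> R[i].
Proof. by simpc. Qed.

Lemma boundary_integral_split f a m b c n d : boundary_integral f a b c d =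
  boundary_integral f a m c n + boundary_integral f m b c n
  + boundary_integral f a m n d + boundary_integral f m b n d.
Proof.
rewrite /boundary_integral.
rewrite -(cint_chasles f (0 +i* c) 1 a m b) -(cint_chasles f (0 +i* d) 1 a m b).
rewrite -(cint_chasles f (b +i* 0) 'i c n d) -(cint_chasles f (a +i* 0) 'i c n d).
ring.
Qed.

Lemma boundary_integralD f g a b c d : holo f -> holo g ->
  -2 < a -> a <= b -> -2 < c -> c <= d ->
  boundary_integral (fun z => f z + g z) a b c d
    = boundary_integral f a b c d + boundary_integral g a b c d.
Proof.
by move=> hf hg a2 ab c2 cd; rewrite /boundary_integral !cintD//; ring.
Qed.

Lemma boundary_integral_affine (k : R[i]) L a b c d :
  -2 < a -> a <= b -> -2 < c -> c <= d ->
  boundary_integral (fun z => k + L * z) a b c d = 0.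
Proof.
move=> a2 ab c2 cd.
have hk : holo (fun=> k) := holo_cst k.
have hi : holo (@id R[i]).
  by have := holo_affine 0 (1 : R[i]); congr holo; apply: funext => z; rewrite add0r mul1r.
have hL : holo (fun z => L * id z) := holoM (holo_cst L) hi.
have E p q x y : -2 < x -> x <= y -> cint (fun z => k + L * z) p q x y
    = k * (y - x)%:C + L * (p * (y - x)%:C + q * ((y ^+ 2 - x ^+ 2) / 2)%:C).
  by move=> x2 xy; rewrite (cintD _ _ hk hL)// cint_cst// (cintZ _ _ _ hi)// cint_id.
rewrite /boundary_integral !E//; case: k L {hk hL E} => [k1 k2] [L1 L2].
by apply/eqP; rewrite eq_complex /=; apply/andP; split; apply/eqP; lra.
Qed.

Lemma boundary_integral_bound f a w c l (M : R) : holo f ->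
  -2 < a -> 0 <= w -> -2 < c -> 0 <= l ->
  (forall x y, a <= x <= a + w -> c <= y <= c + l -> normc (f (x +i* y)) <= M) ->
  normc (boundary_integral f a (a + w) c (c + l)) <= 4 * (M * (w + l)).
Proof.
move=> hf a2 w0 c2 l0 fM; have aw : a <= a + w by rewrite lerDl.
have cl : c <= c + l by rewrite lerDl.
have hor y : c <= y <= c + l -> normc (cint f (0 +i* y) 1 a (a + w)) <= 2 * (M * w).
  move=> ycl; have := @cint_bound _ f (0 +i* y) 1 a (a + w) M hf a2 aw.
  rewrite [a + w - a]addrAC subrr add0r; apply => t taw; rewrite horizontalE; exact: fM.
have ver x : a <= x <= a + w -> normc (cint f (x +i* 0) 'i c (c + l)) <= 2 * (M * l).
  move=> xaw; have := @cint_bound _ f (x +i* 0) 'i c (c + l) M hf c2 cl.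
  rewrite [c + l - c]addrAC subrr add0r; apply => t tcl; rewrite verticalE; exact: fM.
have B (u v : R[i]) (X : R) : normc u <= X -> normc v <= X -> normc (u - v) <= X + X.
  by move=> uX vX; apply: le_trans (le_normcD _ _) _; rewrite normcN lerD.
have ni : normc ('i : R[i]) = 1 by rewrite /normc expr0n/= add0r expr1n sqrtr1.
apply: le_trans (le_normcD _ _) _; rewrite normcM ni mul1r.
apply: le_trans (lerD (B _ _ _ (hor c _) (hor (c + l) _)) (B _ _ _ (ver (a + w) _) (ver a _))) _;
  rewrite ?lexx ?aw ?cl//.
lra.
Qed.

Lemma normc_sub_le z x y : normc ((x +i* y) - z) <= `|x - Re z| + `|y - Im z|.
Proof. by apply: le_trans (normc_le_ReIm _) _; rewrite ReB ImB. Qed.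

(** The bound e (w + l)^2 is reproduced by quartering, as 4 ((w + l)/2)^2 = (w + l)^2. On a small
    rectangle the affine part of f integrates to 0 and the rest is at most (e/4)(w + l), on a
    boundary whose contribution costs 4(w + l). *)
Theorem goursat f a w c l : holo f -> -2 < a -> 0 <= w -> -2 < c -> 0 <= l ->
  boundary_integral f a (a + w) c (c + l) = 0.
Proof.
move=> hf a2' w0' c2' l0'; apply: eq0_normc.
suff H e : 0 < e -> normc (boundary_integral f a (a + w) c (c + l)) <= e * (w + l) ^+ 2.
  apply/eqP; rewrite eq_le normc_ge0 andbT; apply/ler_addgt0Pr => e e0; rewrite add0r.
  have s0 : 0 < (w + l) ^+ 2 + 1 by rewrite ltr_wpDl ?sqr_ge0.
  have /H/le_trans : 0 < e / ((w + l) ^+ 2 + 1) by rewrite divr_gt0.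
  apply; rewrite mulrAC ler_pdivrMr// ler_wpM2l ?(ltW e0)//.
  by rewrite lerDl.
move=> e0; move: a2' c2'.
apply: (@rectangle_ind R (fun a c w l => -2 < a -> -2 < c ->
  normc (boundary_integral f a (a + w) c (c + l)) <= e * (w + l) ^+ 2)) w0' l0'.
- move=> {}a {}c {}w {}l w0 l0 q1 q2 q3 q4 a2 c2.
  have aw2 : -2 < a + w / 2 by rewrite (lt_le_trans a2)// lerDl divr_ge0.
  have cl2 : -2 < c + l / 2 by rewrite (lt_le_trans c2)// lerDl divr_ge0.
  move: (q4 aw2 cl2) (q3 a2 cl2) (q2 aw2 c2) (q1 a2 c2).
  rewrite -!(addrA a) -!(addrA c) -!splitr => h4 h3 h2 h1.
  rewrite (boundary_integral_split f a (a + w / 2) (a + w) c (c + l / 2) (c + l)).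
  apply: le_trans (le_normcD _ _) _.
  apply: le_trans (lerD (le_trans (le_normcD _ _) (lerD (le_trans (le_normcD _ _)
    (lerD h1 h2)) h3)) h4) _.
  by rewrite le_eqVlt; apply/orP; left; apply/eqP; field.
move=> x y; have [L df] := hf (x +i* y).
have e40 : 0 < e / 4 by rewrite divr_gt0.
have [d d0 hd] := df _ e40.
exists (d / 2) => [|{}a {}c {}w {}l xa yc wd ld a2 c2]; first by rewrite divr_gt0.
have /andP[xa1 xa2] := xa; have /andP[yc1 yc2] := yc.
have w0 : 0 <= w by lra.
have l0 : 0 <= l by lra.
pose z0 : R[i] := x +i* y; pose k := f z0 - L * z0.
pose g z := f z + ((- k) + (- L) * z).
have hg : holo g by apply: holoD hf (holo_affine _ _).
have -> : f = fun z => g z + (k + L * z) by apply: funext => z; rewrite /g; ring.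
have aw : a <= a + w by rewrite lerDl.
have cl : c <= c + l by rewrite lerDl.
rewrite (boundary_integralD hg (holo_affine k L))// boundary_integral_affine// addr0.
apply: le_trans (@boundary_integral_bound g a w c l (e / 4 * (w + l)) hg a2 w0 c2 l0 _) _; last by lra.
move=> x' y' x'a y'c.
have /andP[h1 h2] := x'a; have /andP[h3 h4] := y'c.
have dz : normc ((x' +i* y') - z0) <= w + l.
  apply: le_trans (normc_sub_le _ _ _) _; rewrite /z0/= lerD// ler_norml; apply/andP; split; lra.
have := hd ((x' +i* y') - z0); rewrite -/z0 [z0 + _]addrC subrK => /(_ _)/le_trans hh.
rewrite (_ : g _ = f (x' +i* y') - f z0 - L * (x' +i* y' - z0)); last by rewrite /g /k; ring.
apply: hh; first by apply: le_lt_trans dz _; lra.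
by rewrite ler_wpM2l// ltW.
Qed.

Definition in_rectangle a c w l z := (a <= Re z <= a + w) && (c <= Im z <= c + l).

Lemma in_rectangle_near a c w l x y z d : a <= x <= a + w -> c <= y <= c + l ->
  in_rectangle a c w l z -> w < d / 2 -> l < d / 2 -> normc (z - (x +i* y)) < d.
Proof.
move=> /andP[? ?] /andP[? ?] /andP[/andP[? ?] /andP[? ?]] wd ld.
apply: le_lt_trans (normc_le_ReIm _) _; rewrite ReB ImB /=.
rewrite (splitr d) ltrD// ltr_norml; apply/andP; split; lra.
Qed.

Lemma in_rectangle_split a c w l z : in_rectangle a c w l z ->
  [\/ in_rectangle a c (w / 2) (l / 2) z, in_rectangle (a + w / 2) c (w / 2) (l / 2) z,
      in_rectangle a (c + l / 2) (w / 2) (l / 2) z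
    | in_rectangle (a + w / 2) (c + l / 2) (w / 2) (l / 2) z].
Proof.
move=> /andP[/andP[h1 h2] /andP[h3 h4]]; rewrite /in_rectangle.
rewrite -!(addrA a) -!(addrA c) -!splitr h1 h2 h3 h4 /=.
by case: (leP (Re z) (a + w / 2)) => hx; case: (leP (Im z) (c + l / 2)) => hy;
  rewrite ?(ltW hx) ?(ltW hy) /=; [constructor 1|constructor 3|constructor 2|constructor 4].
Qed.

Lemma holo_bounded f a c w l : holo f -> 0 <= w -> 0 <= l ->
  exists2 M, 0 < M & forall z, in_rectangle a c w l z -> normc (f z) <= M.
Proof.
move=> hf; apply: (@rectangle_ind R (fun a c w l =>
  exists2 M, 0 < M & forall z, in_rectangle a c w l z -> normc (f z) <= M)).
  move=> {}a {}c {}w {}l w0 l0 [M1 M10 h1] [M2 M20 h2] [M3 M30 h3] [M4 M40 h4].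
  exists (M1 + M2 + M3 + M4); first by lra.
  by move=> z /in_rectangle_split[/h1|/h2|/h3|/h4]; lra.
move=> x y; have [L df] := hf (x +i* y).
have [d d0 hd] := cdiff_continuous df ltr01.
exists (d / 2) => [|{}a {}c {}w {}l xa yc wd ld]; first by rewrite divr_gt0.
exists (normc (f (x +i* y)) + 1) => [|z zr]; first by rewrite ltr_wpDl ?normc_ge0.
have := hd _ (in_rectangle_near xa yc zr wd ld); rewrite [(x +i* y) + _]addrC subrK => hz.
by rewrite -(subrK (f (x +i* y)) (f z)) addrC (le_trans (le_normcD _ _))// lerD2l.
Qed.

Lemma holo_unif_continuous f a c w l e : holo f -> 0 <= w -> 0 <= l -> 0 < e ->
  exists2 d, 0 < d & forall z z', in_rectangle a c w l z -> normc (z' - z) < d ->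
    normc (f z' - f z) <= e.
Proof.
move=> hf w0' l0' e0; move: w0' l0'; apply: (@rectangle_ind R (fun a c w l =>
  exists2 d, 0 < d & forall z z', in_rectangle a c w l z -> normc (z' - z) < d ->
    normc (f z' - f z) <= e)).
  move=> {}a {}c {}w {}l w0 l0 [M1 M10 h1] [M2 M20 h2] [M3 M30 h3] [M4 M40 h4].
  exists (Num.min (Num.min M1 M2) (Num.min M3 M4)); first by rewrite !lt_min M10 M20 M30.
  move=> z z' zr; rewrite !lt_min => /andP[/andP[? ?] /andP[? ?]].
  by case: (in_rectangle_split zr) => [/h1|/h2|/h3|/h4]; apply.
move=> x y; have [L df] := hf (x +i* y).
have e20 : 0 < e / 2 by rewrite divr_gt0.
have [d d0 hd] := cdiff_continuous df e20.
exists (d / 2 / 2) => [|{}a {}c {}w {}l xa yc wd ld]; first by rewrite !divr_gt0.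
exists (d / 2) => [|z z' zr zz']; first by rewrite divr_gt0.
have hz := in_rectangle_near xa yc zr wd ld.
have h1 : normc (z - (x +i* y)) < d by lra.
have h2 : normc (z' - (x +i* y)) < d.
  rewrite -(subrKA z); apply: le_lt_trans (le_normcD _ _) _; lra.
have := hd _ h1; have := hd _ h2; rewrite ![(x +i* y) + _]addrC !subrK => k2 k1.
rewrite -(subrKA (f (x +i* y))); apply: le_trans (le_normcD _ _) _.
by rewrite (splitr e) lerD// -normcN opprB.
Qed.

End Goursat.

(** * Landau's kernel *)

Section LandauKernel.
Variable R : realType.
Implicit Types (s t u v x y : R) (n : nat).

(** Over any ring, since it serves as a real function of t - x and as a complex function of z -
    w. *)
Definition kernel_poly (F : comNzRingType) n : {poly F} := (1 - 'X^2) ^+ n.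

Lemma horner_kernel (F : comNzRingType) n (z : F) : (kernel_poly F n).[z] = (1 - z ^+ 2) ^+ n.
Proof. by rewrite /kernel_poly horner_exp !hornerE. Qed.

Local Notation K n s := (kernel_poly R n).[s].

Lemma kernel_ge0 n s : -1 <= s <= 1 -> 0 <= K n s.
Proof. by move=> /andP[? ?]; rewrite horner_kernel exprn_ge0//; nra. Qed.

Definition kernel_prim n : R -> R := prim (horner (kernel_poly R n)).
Local Notation Phi := kernel_prim.

Lemma is_derive_kernel_prim n s : -2 < s -> is_derive s 1 (Phi n) (K n s).
Proof. by apply: is_derive_prim; exact: continuous_horner. Qed.

Lemma is_derive_poly_eq (p q : {poly R}) s : p^`() = q -> is_derive s 1 (horner p) q.[s].
Proof. by move=> <-; exact: is_derive_poly. Qed.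

Definition kernel_mass n := Phi n 2^-1 - Phi n (- 2^-1).

(** On [0, 1/2] the kernel exceeds (1 - s)^n, whose integral is (1 - 2^-(n+1))/(n + 1). A lower
    bound of order 1/n suffices against tails that decay exponentially. *)
Lemma kernel_mass_ge n : (2 * n.+1%:R)^-1 <= kernel_mass n.
Proof.
have n1 : n.+1%:R != 0 :> R by rewrite pnatr_eq0.
have n1' : 0 < n.+1%:R :> R by rewrite ltr0n.
pose G : {poly R} := (- n.+1%:R^-1) *: (1 - 'X) ^+ n.+1.
have GE s : G.[s] = - (n.+1%:R^-1 * (1 - s) ^+ n.+1).
  by rewrite /G hornerZ horner_exp !hornerE mulNr.
have dG : G^`() = (1 - 'X) ^+ n.
  rewrite /G derivZ deriv_exp derivB derivC derivX sub0r /=.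
  by rewrite mulNr mul1r mulNrn scalerN scaleNr opprK -[X in _ *: X]scaler_nat scalerA mulVf ?scale1r.
have h1 : Phi n 0 - G.[0] <= Phi n 2^-1 - G.[2^-1].
  apply: (@derive_mono R (Phi n - horner G) (fun s => K n s - ((1 - 'X) ^+ n).[s])); first lra.
    move=> s /andP[s0 s1]; apply: is_deriveB; last exact: is_derive_poly_eq.
    by apply: is_derive_kernel_prim; lra.
  move=> s /andP[s0 s1]; rewrite subr_ge0 horner_kernel horner_exp !hornerE.
  by rewrite lerXn2r ?nnegrE; nra.
have h2 : Phi n (- 2^-1) <= Phi n 0.
  apply: (@derive_mono R (Phi n) (fun s => K n s)); first lra.
    by move=> s /andP[s0 s1]; apply: is_derive_kernel_prim; lra.
  by move=> s /andP[s0 s1]; apply: kernel_ge0; lra.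
have hp : (1 - 2^-1 : R) ^+ n.+1 <= 2^-1.
  rewrite (_ : 1 - 2^-1 = 2^-1); last lra.
  by rewrite exprS ler_piMr// exprn_ile1//; lra.
move: h1; rewrite !GE subr0 expr1n /kernel_mass invfM => h1.
have : n.+1%:R^-1 * (1 - 2^-1) ^+ n.+1 <= n.+1%:R^-1 * 2^-1 :> R.
  by rewrite ler_wpM2l// invr_ge0 ltW.
have : 0 <= n.+1%:R^-1 :> R by rewrite invr_ge0 ltW.
move: h1 h2; set X := (1 - 2^-1) ^+ n.+1; set N := n.+1%:R^-1; move: X N => X N.
lra.
Qed.

(** The interval [3/8, 5/8] is 1/2 within 1/8, the range of the displaced endpoints when |x| <= 1/8.
    There 1 - s^2 <= 55/64 < 9/10. *)
Lemma kernel_tail n u v : u <= v -> v <= u + 1 ->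
  (forall s, u <= s <= v -> 3 / 8 <= `|s| <= 5 / 8) ->
  0 <= Phi n v - Phi n u <= (9 / 10) ^+ n.
Proof.
move=> uv vu1 uvs.
have bnd s : u <= s <= v -> 0 <= 1 - s ^+ 2 <= 9 / 10 /\ -2 < s.
  move=> /uvs /andP[h1 h2]; have := real_normK (num_real s).
  move: h2; rewrite ler_norml => /andP[? ?] E.
  split; last lra.
  by rewrite -E; apply/andP; split; nra.
have dPhi s : u <= s <= v -> is_derive s 1 (Phi n) (K n s).
  by move=> /bnd[_ ?]; exact: is_derive_kernel_prim.
apply/andP; split.
  rewrite subr_ge0; apply: (@derive_mono R (Phi n) (fun s => K n s)) => // s /bnd[/andP[h _] _].
  by rewrite horner_kernel exprn_ge0.
have Q0 : 0 <= (9 / 10 : R) ^+ n by rewrite exprn_ge0; lra.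
have h : ((9 / 10 : R) ^+ n *: id - Phi n) u <= ((9 / 10 : R) ^+ n *: id - Phi n) v.
  apply: (@derive_mono R ((9 / 10 : R) ^+ n *: id - Phi n) (fun s => (9 / 10) ^+ n *: 1 - K n s)) => // s us.
    by apply: is_deriveB (dPhi _ us); exact: is_deriveZ.
  have [/andP[h1 h2] _] := bnd _ us.
  rewrite [_ *: 1]mulr1 subr_ge0 horner_kernel lerXn2r ?nnegrE//; lra.
have E w : ((9 / 10 : R) ^+ n *: id - Phi n) w = (9 / 10) ^+ n * w - Phi n w by [].
move: h; rewrite !E; nra.
Qed.

(* Its derivative lies slightly above [s ^+ 2 * K n s]. *)
Definition moment_prim n s := (2 * n.+1%:R)^-1 * (Phi n s - s * K n.+1 s).

(** Integration by parts: the derivative of s K_(n+1) is K_n - (2n + 3) s^2 K_n. *)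
Lemma is_derive_moment n s : -2 < s -> is_derive s 1 (moment_prim n)
  ((2 * n.+1%:R)^-1 * ((2 * n.+1%:R + 1) * (s ^+ 2 * K n s))).
Proof.
move=> s2.
have E : moment_prim n = (2 * n.+1%:R)^-1 *: (Phi n - horner ('X * kernel_poly R n.+1)).
  by apply: funext => t; rewrite /moment_prim -[RHS]/((2 * n.+1%:R)^-1 * (Phi n t - _)) hornerM hornerX.
rewrite E.
have d1 := is_deriveB (is_derive_kernel_prim n s2) (is_derive_poly_eq s (erefl ('X * kernel_poly R n.+1)^`())).
apply: (is_derive_eq (is_deriveZ _ d1)).
rewrite -[LHS]/((2 * n.+1%:R)^-1 * _); congr (_ * _).
rewrite derivM derivX mul1r /kernel_poly deriv_exp /= derivB derivC derivXn !hornerE.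
rewrite hornerMn hornerM hornerN hornerMn hornerXn -mulr_natl /= !horner_exp !hornerE /= (exprS (1 - s ^+ 2) n).
set X := _ ^+ n; rewrite -[RHS]/((2 * n.+1%:R + 1) * s * s * X); ring.
Qed.

(** The boundary terms s K_(n+1)(s) have the favourable sign because u <= 0 <= v. The second moment
    is therefore at most the mass divided by 2(n + 1). *)
Lemma moment_increment n u v : -1 <= u <= 0 -> 0 <= v <= 1 ->
  moment_prim n v - moment_prim n u <= (2 * n.+1%:R)^-1 * (Phi n v - Phi n u).
Proof.
move=> /andP[u1 u0] /andP[v0 v1]; rewrite /moment_prim -mulrBr.
rewrite ler_wpM2l ?invr_ge0 ?mulr_ge0//.
have : 0 <= v * K n.+1 v by rewrite mulr_ge0// kernel_ge0//; lra.
have : 0 <= (- u) * K n.+1 u by rewrite mulr_ge0 ?oppr_ge0// kernel_ge0//; lra.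
lra.
Qed.

(** With U = u^2 and V = v^2, the squared modulus of 1 - (u + iv)^2 is (1 - U + V)^2 + 4UV, at most
    (7/8)^2 + 100/4096 < (9/10)^2. This controls the vertical sides of the rectangle. *)
Lemma normc_kernel (u v : R) n : 3 / 8 <= `|u| <= 5 / 8 -> `|v| <= 8^-1 ->
  normc (kernel_poly R[i] n).[u +i* v] <= (9 / 10) ^+ n.
Proof.
move=> /andP[u1 u2] v1; rewrite horner_kernel normcX.
have c0 : 0 <= 9 / 10 :> R by lra.
rewrite lerXn2r ?nnegrE ?normc_ge0//.
rewrite expr2; have -> : 1 - (u +i* v) * (u +i* v) = (1 - (u ^+ 2 - v ^+ 2)) +i* (- (2 * (u * v))).
  by apply/eqP; rewrite eq_complex /=; apply/andP; split; apply/eqP; ring.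
rewrite /normc -[leRHS]ger0_norm// -sqrtr_sqr ler_sqrt ?sqr_ge0//.
have EU := real_normK (num_real u); have EV := real_normK (num_real v).
have hU : 9 / 64 <= u ^+ 2 <= 25 / 64 by rewrite -EU; apply/andP; split; nra.
have hV : 0 <= v ^+ 2 <= 64^-1 by rewrite -EV sqr_ge0; have := normr_ge0 v; nra.
rewrite sqrrN exprMn exprMn; move: hU hV; set U := u ^+ 2; set V := v ^+ 2.
move=> /andP[? ?] /andP[? ?].
have : (1 - (U - V)) ^+ 2 <= (7 / 8) ^+ 2 by rewrite lerXn2r ?nnegrE; lra.
have : U * V <= 25 / 64 * 64^-1 by rewrite ler_pM//; lra.
lra.
Qed.

(** The factor n + 1 is at most 20 (21/20)^n, and (21/20)(9/10) = 189/200 < 1. *)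
Lemma kernel_power_eventually (C e : R) : 0 < e ->
  exists H, forall n, (H <= n)%N -> C * (n.+1%:R * (9 / 10) ^+ n) < e.
Proof.
move=> e0; have th : 0 < (189 / 200 : R) < 1 by apply/andP; split; lra.
have [H hH] := geometric_eventually_lt (`|C| * 20) th e0.
exists H => n /hH; apply: le_lt_trans; rewrite -mulrA.
apply: (@le_trans _ _ (`|C| * (n.+1%:R * (9 / 10) ^+ n))).
  by rewrite ler_wpM2r ?ler_norm// mulr_ge0// exprn_ge0//; lra.
rewrite ler_wpM2l//.
have -> : 189 / 200 = (21 / 20) * (9 / 10) :> R by lra.
rewrite (exprMn _ (21 / 20)) mulrA ler_wpM2r ?exprn_ge0//.
elim: n => [|n IH]; first by rewrite expr0; lra.
rewrite exprS -natr1.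
have : 1 <= (21 / 20 : R) ^+ n by rewrite exprn_ege1//; lra.
lra.
Qed.

End LandauKernel.

(** * Approximation of holomorphic functions by polynomials *)

Section PolynomialApproximation.
Variable R : realType.
Local Notation Re := (@complex.Re R).
Local Notation Im := (@complex.Im R).
Local Notation Phi := (kernel_prim (R := R)).
Local Notation J := (kernel_mass R).
Implicit Types (f g : R[i] -> R[i]) (z w p q : R[i]) (n k : nat).

Lemma holo_sum (F : nat -> R[i] -> R[i]) N : (forall k, holo (F k)) ->
  holo (fun w => \sum_(k < N) F k w).
Proof.
move=> hF; elim: N => [|N IH].
  by rewrite (_ : (fun w => _) = fun=> 0); [exact: holo_cst|apply: funext => w; rewrite big_ord0].
rewrite (_ : (fun w => _) = fun w => \sum_(k < N) F k w + F N w).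
  exact: holoD IH (hF N).
by apply: funext => w; rewrite big_ord_recr.
Qed.

Lemma cint_sum (F : nat -> R[i] -> R[i]) N p q (a b : R) : (forall k, holo (F k)) ->
  -2 < a -> a <= b ->
  cint (fun w => \sum_(k < N) F k w) p q a b = \sum_(k < N) cint (F k) p q a b.
Proof.
move=> hF a2 ab; elim: N => [|N IH].
  rewrite big_ord0 (_ : (fun w => _) = fun=> 0).
    by rewrite cint_cst// mul0r.
  by apply: funext => w; rewrite big_ord0.
rewrite big_ord_recr/= -IH -cintD//; last exact: holo_sum.
by congr cint; apply: funext => w; rewrite big_ord_recr.
Qed.

Definition landau_integrand f n z w := f w * (kernel_poly R[i] n).[z + (-1) * w].

Definition landau f n z := cint (landau_integrand f n z) 0 1 (- 2^-1) 2^-1.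

Lemma holo_kernel n z : holo (fun w => (kernel_poly R[i] n).[z + (-1) * w]).
Proof. exact: holo_comp_affine (holo_horner _). Qed.

(** The kernel at z - w is expanded as a polynomial in z with coefficients polynomial in w; the
    integrals of f against these are the coefficients of P. *)
Lemma landau_poly f n : holo f -> exists P : {poly R[i]}, forall z, P.[z] = landau f n z.
Proof.
move=> hf.
pose B : {poly {poly R[i]}} := (1 - ('X - ('X : {poly R[i]})%:P) ^+ 2) ^+ n.
have BE z w : (kernel_poly R[i] n).[z + (-1) * w] = \sum_(k < size B) z ^+ k * (B`_k).[w].
  have -> : (kernel_poly R[i] n).[z + (-1) * w] = (B.[z%:P]).[w].
    by rewrite horner_kernel /B !(horner_exp, hornerE) mulN1r.
  rewrite (horner_coef B) horner_sum; apply: eq_bigr => k _.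
  by rewrite hornerM horner_exp hornerC mulrC.
have hB k : holo (fun w => f w * (B`_k).[w]) := holoM hf (holo_horner _).
have a2 : -2 < - 2^-1 :> R by lra.
have ab : - 2^-1 <= 2^-1 :> R by lra.
exists (\poly_(k < size B) cint (fun w => f w * (B`_k).[w]) 0 1 (- 2^-1) 2^-1) => z.
rewrite horner_poly /landau.
rewrite (_ : landau_integrand f n z = fun w => \sum_(k < size B) z ^+ k * (f w * (B`_k).[w])).
  rewrite (cint_sum (F := fun k w => z ^+ k * (f w * (B`_k).[w])))//.
    by apply: eq_bigr => k _; rewrite cintZ// mulrC.
  by move=> k; exact: holoM (holo_cst _) (hB k).
apply: funext => w; rewrite /landau_integrand BE mulr_sumr.
by apply: eq_bigr => k _; rewrite mulrCA.
Qed.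

Lemma is_derive_translate (F : R -> R) (d t x : R) :
  is_derive (t - x) 1 F d -> is_derive t 1 (fun t => F (t - x)) d.
Proof.
move=> dF; have dg : is_derive t 1 (id - cst x : R -> R) (1 - 0).
  by apply: is_deriveB.
have := @is_derive1_comp R F (id - cst x) t d (1 - 0) dF dg.
by rewrite subr0 mulr1.
Qed.

Lemma kernel_on_line n (x y t : R) :
  (kernel_poly R[i] n).[(x +i* y) + (-1) * ((0 +i* y) + t%:C * 1)]
    = ((kernel_poly R n).[t - x])%:C.
Proof.
rewrite !horner_kernel (_ : (x +i* y) + _ = - (t - x)%:C).
  by rewrite sqrrN; move: (t - x) => s; rewrite rmorphXn rmorphB rmorph1 rmorphXn.
by apply/eqP; rewrite eq_complex /=; apply/andP; split; apply/eqP; ring.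
Qed.

Lemma cint_kernel n (x y a b : R) : -2 < a -> a <= b -> -2 < a - x ->
  cint (fun w => (kernel_poly R[i] n).[(x +i* y) + (-1) * w]) (0 +i* y) 1 a b
    = (Phi n (b - x) - Phi n (a - x))%:C.
Proof.
move=> a2 ab ax2; rewrite /cint.
have ER : (fun t : R => Re ((kernel_poly R[i] n).[(x +i* y) + (-1) * ((0 +i* y) + t%:C * 1)]))
    = fun t => (kernel_poly R n).[t - x].
  by apply: funext => t; rewrite kernel_on_line.
have EI : (fun t : R => Im ((kernel_poly R[i] n).[(x +i* y) + (-1) * ((0 +i* y) + t%:C * 1)]))
    = fun=> 0.
  by apply: funext => t; rewrite kernel_on_line.
have cR := continuous_Re_line (p := 0 +i* y) (q := 1) (holo_kernel n (x +i* y)).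
rewrite ER in cR; rewrite ER EI; congr (_ +i* _).
  have dF t : a <= t <= b ->
      is_derive t 1 (fun t => Phi n (t - x)) ((kernel_poly R n).[t - x]).
    by move=> /andP[t1 t2]; apply: is_derive_translate; apply: is_derive_kernel_prim; lra.
  by rewrite (rint_derive cR a2 ab dF).
have c0 : continuous (fun _ : R => 0 : R) by move=> t; exact: cvg_cst.
have d0 t : a <= t <= b -> is_derive t 1 (cst 0 : R -> R) 0.
  by move=> _; exact: is_derive_cst.
by rewrite (rint_derive c0 a2 ab d0) subrr.
Qed.

(* Cauchy's theorem moves the segment of integration to the height y, where the
   kernel is real and acts as an approximate identity. *)
Lemma landau_error f n (x y M e C : R) : holo f -> `|x| <= 8^-1 -> `|y| <= 8^-1 ->
    (forall w, in_rectangle (- 2^-1) (- 8^-1) 1 4^-1 w -> normc (f w) <= M) ->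
    0 <= e -> 0 <= C ->
    (forall t, - 2^-1 <= t <= 2^-1 ->
      normc (f (t +i* y) - f (x +i* y)) <= e + C * (t - x) ^+ 2) ->
  normc (landau f n (x +i* y) - f (x +i* y) * (J n)%:C)
    <= 2 * ((e + C * (2 * n.+1%:R)^-1) * (J n + 2 * (9 / 10) ^+ n)) + 4 * (M * (9 / 10) ^+ n).
Proof.
move=> hf; rewrite !ler_norml => /andP[x1 x2] /andP[y1 y2] fM e0 C0 fe.
set z := x +i* y; set Q := (9 / 10 : R) ^+ n.
have Q0 : 0 <= Q by rewrite exprn_ge0//; lra.
have a2 : -2 < - 2^-1 :> R by lra.
have ab : - 2^-1 <= 2^-1 :> R by lra.
have fz : normc (f z) <= M by apply: fM; rewrite /in_rectangle /=; apply/andP; split; apply/andP; split; lra.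
have M0 : 0 <= M by apply: le_trans fz; exact: normc_ge0.
have hk := holo_kernel n z.
have hg : holo (landau_integrand f n z) := holoM hf hk.
pose m := Phi n (2^-1 - x) - Phi n (- 2^-1 - x).
have /andP[mJ1 mJ2] : J n - 2 * Q <= m <= J n + 2 * Q.
  have t1 (u v : R) : u <= v -> v <= u + 1 ->
      (forall s, u <= s <= v -> 3 / 8 <= `|s| <= 5 / 8) ->
      0 <= Phi n v - Phi n u <= Q by exact: kernel_tail.
  have pos (u v s : R) : 3 / 8 <= u -> v <= 5 / 8 -> u <= s <= v -> 3 / 8 <= `|s| <= 5 / 8.
    by move=> ? ? /andP[? ?]; rewrite ger0_norm; [apply/andP; split|]; lra.
  have neg (u v s : R) : - (5 / 8) <= u -> v <= - (3 / 8) -> u <= s <= v -> 3 / 8 <= `|s| <= 5 / 8.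
    by move=> ? ? /andP[? ?]; rewrite ler0_norm; [apply/andP; split|]; lra.
  have A1 : - Q <= Phi n (2^-1 - x) - Phi n 2^-1 <= Q.
    case: (lerP 0 x) => x0.
      have /andP[? ?] := t1 (2^-1 - x) 2^-1 ltac:(lra) ltac:(lra)
        (fun s => @pos (2^-1 - x) 2^-1 s ltac:(lra) ltac:(lra)).
      by apply/andP; split; lra.
    have /andP[? ?] := t1 2^-1 (2^-1 - x) ltac:(lra) ltac:(lra)
        (fun s => @pos 2^-1 (2^-1 - x) s ltac:(lra) ltac:(lra)).
    by apply/andP; split; lra.
  have A2 : - Q <= Phi n (- 2^-1 - x) - Phi n (- 2^-1) <= Q.
    case: (lerP 0 x) => x0.
      have /andP[? ?] := t1 (- 2^-1 - x) (- 2^-1) ltac:(lra) ltac:(lra)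
        (fun s => @neg (- 2^-1 - x) (- 2^-1) s ltac:(lra) ltac:(lra)).
      by apply/andP; split; lra.
    have /andP[? ?] := t1 (- 2^-1) (- 2^-1 - x) ltac:(lra) ltac:(lra)
        (fun s => @neg (- 2^-1) (- 2^-1 - x) s ltac:(lra) ltac:(lra)).
    by apply/andP; split; lra.
  move: A1 A2 => /andP[? ?] /andP[? ?]; rewrite /m /kernel_mass.
  by apply/andP; split; lra.
have shifted : landau f n z = cint (landau_integrand f n z) (0 +i* y) 1 (- 2^-1) 2^-1
    - 'i * (cint (landau_integrand f n z) (2^-1 +i* 0) 'i 0 y
            - cint (landau_integrand f n z) (- 2^-1 +i* 0) 'i 0 y).
  have bi : boundary_integral (landau_integrand f n z) (- 2^-1) 2^-1 0 y = 0.
    have E1 : - 2^-1 + 1 = 2^-1 :> R by lra.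
    (* For y < 0 the rectangle runs from y up to 0, and its boundary integral is the opposite of the
       one wanted. *)
    have [y0|y0] := lerP 0 y.
      have := @goursat _ _ (- 2^-1) 1 0 y hg a2 ler01 ltac:(lra) y0.
      by rewrite E1 add0r.
    have := @goursat _ _ (- 2^-1) 1 y (- y) hg a2 ler01 ltac:(lra) ltac:(lra).
    rewrite E1 subrr /boundary_integral (cintN _ _ 'i 0 y) (cintN _ (- 2^-1 +i* 0) 'i 0 y) => bi0.
    by apply/eqP; rewrite -oppr_eq0; apply/eqP; rewrite -[RHS]bi0; ring.
  rewrite /landau (_ : 0 = 0 +i* 0 :> R[i])//.
  by apply/eqP; rewrite -subr_eq0; apply/eqP; rewrite -[RHS]bi /boundary_integral; ring.
have side (s : R) : 3 / 8 <= `|x - s| <= 5 / 8 -> - 2^-1 <= s <= 2^-1 ->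
    normc (cint (landau_integrand f n z) (s +i* 0) 'i 0 y) <= M * Q / 4.
  move=> xs /andP[s1 s2].
  have pt (t : R) : - 8^-1 <= t <= 8^-1 -> `|y - t| <= 8^-1 ->
      normc (landau_integrand f n z ((s +i* 0) + t%:C * 'i)) <= M * Q.
    move=> /andP[t1 t2] yt; rewrite verticalE /landau_integrand normcM.
    rewrite (_ : z + (-1) * (s +i* t) = (x - s) +i* (y - t)); last first.
      by apply/eqP; rewrite eq_complex /=; apply/andP; split; apply/eqP; ring.
    rewrite ler_pM ?normc_ge0 ?normc_kernel//.
    by apply: fM; rewrite /in_rectangle /=; apply/andP; split; apply/andP; split; lra.
  have MQ0 : 0 <= M * Q by rewrite mulr_ge0.
  have [y0|y0] := lerP 0 y.
    apply: le_trans (@cint_bound _ _ (s +i* 0) 'i 0 y (M * Q) hg ltac:(lra) y0 _) _.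
      move=> t /andP[t1 t2]; apply: pt; first by apply/andP; split; lra.
      by rewrite ger0_norm; lra.
    by rewrite subr0; nra.
  rewrite cintN normcN.
  apply: le_trans (@cint_bound _ _ (s +i* 0) 'i y 0 (M * Q) hg ltac:(lra) ltac:(lra) _) _.
    move=> t /andP[t1 t2]; apply: pt; first by apply/andP; split; lra.
    by rewrite ler0_norm; lra.
  by rewrite sub0r; nra.
have xs1 : 3 / 8 <= `|x - 2^-1| <= 5 / 8 by rewrite ler0_norm; [apply/andP; split|]; lra.
have xs2 : 3 / 8 <= `|x - - 2^-1| <= 5 / 8 by rewrite ger0_norm; [apply/andP; split|]; lra.
have S1 := side 2^-1 xs1 ltac:(apply/andP; split; lra).
have S2 := side (- 2^-1) xs2 ltac:(apply/andP; split; lra).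
have hg1 : holo (fun w => (f w + - f z) * (kernel_poly R[i] n).[z + (-1) * w]).
  exact: holoM (holoD hf (holo_cst _)) hk.
have main : cint (landau_integrand f n z) (0 +i* y) 1 (- 2^-1) 2^-1
    = cint (fun w => (f w + - f z) * (kernel_poly R[i] n).[z + (-1) * w]) (0 +i* y) 1 (- 2^-1) 2^-1
      + f z * m%:C.
  rewrite -(cint_kernel n y a2 ab); last lra.
  rewrite -(cintZ (f z))// -cintD//; last exact: holoM (holo_cst _) hk.
  congr cint; apply: funext => w; rewrite /landau_integrand -/z.
  by rewrite -mulrDl addrNK.
(* A primitive of a majorant of (e + C s^2) K_n(s), the bound for the integrand after f z has been
   subtracted. *)
pose E (s : R) := e * Phi n s + C * moment_prim n s.
have dE (s : R) : -2 < s -> is_derive s 1 E (e * (kernel_poly R n).[s]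
    + C * ((2 * n.+1%:R)^-1 * ((2 * n.+1%:R + 1) * (s ^+ 2 * (kernel_poly R n).[s])))).
  move=> s2; exact: (is_deriveD (is_deriveZ e (is_derive_kernel_prim n s2))
    (is_deriveZ C (is_derive_moment n s2))).
have near_part : normc (cint (fun w => (f w + - f z) * (kernel_poly R[i] n).[z + (-1) * w])
    (0 +i* y) 1 (- 2^-1) 2^-1) <= 2 * (E (2^-1 - x) - E (- 2^-1 - x)).
  apply: (@cint_le _ _ (0 +i* y) 1 (- 2^-1) 2^-1 (fun t => E (t - x)) (fun t =>
    e * (kernel_poly R n).[t - x] + C * ((2 * n.+1%:R)^-1 *
      ((2 * n.+1%:R + 1) * ((t - x) ^+ 2 * (kernel_poly R n).[t - x])))) hg1 a2 ab).
    move=> t /andP[t1 t2]; apply: is_derive_translate; apply: dE; lra.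
  move=> t tab; have /andP[t1 t2] := tab.
  have K0 : 0 <= (kernel_poly R n).[t - x] by apply: kernel_ge0; apply/andP; split; lra.
  rewrite normcM kernel_on_line normcR_ge0// horizontalE.
  apply: le_trans (ler_wpM2r K0 (fe t tab)) _.
  rewrite mulrDl lerD2l -mulrA ler_wpM2l// [leRHS]mulrA ler_peMl//.
    by rewrite mulr_ge0// sqr_ge0.
  by rewrite mulrDr mulr1 mulVf ?lerDl ?invr_ge0 ?mulf_neq0 ?pnatr_eq0.
have incr : E (2^-1 - x) - E (- 2^-1 - x) <= (e + C * (2 * n.+1%:R)^-1) * m.
  have := @moment_increment R n (- 2^-1 - x) (2^-1 - x) ltac:(apply/andP; split; lra)
    ltac:(apply/andP; split; lra).
  rewrite -/m => /(ler_wpM2l C0) h.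
  rewrite [leLHS](_ : _ = e * m + C * (moment_prim n (2^-1 - x) - moment_prim n (- 2^-1 - x))).
    by rewrite mulrDl lerD2l -mulrA.
  by rewrite /E /m; ring.
have em0 : 0 <= e + C * (2 * n.+1%:R)^-1 by rewrite addr_ge0// mulr_ge0// invr_ge0 mulr_ge0.
have mJ := ler_wpM2l em0 mJ2.
rewrite shifted main.
rewrite (_ : _ - _ = cint (fun w => (f w + - f z) * (kernel_poly R[i] n).[z + (-1) * w])
    (0 +i* y) 1 (- 2^-1) 2^-1 + (f z * (m - J n)%:C
    + - ('i * (cint (landau_integrand f n z) (2^-1 +i* 0) 'i 0 y
            - cint (landau_integrand f n z) (- 2^-1 +i* 0) 'i 0 y)))); last first.
  have -> : (m - J n)%:C = m%:C - (J n)%:C by rewrite (rmorphB (real_complex R) m (J n)).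
  by rewrite mulrBr; ring.
apply: le_trans (le_normcD _ _) _.
have N1 : normc (f z * (m - J n)%:C) <= M * (2 * Q).
  rewrite normcM normcR ler_pM ?normc_ge0// ler_norml; apply/andP; split; lra.
have ni : normc ('i : R[i]) = 1 by rewrite /normc expr0n/= add0r expr1n sqrtr1.
have N2 : normc (- ('i * (cint (landau_integrand f n z) (2^-1 +i* 0) 'i 0 y
            - cint (landau_integrand f n z) (- 2^-1 +i* 0) 'i 0 y))) <= M * Q / 4 + M * Q / 4.
  rewrite normcN normcM ni mul1r; apply: le_trans (le_normcD _ _) _.
  by rewrite normcN lerD.
have N3 := le_trans (le_normcD (f z * (m - J n)%:C) _) (lerD N1 N2).
apply: le_trans (lerD near_part N3) _.
have MQ0 : 0 <= M * Q by rewrite mulr_ge0.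
move: incr mJ MQ0; clear; set A := E _ - E _; set A1 := _ * m; set A2 := _ * (_ + _).
lra.
Qed.

Lemma holo_poly_approx_square f (e : R) : holo f -> 0 < e ->
  exists P : {poly R[i]}, forall x y : R, `|x| <= 8^-1 -> `|y| <= 8^-1 ->
    normc (P.[x +i* y] - f (x +i* y)) <= e.
Proof.
move=> hf e0.
have q0 : 0 <= 4^-1 :> R by lra.
have [M M0 fM] := @holo_bounded R f (- 2^-1) (- 8^-1) 1 4^-1 hf ler01 q0.
have e80 : 0 < e / 16 by lra.
have [d d0 fd] := @holo_unif_continuous R f (- 2^-1) (- 8^-1) 1 4^-1 _ hf ler01 q0 e80.
(* Far from x, where |t - x| >= d, the oscillation 2M is at most C (t - x)^2. One quadratic majorant
   thus covers near and far points, and the second moment handles it. *)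
pose C := 2 * M / d ^+ 2.
have C0 : 0 <= C by rewrite divr_ge0 ?mulr_ge0 ?exprn_ge0// ltW.
have [H1 h1] := kernel_power_eventually 1 (ltac:(lra) : 0 < 8^-1 :> R).
have [H2 h2] := kernel_power_eventually (8 * M) (ltac:(lra) : 0 < e / 2).
pose H3 := Num.bound (C / (e / 16)).
(* As 1 / J n <= 2(n + 1), these thresholds give C / (2(n + 1)) <= e/16, q / J n <= 1/4 and M q / J
   n <= e/8, where q = (9/10)^n. The two parts of the error are then e/2 each. *)
pose n := maxn H3 (maxn H1 H2).
have {}h1 := h1 n; have {}h2 := h2 n.
move: h1 h2; rewrite /n !leq_max !leqnn !orbT -/n => /(_ isT) h1 /(_ isT) h2.
have n1 : 0 < n.+1%:R :> R by rewrite ltr0n.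
have hC : C * (2 * n.+1%:R)^-1 <= e / 16.
  have q : 0 <= C / (e / 16) by rewrite divr_ge0// ltW.
  rewrite ler_pdivrMr ?mulr_gt0//.
  have : C / (e / 16) <= n.+1%:R.
    apply: le_trans (ltW (archi_boundP q)) _.
    by rewrite ler_nat leqW// /n leq_max leqnn.
  rewrite ler_pdivrMr// => /le_trans; apply; nra.
have Jge := kernel_mass_ge R n.
have J0 : 0 < J n by apply: lt_le_trans Jge; rewrite invr_gt0 mulr_gt0.
have Jn : (J n)^-1 <= 2 * n.+1%:R.
  by rewrite -[leRHS]invrK lef_pV2 ?posrE ?invr_gt0 ?mulr_gt0.
have [P hP] := landau_poly n hf.
exists ((J n)^-1%:C *: P) => x y x8 y8; set z := x +i* y.
have zr : in_rectangle (- 2^-1) (- 8^-1) 1 4^-1 z.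
  move: x8 y8; rewrite !ler_norml => /andP[? ?] /andP[? ?].
  by rewrite /in_rectangle /=; apply/andP; split; apply/andP; split; lra.
have fe t : - 2^-1 <= t <= 2^-1 -> normc (f (t +i* y) - f z) <= e / 16 + C * (t - x) ^+ 2.
  move=> /andP[t1 t2].
  have ntx : normc ((t +i* y) - z) = `|t - x|.
    rewrite (_ : _ - _ = (t - x)%:C) ?normcR//.
    by apply/eqP; rewrite eq_complex /= subrr !eqxx.
  have [lt|ge] := ltP (`|t - x|) d.
    apply: le_trans (fd z (t +i* y) zr _) _; first by rewrite ntx.
    by rewrite lerDl mulr_ge0// sqr_ge0.
  apply: (@le_trans _ _ (2 * M)).
    apply: le_trans (le_normcD _ _) _; rewrite normcN mulr2n mulrDl mul1r lerD//; apply: fM => //.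
    move: y8; rewrite ler_norml => /andP[? ?].
    by rewrite /in_rectangle /=; apply/andP; split; apply/andP; split; lra.
  apply: (@le_trans _ _ (C * (t - x) ^+ 2)); last by rewrite lerDr ltW.
  rewrite /C mulrAC ler_pdivlMr ?exprn_gt0// ler_wpM2l ?mulr_ge0 ?(ltW M0)//.
  by rewrite -(real_normK (num_real (t - x))) lerXn2r ?nnegrE ?normr_ge0// ltW.
have := landau_error n hf x8 y8 fM (ltW e80) C0 fe.
rewrite -/z -hP => err.
have -> : ((J n)^-1%:C *: P).[z] - f z = (J n)^-1%:C * (P.[z] - f z * (J n)%:C).
  rewrite hornerZ mulrBr; congr (_ - _); rewrite mulrCA -rmorphM/= mulVf ?gt_eqF//.
  by rewrite mulr1.
rewrite normcM normcR_ge0 ?invr_ge0 ?(ltW J0)//.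
apply: le_trans (ler_wpM2l _ err) _; first by rewrite invr_ge0 ltW.
set q := (9 / 10) ^+ n in h1 h2 err *.
have Q0 : 0 <= q by rewrite exprn_ge0//; lra.
have B1 : (J n)^-1 * q <= 4^-1.
  apply: le_trans (ler_wpM2r Q0 Jn) _; rewrite -mulrA; lra.
have B2 : M * ((J n)^-1 * q) <= e / 8.
  apply: le_trans (ler_wpM2l (ltW M0) (ler_wpM2r Q0 Jn)) _; lra.
have JJ : (J n)^-1 * J n = 1 by rewrite mulVf// gt_eqF.
rewrite [leLHS](_ : _ = 2 * ((e / 16 + C * (2 * n.+1%:R)^-1) * ((J n)^-1 * J n + 2 * ((J n)^-1 * q)))
  + 4 * (M * ((J n)^-1 * q))); last by ring.
have em : e / 16 + C * (2 * n.+1%:R)^-1 <= e / 8.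
  by rewrite (_ : e / 8 = e / 16 + e / 16); [rewrite lerD2l|lra].
have em0 : 0 <= e / 16 + C * (2 * n.+1%:R)^-1.
  by rewrite addr_ge0 ?mulr_ge0 ?invr_ge0 ?mulr_ge0 ?ltW.
have B3 : (J n)^-1 * J n + 2 * ((J n)^-1 * q) <= 2 by rewrite JJ; lra.
have B30 : 0 <= (J n)^-1 * J n + 2 * ((J n)^-1 * q).
  by rewrite JJ addr_ge0// mulr_ge0// mulr_ge0// invr_ge0 ltW.
move: (ler_pM em0 B30 em B3) B2; set X := _ * (_ + _); set Y := M * _; lra.
Qed.

Theorem holo_poly_approx f (r e : R) : holo f -> 0 < r -> 0 < e ->
  exists P : {poly R[i]}, forall z, normc z <= r -> normc (P.[z] - f z) <= e.
Proof.
(* Scaling by 8r brings the disc of radius r into the square of half-side 1/8. *)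
move=> hf r0 e0; pose s : R := 8 * r.
have s0 : 0 < s by rewrite mulr_gt0.
have [P hP] := holo_poly_approx_square (holo_comp_affine 0 s%:C hf) e0.
exists (P \Po (s^-1%:C *: 'X)) => z zr.
have ss : s%:C * (s^-1%:C * z) = z.
  by rewrite mulrA -rmorphM/= mulfV ?gt_eqF// mul1r.
have sz : normc (s^-1%:C * z) <= 8^-1.
  rewrite normcM normcR_ge0 ?invr_ge0 ?(ltW s0)// mulrC ler_pdivrMr//.
  by rewrite /s mulrA mulVf ?mul1r// pnatr_eq0.
have := hP (Re (s^-1%:C * z)) (Im (s^-1%:C * z)).
rewrite (_ : _ +i* _ = s^-1%:C * z); last by case: (s^-1%:C * z).
rewrite add0r ss horner_comp hornerZ hornerX; apply.
  exact: le_trans (normc_ge_absRe _) sz.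
exact: le_trans (normc_ge_absIm _) sz.
Qed.

End PolynomialApproximation.

(** * Entire limits of polynomials *)

Section Derivable.
Variable R : realType.
Implicit Types (f : R[i] -> R[i]) (z L : R[i]).

Lemma complex_gt0 (e : R[i]) : 0 < e -> exists2 e' : R, 0 < e' & e = e'%:C.
Proof.
move=> e0; exists (complex.Re e); first by move: e0; rewrite ltcE => /andP[].
by move: e0; case: e => a b; rewrite ltcE /= => /andP[/eqP-> _].
Qed.

Lemma cdiff_cvg f z L : cdiff f z L ->
  (fun h : R[i] => h^-1 *: (f (h + z) - f z)) @ 0^' --> L.
Proof.
move=> df; apply/cvgrPdist_le => e /complex_gt0[e' e'0 ->].
have [d d0 hd] := df e' e'0.
apply/nbhs_ballP; exists d%:C; first by rewrite /= ltcR.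
move=> h; rewrite -ball_normE /= sub0r normrN normr_normc ltcR => /hd hh h0.
rewrite normr_normc lecR -[_ *: _]/(h^-1 * (f (h + z) - f z)).
have -> : L - h^-1 * (f (h + z) - f z) = - (h^-1 * (f (z + h) - f z - L * h)).
  by rewrite (addrC h z); field.
by rewrite normcN normcM normcV mulrC ler_pdivrMr// normc_gt0.
Qed.

Lemma cdiff_derive1 f z L : cdiff f z L -> derive1 f z = L.
Proof. by move=> /cdiff_cvg df; apply: cvg_lim df; exact: norm_hausdorff. Qed.

Lemma cdiff_derivable f z L : cdiff f z L -> derivable f z 1.
Proof.
move=> /cdiff_cvg df; apply/cvg_ex; exists L.
have E : (fun h : R[i] => h^-1 *: (f (h + z) - f z))
    = (fun h : R[i] => h^-1 *: ((f \o shift z) (h *: 1) - f z)).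
  by apply: funext => h /=; rewrite -[h *: 1]/(h * 1) mulr1.
by rewrite E in df.
Qed.

Lemma derivable_holo f : (forall z, derivable f z 1) -> holo f.
Proof.
move=> df z; have /cvg_ex[L hL] := df z; exists L => e e0.
have e0' : 0 < e%:C by rewrite ltcR.
move: hL => /cvgrPdist_le/(_ _ e0')/nbhs_ballP[d /= /complex_gt0[d' d'0 ->] hd].
exists d' => // h hd'; have [->|h0] := eqVneq h 0.
  by rewrite addr0 subrr mulr0 subr0 normc0 mulr0.
have := hd h; rewrite -ball_normE /= sub0r normrN normr_normc ltcR => /(_ hd' h0).
rewrite normr_normc lecR -[_ *: (_ - _)]/(h^-1 * (f (h * 1 + z) - f z)) mulr1 addrC.
have -> : - (h^-1 * (f (h + z) - f z)) + L = - (h^-1 * (f (z + h) - f z - L * h)).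
  by rewrite (addrC h z); field.
by rewrite normcN normcM normcV mulrC ler_pdivrMr// normc_gt0.
Qed.

End Derivable.

(** * Limits of complex sequences *)

Section ComplexLimits.
Variable R : realType.
Implicit Types (a b : nat -> R[i]) (l m c : R[i]).

Definition ccvg a l := forall e : R, 0 < e -> exists t0, forall t, (t0 <= t)%N ->
  normc (a t - l) <= e.

Lemma ccvg_cst c : ccvg (fun=> c) c.
Proof. by move=> e e0; exists 0%N => t _; rewrite subrr normc0 ltW. Qed.

Lemma ccvgD a b l m : ccvg a l -> ccvg b m -> ccvg (fun t => a t + b t) (l + m).
Proof.
move=> al bm e e0; have e20 : 0 < e / 2 by rewrite divr_gt0.
have [t1 h1] := al _ e20; have [t2 h2] := bm _ e20.
exists (maxn t1 t2) => t; rewrite geq_max => /andP[/h1{}h1 /h2{}h2].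
rewrite opprD addrACA; apply: le_trans (le_normcD _ _) _.
by rewrite (splitr e) lerD.
Qed.

Lemma ccvgM a b l m : ccvg a l -> ccvg b m -> ccvg (fun t => a t * b t) (l * m).
Proof.
move=> al bm e e0.
have L0 := normc_ge0 l; have M0 := normc_ge0 m.
pose s := normc m + 1 + normc l.
have s0 : 0 < s by rewrite /s; lra.
have es : 0 < e / s by rewrite divr_gt0.
have [t1 h1] := al _ es; have [t2 h2] := bm _ es; have [t3 h3] := bm _ ltr01.
exists (maxn t1 (maxn t2 t3)) => t; rewrite !geq_max => /and3P[/h1{}h1 /h2{}h2 /h3{}h3].
have bt : normc (b t) <= normc m + 1.
  by rewrite -(subrK m (b t)) addrC; apply: le_trans (le_normcD _ _) _; rewrite lerD2l.
have -> : a t * b t - l * m = (a t - l) * b t + l * (b t - m) by ring.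
apply: le_trans (le_normcD _ _) _; rewrite !normcM.
apply: le_trans (lerD (ler_pM (normc_ge0 _) (normc_ge0 _) h1 bt) (ler_wpM2l L0 h2)) _.
by rewrite [normc l * _]mulrC -mulrDr -/s divfK// gt_eqF.
Qed.

Lemma ccvg_le a l c (B : R) : ccvg a l ->
  (exists t0, forall t, (t0 <= t)%N -> normc (a t - c) <= B) -> normc (l - c) <= B.
Proof.
move=> al [t0 h0]; apply/ler_addgt0Pr => e e0; have [t1 h1] := al e e0.
have {}h0 := h0 _ (leq_maxl t0 t1); have {}h1 := h1 _ (leq_maxr t0 t1).
rewrite -(subrKA (a (maxn t0 t1))); apply: le_trans (le_normcD _ _) _.
by rewrite addrC lerD// -normcN opprB.
Qed.

Lemma ccvg_unique a l m : ccvg a l -> ccvg a m -> l = m.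
Proof.
move=> al am; apply/eqP; rewrite -subr_eq0; apply/eqP; apply: eq0_normc.
apply/eqP; rewrite eq_le normc_ge0 andbT; apply/ler_addgt0Pr => e e0.
by rewrite add0r; apply: ccvg_le al _; exact: am.
Qed.

Lemma real_cauchy_cvg (x : nat -> R) :
  (forall e, 0 < e -> exists t0, forall t, (t0 <= t)%N -> `|x t - x t0| <= e) ->
  exists l : R, forall e, 0 < e -> exists t0, forall t, (t0 <= t)%N -> `|x t - l| <= e.
Proof.
move=> hx; have /cvg_ex[l hl] : cvgn x.
  apply/cauchy_cvgP/cauchy_exP => e e0.
  have e20 : 0 < e / 2 by rewrite divr_gt0.
  have [t0 ht0] := hx _ e20.
  exists (x t0); exists t0 => // t /= /ht0 h.
  rewrite /ball/= distrC; apply: le_lt_trans h _; lra.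
exists l => e e0; move: hl => /cvgrPdist_le/(_ _ e0)[t0 _ h].
by exists t0 => t /h /=; rewrite distrC.
Qed.

Lemma ccvg_exists a :
  (forall e, 0 < e -> exists t0, forall t, (t0 <= t)%N -> normc (a t - a t0) <= e) ->
  exists l, ccvg a l.
Proof.
move=> ha.
have [x hx] : exists x, forall e, 0 < e -> exists t0, forall t, (t0 <= t)%N ->
    `|complex.Re (a t) - x| <= e.
  apply: real_cauchy_cvg => e /ha[t0 h]; exists t0 => t /h.
  by rewrite -ReB; apply: le_trans; exact: normc_ge_absRe.
have [y hy] : exists y, forall e, 0 < e -> exists t0, forall t, (t0 <= t)%N ->
    `|complex.Im (a t) - y| <= e.
  apply: real_cauchy_cvg => e /ha[t0 h]; exists t0 => t /h.
  by rewrite -ImB; apply: le_trans; exact: normc_ge_absIm.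
exists (x +i* y) => e e0; have e20 : 0 < e / 2 by rewrite divr_gt0.
have [t1 h1] := hx _ e20; have [t2 h2] := hy _ e20.
exists (maxn t1 t2) => t; rewrite geq_max => /andP[/h1{}h1 /h2{}h2].
by apply: le_trans (normc_le_ReIm _) _; rewrite ReB ImB (splitr e) lerD.
Qed.

End ComplexLimits.

Section EntireLimits.
Variable R : realType.
Implicit Types (p q : {poly R[i]}) (P : nat -> {poly R[i]}) (f g : R[i] -> R[i]).
Implicit Types (r e : R) (z h : R[i]).

Definition pcauchy P := forall r e, 1 <= r -> 0 < e -> exists t0, forall t s,
  (t0 <= t)%N -> (t <= s)%N -> pnorm r (P s - P t) <= e.

Definition plim P f := forall z, ccvg (fun t => (P t).[z]) (f z).

Lemma normc_horner_le p z r : normc z <= r -> normc p.[z] <= pnorm r p.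
Proof.
by move=> zr; apply: le_trans (normc_horner _ _) _; apply: pnorm_le => //; exact: normc_ge0.
Qed.

Lemma plim_exists P : pcauchy P -> exists f, plim P f.
Proof.
move=> hP; suff H z : exists l, ccvg (fun t => (P t).[z]) l.
  by have [f hf] := choice H; exists f.
apply: ccvg_exists => e e0.
have r1 : 1 <= Num.max 1 (normc z) by rewrite le_max lexx.
have [t0 h] := hP _ _ r1 e0; exists t0 => t t0t.
rewrite -hornerN -hornerD; apply: le_trans (normc_horner_le _ _) (h _ _ (leqnn _) t0t).
by rewrite le_max lexx orbT.
Qed.

(** Doubling the radius pays for the factor i + 1 <= 2^(i + 1), so a sequence that is Cauchy at all
    radii has Cauchy derivatives. *)
Lemma pnorm_deriv r p : 1 <= r -> pnorm r p^`() <= pnorm (2 * r) p.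
Proof.
move=> r1; have r0 : 0 <= r by apply: le_trans r1.
rewrite (@pnorm_widen _ (size p)); last first.
  by rewrite (leq_trans (size_poly _ _))// leq_pred.
apply: le_trans (pnorm_partial p (1 + size p) _); last by rewrite mulr_ge0.
rewrite big_split_ord/= big_ord1 expr0 mulr1; apply: ler_wpDl; first exact: normc_ge0.
apply: ler_sum => i _; rewrite coef_deriv -[_ *+ i.+1]mulr_natl normcM normc_nat.
rewrite mulrC mulrA mulrC ler_wpM2l ?normc_ge0// exprMn.
rewrite mulrC ler_pM ?exprn_ge0//; last by rewrite ler_weXn2l.
by rewrite -natrX ler_nat ltnW// ltn_expl.
Qed.

Lemma pcauchy_deriv P : pcauchy P -> pcauchy (fun t => (P t)^`()).
Proof.
move=> hP r e r1 e0; have r2 : 1 <= 2 * r by lra.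
have [t0 h] := hP _ _ r2 e0; exists t0 => t s t0t ts.
by rewrite -derivB; apply: le_trans (pnorm_deriv _ r1) (h _ _ t0t ts).
Qed.

Lemma horner_deriv_sum p z :
  (p^`()).[z] = \sum_(l < size p) p`_l * (l%:R * z ^+ l.-1).
Proof.
rewrite {1}(_ : p = \sum_(l < size p) p`_l *: 'X^l); last by rewrite -[LHS]coefK poly_def.
rewrite linear_sum /= horner_sum; apply: eq_bigr => l _.
by rewrite derivZ hornerZ derivXn hornerMn hornerXn mulr_natl.
Qed.

Lemma horner_taylor2 p z h B : 1 <= B -> normc z <= B -> normc h <= B ->
  normc (p.[z + h] - p.[z] - (p^`()).[z] * h) <= normc h ^+ 2 * pnorm (4 * B) p.
Proof.
move=> B1 zB hB; have B0 : 0 <= B by apply: le_trans B1.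
have nC (c : R[i]) : pnorm 1 c%:P <= normc c.
  rewrite -[c%:P]mulr1 mul_polyC pnormZ pnorm1 mulr1//.
have H (l : nat) : exists Q : R[i], (z + h) ^+ l = z ^+ l + (l%:R * z ^+ l.-1) * h + h ^+ 2 * Q
    /\ normc Q <= (4 * B) ^+ l.
  have [Q eQ nQ] := taylor2_exp ler01 l B1 (le_trans (nC z) zB) (le_trans (nC h) hB).
  exists Q.[0]; split.
    by have := congr1 (fun p => p.[0]) eQ; rewrite !(hornerD, horner_exp, hornerM, hornerC, hornerMn).
  by apply: le_trans nQ; apply: normc_horner_le; rewrite normc0.
have [Q hQ] := choice H.
have -> : p.[z + h] - p.[z] - (p^`()).[z] * h = h ^+ 2 * \sum_(l < size p) p`_l * Q l.
  rewrite horner_deriv_sum !horner_coef mulr_suml mulr_sumr -!sumrB; apply: eq_bigr => l _.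
  by have [-> _] := hQ l; ring.
rewrite normcM normcX ler_wpM2l ?exprn_ge0 ?normc_ge0//.
apply: le_trans (normc_sum _ _ _) _; apply: ler_sum => l _.
by rewrite normcM ler_wpM2l ?normc_ge0//; have [] := hQ l.
Qed.

(** The second order Taylor bound holds for each [P t] with a constant bounded along the Cauchy
    sequence, so it passes to the pointwise limit. *)
Lemma plim_cdiff P f g : pcauchy P -> plim P f -> plim (fun t => (P t)^`()) g ->
  forall z, cdiff f z (g z).
Proof.
move=> hP Pf Pg z.
pose B := normc z + 1.
have z0 := normc_ge0 z.
have B1 : 1 <= B by rewrite /B; lra.
have B4 : 1 <= 4 * B by lra.
have B40 : 0 <= 4 * B by lra.
have [t0 ht0] := hP _ _ B4 ltr01.
pose C := pnorm (4 * B) (P t0) + 1.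
have C0 : 0 < C by rewrite ltr_wpDl ?pnorm_ge0.
have bound h : normc h <= 1 -> normc (f (z + h) - f z - g z * h) <= normc h ^+ 2 * C.
  move=> h1.
  have cv : ccvg (fun t => (P t).[z + h] + (- 1) * (P t).[z] + (- h) * ((P t)^`()).[z])
      (f (z + h) + (- 1) * f z + (- h) * g z).
    by apply: ccvgD; [apply: ccvgD; [exact: Pf|apply: ccvgM (ccvg_cst _) (Pf z)]|
      apply: ccvgM (ccvg_cst _) (Pg z)].
  rewrite -[_ - _ - _]subr0.
  have -> : f (z + h) - f z - g z * h = f (z + h) + (- 1) * f z + (- h) * g z by ring.
  apply: ccvg_le cv _; exists t0 => t t0t; rewrite subr0.
  have -> : (P t).[z + h] + (- 1) * (P t).[z] + (- h) * ((P t)^`()).[z]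
    = (P t).[z + h] - (P t).[z] - ((P t)^`()).[z] * h by ring.
  apply: le_trans (horner_taylor2 _ B1 _ _) _; [by rewrite /B; lra|by rewrite /B; lra|].
  rewrite ler_wpM2l ?exprn_ge0 ?normc_ge0// /C.
  rewrite -(subrK (P t0) (P t)) addrC; apply: le_trans (pnormD _ _ B40) _.
  by rewrite lerD2l ht0.
move=> e e0; exists (Num.min 1 (e / C)); first by rewrite lt_min ltr01 divr_gt0.
move=> h; rewrite lt_min => /andP[h1 h2].
apply: le_trans (bound h (ltW h1)) _; rewrite expr2 -mulrA mulrC ler_wpM2r ?normc_ge0//.
by rewrite -ler_pdivlMr// ltW.
Qed.

Lemma plim_derive1 P f : pcauchy P -> plim P f ->
  (forall z, derivable f z 1) /\ plim (fun t => (P t)^`()) (derive1 f).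
Proof.
move=> hP Pf; have [g Pg] := plim_exists (pcauchy_deriv hP).
have df := plim_cdiff hP Pf Pg.
split; first by move=> z; exact: cdiff_derivable (df z).
by rewrite (_ : derive1 f = g)//; apply: funext => z; exact: cdiff_derive1.
Qed.

Lemma plim_iter P (f : compact_cvg_fun R) n : pcauchy P -> plim P f ->
  pcauchy (fun t => (P t)^`(n)) /\ plim (fun t => (P t)^`(n)) (iter n (@derivation R) f).
Proof.
move=> hP Pf; elim: n => [|n [IH1 IH2]]; first by split.
split.
  exact: pcauchy_deriv IH1.
by have [_ h] := plim_derive1 IH1 IH2.
Qed.

Lemma shiftn_fact n p : shiftn (fun k => k`!%:R) n p = p^`(n).
Proof.
apply/polyP => i; rewrite coef_shiftn coef_derivn addnC -[RHS]mulr_natl; congr (_ * _).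
rewrite -(@ffact_fact (n + i) n) ?leq_addr// addKn natrM mulfK ?pnatr_eq0 -?lt0n ?fact_gt0//.
by rewrite rmorph_nat.
Qed.

Lemma pcauchy_comp (Q : {poly R[i]}) P : pcauchy P -> pcauchy (fun t => Q \Po P t).
Proof.
move=> hP r e r1 e0; have r0 : 0 <= r by apply: le_trans r1.
have [t0 ht0] := hP r 1 r1 ltr01.
pose B := pnorm r (P t0) + 1.
have B1 : 1 <= B by rewrite lerDr pnorm_ge0.
have PB t : (t0 <= t)%N -> pnorm r (P t) <= B.
  move=> t0t; rewrite -(subrK (P t0) (P t)) addrC; apply: le_trans (pnormD _ _ r0) _.
  by rewrite lerD2l ht0.
pose c := \sum_(l < size Q) normc Q`_l * (l%:R * B ^+ l).
have c0 : 0 <= c.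
  by apply: sumr_ge0 => l _; rewrite !mulr_ge0 ?normc_ge0 ?exprn_ge0 ?(le_trans _ B1).
have ec : 0 < e / (c + 1) by rewrite divr_gt0// ltr_wpDl.
have [t1 ht1] := hP r _ r1 ec.
exists (maxn t0 t1) => t s; rewrite geq_max => /andP[t0t t1t] ts.
have -> : P s = P t + (P s - P t) by rewrite addrC subrK.
rewrite !comp_polyE -sumrB; apply: le_trans (pnorm_sum _ _ _ r0) _.
apply: (@le_trans _ _ (e / (c + 1) * c)); last first.
  by rewrite mulrAC ler_pdivrMr ?ltr_wpDl// ler_wpM2l ?(ltW e0)// lerDl.
rewrite /c mulr_sumr; apply: ler_sum => l _.
rewrite -scalerBr pnormZ mulrCA ler_wpM2l ?normc_ge0//.
apply: le_trans (pnorm_expB r0 l B1 (PB _ t0t) _) _.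
  by rewrite addrC subrK PB// (leq_trans t0t).
rewrite ler_wpM2r ?ht1//.
by rewrite mulr_ge0 ?exprn_ge0 ?(le_trans _ B1).
Qed.

End EntireLimits.

(** * The algebra in H(C) *)

Section EntireAlgebra.
Variable R : realType.
Implicit Types (z : R[i]).

Lemma continuous_normc : continuous (@normc R).
Proof.
move=> z; apply/(@cvgrPdist_le R R^o _ (nbhs z)) => e e0.
suff : nbhs z [set w | `|normc z - normc w| <= e] by [].
apply/nbhs_ballP; exists e%:C; first by rewrite /= ltcR.
move=> w; rewrite -ball_normE /= normr_normc ltcR => /ltW zw.
apply: le_trans zw; rewrite ler_norml lerBrDr lerBlDr addrC; apply/andP; split.
  rewrite lerBlDr; have := le_normcD (- (z - w)) z.
  by rewrite normcN opprB subrK addrC.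
by have := le_normcD (z - w) w; rewrite subrK.
Qed.

(* The discs of integer radius generate a filter finer than the neighbourhood
   filter, since compact sets are bounded. *)
Lemma nbhs_compact_cvg (y : compact_cvg_fun R) (U : set (compact_cvg_fun R)) : nbhs y U ->
  exists r e : R, [/\ 0 < r, 0 < e & forall g : compact_cvg_fun R,
    (forall z, normc z <= r -> normc (g z - y z) <= e) -> U g].
Proof.
pose V n := [set g : R[i] -> R[i] |
  forall z, normc z <= n.+1%:R -> normc (g z - y z) <= n.+1%:R^-1].
pose F := filter_from setT V.
have FF : Filter F.
  apply: filter_fromT_filter; first by exists 0%N.
  move=> i j; exists (maxn i j) => g Vg.
  have le k : (k <= maxn i j)%N -> V k g.
    move=> km z zk; apply: (@le_trans _ _ (maxn i j).+1%:R^-1).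
      by apply: Vg; apply: le_trans zk _; rewrite ler_nat.
    by rewrite lef_pV2 ?posrE ?ltr0n// ler_nat.
  by split; apply: le; rewrite ?leq_maxl ?leq_maxr.
have Fy : {family compact, F --> (y : R[i] -> R[i])}.
  apply/fam_cvgP => A cA P /uniform_nbhs[E [entE EP]].
  move: entE; rewrite -entourage_ballE => -[e /= /complex_gt0[e' e'0 ->] eE].
  have [M hM] : exists M : nat, forall z, A z -> normc z <= M%:R.
    have cN : compact (@normc R @` A).
      by apply: continuous_compact cA; apply: continuous_subspaceT; exact: continuous_normc.
    have [M [_ hM]] := compact_bounded cN.
    have M1 : M < `|M| + 1 by apply: le_lt_trans (ler_norm M) _; rewrite ltrDl.
    have M0 : 0 <= `|M| + 1 by rewrite addr_ge0.
    exists (Num.bound (`|M| + 1)) => z Az.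
    have zM : `|normc z| <= `|M| + 1 by apply: (hM _ M1); exists z.
    exact: le_trans (ler_norm _) (le_trans zM (ltW (archi_boundP M0))).
  pose n := maxn M (Num.bound (2 / e')).
  exists n => // g Vg; apply: EP => z Az; apply: eE => /=.
  rewrite -ball_normE /= distrC normr_normc ltcR.
  apply: (@le_lt_trans _ _ n.+1%:R^-1).
    by apply: Vg; apply: le_trans (hM _ Az) _; rewrite ler_nat leqW// leq_maxl.
  have e2 : 0 <= 2 / e' by rewrite divr_ge0// ltW.
  have : 2 / e' <= n.+1%:R.
    apply: le_trans (ltW (archi_boundP e2)) _.
    by rewrite ler_nat leqW// leq_maxr.
  rewrite ler_pdivrMr// => h.
  have n0 : 0 < n.+1%:R :> R by rewrite ltr0n.
  rewrite -[ltRHS]mul1r -ltr_pdivrMr// mulrC -invfM.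
  by rewrite invf_lt1 ?mulr_gt0//; lra.
move=> /Fy[n _ nU]; exists n.+1%:R, n.+1%:R^-1; split.
- by rewrite ltr0n.
- by rewrite invr_gt0 ltr0n.
- by move=> g hg; apply: nU.
Qed.

Theorem entire_algebra : exists A : set (compact_cvg_fun R),
  upper_frequently_hypercyclic_algebra (@entire R) (@fun_mul R) (@derivation R) A.
Proof.
have hW := factorial_admissible R.
have ok_rad n : 1 <= n.+1%:R :> R by rewrite ler1n.
have rad_cof (r : R) : 1 <= r -> exists n0, forall n, (n0 <= n)%N -> r <= n.+1%:R.
  move=> r1; have r0 : 0 <= r by apply: le_trans r1.
  exists (Num.bound r) => n rn; apply: le_trans (ltW (archi_boundP r0)) _.
  by rewrite ler_nat leqW.
have [u [_ ucau uhit]] := @universal_sequence R _ _ _ hW (fun n => n.+1%:R) ok_rad rad_cof.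
have hu : pcauchy u by move=> r e r1 e0; exact: ucau.
pose A := [set f : compact_cvg_fun R |
  exists P : {poly R[i]}, P`_0 = 0 /\ plim (fun t => P \Po u t) f].
have hit (f : compact_cvg_fun R) (P y : {poly R[i]}) (r e : R) :
    plim (fun t => P \Po u t) f -> (1 < size P)%N -> 0 < e ->
    exists2 p, (0 < p)%N & forall H, exists2 h, (H <= h)%N & forall k, (k * p <= h)%N ->
      forall z, normc z <= r -> normc (iter (2 * h + k * p) (@derivation R) f z - y.[z]) <= e.
  move=> Pf sP e0; have r1 : 1 <= Num.max 1 r by rewrite le_max lexx.
  have [p p0 hp] := uhit y P _ e r1 e0 sP.
  exists p => // H; have [h Hh [t0 ht0]] := hp H.
  exists h => // k kh z zr.
  have [_ cv] := plim_iter (2 * h + k * p) (pcauchy_comp P hu) Pf.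
  apply: ccvg_le (cv z) _; exists t0 => t t0t.
  rewrite -hornerN -hornerD; apply: le_trans (ht0 t t0t k kh).
  rewrite shiftn_fact; apply: normc_horner_le.
  by rewrite le_max zr orbT.
have entA f : A f -> entire f.
  move=> [P [_ Pf]]; have [d _] := plim_derive1 (pcauchy_comp P hu) Pf.
  exact: d.
exists A; split => //.
- split.
  + exists 0; split=> [|z]; first by rewrite coef0.
    have := ccvg_cst (0 : R[i]); congr ccvg.
    by apply: funext => t; rewrite comp_poly0 horner0.
  + move=> f g [P [P0 Pf]] [Q [Q0 Qg]]; exists (P + Q); split=> [|z].
      by rewrite coefD P0 Q0 addr0.
    have := ccvgD (Pf z) (Qg z); congr ccvg.
    by apply: funext => t; rewrite comp_polyD hornerD.
  + move=> c f [P [P0 Pf]]; exists (c *: P); split=> [|z].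
      by rewrite coefZ P0 mulr0.
    have := ccvgM (ccvg_cst c) (Pf z); congr ccvg.
    by apply: funext => t; rewrite comp_polyZ hornerZ.
  + move=> f g [P [P0 Pf]] [Q [Q0 Qg]]; exists (P * Q); split=> [|z].
      by rewrite coefM big_ord1 P0 mul0r.
    have := ccvgM (Pf z) (Qg z); congr ccvg.
    by apply: funext => t; rewrite comp_polyM hornerM.
- move=> A0.
  have uX : (fun t => 'X \Po u t) = u by apply: funext => t; rewrite comp_polyX.
  have [f uf] := plim_exists hu.
  have Af : A f by exists 'X; split; [rewrite coefX|rewrite uX].
  have f0 : f = (0 : compact_cvg_fun R) by move: Af; rewrite A0.
  rewrite -uX in uf.
  have [p _ hp] := hit f 'X 1 1 2^-1 uf ltac:(by rewrite size_polyX) ltac:(by rewrite invr_gt0).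
  have [h _ hh] := hp 0%N.
  have := hh 0%N (leq0n _) 0; rewrite normc0 => /(_ ler01).
  (* The zero function is the limit of zero polynomials, so its derivatives come from [plim_iter]
     and uniqueness of limits. *)
  have zero n : iter n (@derivation R) f = (0 : compact_cvg_fun R).
    have P0 : pcauchy (fun=> 0 : {poly R[i]}).
      by move=> r e _ e0; exists 0%N => t s _ _; rewrite subrr pnorm0 ltW.
    have f0' : plim (fun=> 0 : {poly R[i]}) f.
      by move=> z; rewrite f0 horner0; exact: ccvg_cst.
    have [_ cv] := plim_iter n P0 f0'.
    apply: funext => z; apply: ccvg_unique (cv z) _.
    by rewrite derivnC /=; case: n {cv} => [|n]; rewrite ?horner0; exact: ccvg_cst.
  rewrite zero hornerC -[(0 : compact_cvg_fun R) 0]/(0 : R[i]) sub0r normcN normc1.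
  lra.
move=> f [P [P0 Pf]] f0; split; first by apply: entA; exists P.
move=> U Uo [y0 [ey0 Uy0]].
have Pn0 : P != 0.
  apply/eqP => PE; apply: f0; apply: funext => z; apply: ccvg_unique (Pf z) _.
  have := ccvg_cst (0 : R[i]); congr ccvg.
  by apply: funext => t; rewrite PE comp_poly0 horner0.
have sP := comp_poly_coef_nonconstant P0 Pn0.
have [r [e [r0 e0 reU]]] := nbhs_compact_cvg (open_nbhs_nbhs (conj Uo Uy0)).
have e20 : 0 < e / 2 by rewrite divr_gt0.
(* The target y0 is only known to be complex differentiable; here it is replaced by a polynomial. *)
have [y hy] := holo_poly_approx (derivable_holo ey0) r0 e20.
have [p p0 hp] := hit f P y r (e / 2) Pf sP e20.
refine (@upper_density_gt0 R _ p p0 _) => H; have [h Hh hh] := hp H.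
exists h; first exact: Hh.
move=> k kh.
(* Open sets are traces on the entire functions, so the iterate must be shown entire as well as
   close to y0. *)
rewrite /setI /mkset; split.
  have [c1 c2] := plim_iter (2 * h + k * p) (pcauchy_comp P hu) Pf.
  by have [d _] := plim_derive1 c1 c2; exact: d.
apply: reU => z zr; rewrite -(subrKA y.[z]); apply: le_trans (le_normcD _ _) _.
by rewrite (splitr e) lerD// ?hh// hy.
Qed.

End EntireAlgebra.

Theorem corollary1p5 (R : realType) :
  (forall lambda : R, 1 < lambda ->
     exists A : set (ell1 R),
       upper_frequently_hypercyclic_algebra setT (@ell1_conv R)
         (fun x => lambda%:C *: backward_shift x) A) /\
  (exists A : set (compact_cvg_fun R),
     upper_frequently_hypercyclic_algebra (@entire R) (@fun_mul R)
       (@derivation R) A).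
Proof.
by split; [exact: ell1_algebra|exact: entire_algebra].
Qed.
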